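(* Let $K\ge0$, $0<\alpha<1$, $\beta>0$, $N>0$, $\delta>0$, and let $v:\mathbb{R}\to\mathbb{R}$ be an analytic function with $|u|<v(u)\le|u|+\delta$ for all $u\in\mathbb{R}$ (for instance $v(u)=(u^2+\delta^2)^{1/2}$). Let $\rho_0$ and $\rho_0u_0$ be real valued analytic functions on $\mathbb{T}$, independent of $\epsilon$, with $\rho_0(x)>0$ for all $x\in\mathbb{T}$. For $\epsilon>0$ consider the system of ODEs $$\frac{d}{dt}\rho(x,t,\epsilon)=\frac1\epsilon\big[(\rho u^+)(x-\epsilon,t,\epsilon)-(\rho v(u))(x,t,\epsilon)+(\rho u^-)(x+\epsilon,t,\epsilon)\big]+\epsilon^\beta,$$ $$\frac{d}{dt}(\rho u)(x,t,\epsilon)=\frac1\epsilon\big[(\rho u u^+)(x-\epsilon,t,\epsilon)-(\rho u\,v(u))(x,t,\epsilon)+(\rho u u^-)(x+\epsilon,t,\epsilon)\big]-\rho(x,t,\epsilon)\frac{\partial}{\partial x}\Phi(x,t,\epsilon),$$ where $$u^+=\frac{v(u)+u}{2},\qquad u^-=\frac{v(u)-u}{2},\qquad u(x,t,\epsilon)=\frac{(\rho u)(x,t,\epsilon)}{\rho(x,t,\epsilon)},$$ $$\Phi(x,t,\epsilon)=K\big[\log(\rho(\cdot,t,\epsilon)+\epsilon^N)*\phi_{\epsilon^\alpha}\big](x),$$ with initial conditions $\rho(\cdot,0,\epsilon)=\rho_0$, $(\rho u)(\cdot,0,\epsilon)=\rho_0u_0$. Then if $|t|$ is small enough the solution of this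 system tends, when $\epsilon\to0$, to the classical analytic solution of the isothermal gas equations with the same initial data; that is, there exist $t_0>0$ and $\epsilon_0>0$ such that for $0<\epsilon<\epsilon_0$ the solution is defined for $|t|<t_0$, and for every $t$ with $|t|<t_0$ the functions $\rho(\cdot,t,\epsilon)$ and $(\rho u)(\cdot,t,\epsilon)$ converge uniformly on $\mathbb{T}$, when $\epsilon\to0$, to $\rho(\cdot,t)$ and $(\rho u)(\cdot,t)$, where $(\rho,\rho u)$ is the classical analytic solution of $$\partial_t\rho+\partial_x(\rho u)=0,\qquad\partial_t(\rho u)+\partial_x(\rho u^2)+\rho\,\partial_x\Phi=0,\qquad\Phi=K\log\rho,$$ with initial data $(\rho_0,\rho_0u_0)$ at $t=0$.
   Context: $\mathbb{T}=\mathbb{R}/(2\pi\mathbb{Z})$; functions on $\mathbb{T}$ are identified with $2\pi$-periodic functions on $\mathbb{R}$, and the ODEs are considered in the Banach space $\mathcal{C}(\mathbb{T})$ of continuous functions on $\mathbb{T}$ with the sup norm. Products such as $\rho u^\pm$, $\rho u\,v(u)$ are evaluated at the indicated point. A function $\phi\in\mathcal{C}_c^\infty(\mathbb{R})$ is fixed with $\phi\ge 0$, $\phi(-x)=\phi(x)$ for all $x$, $\int\phi(x)\,dx=1$; for $\mu>0$, $\phi_\mu(x)=\frac1\mu\phi(\frac x\mu)$; $*$ denotes convolution on $\mathbb{R}$. The classical analytic solution is the unique analytic solution, for $|t|$ small, given by the Cauchy–Kovalevska theorem. *)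

(* Defs.v *)
From Stdlib Require Import Reals.
From Coquelicot Require Import Coquelicot.
Open Scope R_scope.

(** Functions on the torus [R / 2 pi Z] are [2 pi]-periodic functions on [R]. *)
Definition periodic (f : R -> R) : Prop := forall x, f (x + 2 * PI) = f x.

Definition in_CT (f : R -> R) : Prop := (forall x, continuous f x) /\ periodic f.

Definition analytic (f : R -> R) : Prop :=
  forall x0, exists (a : nat -> R) (r : R), 0 < r /\
    forall x, Rabs (x - x0) < r -> is_pseries a (x - x0) (f x).

(** Joint analyticity: near the base point [f] is the sum of an absolutely
    convergent double power series, the terms being grouped by total degree. *)
Definition analytic2_at (f : R -> R -> R) (s0 x0 : R) : Prop :=
  exists (a : nat -> nat -> R) (r : R), 0 < r /\
    forall s x, Rabs (s - s0) < r -> Rabs (x - x0) < r ->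
      let term i j := a i j * (s - s0) ^ i * (x - x0) ^ j in
      ex_series (fun n => sum_n (fun i => Rabs (term i (n - i)%nat)) n) /\
      is_series (fun n => sum_n (fun i => term i (n - i)%nat) n) (f s x).

Record mollifier (phi : R -> R) : Prop := {
  mollifier_smooth : forall n x, ex_derive_n phi n x;
  mollifier_support : exists A, forall x, A < Rabs x -> phi x = 0;
  mollifier_ge0 : forall x, 0 <= phi x;
  mollifier_even : forall x, phi (- x) = phi x;
  mollifier_int1 :
    is_RInt_gen phi (Rbar_locally m_infty) (Rbar_locally p_infty) 1
}.

Definition rescale (phi : R -> R) (mu x : R) : R := / mu * phi (x / mu).

Definition convolution (f g : R -> R) (x : R) : R :=
  RInt_gen (fun y => f (x - y) * g y)
    (Rbar_locally m_infty) (Rbar_locally p_infty).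

(** In the following, [rho] and [m] are the density and the momentum [rho u]
    at a fixed time, as functions of [x]. *)

Definition velocity (rho m : R -> R) (x : R) : R := m x / rho x.

Definition uplus (v : R -> R) (u : R) : R := (v u + u) / 2.
Definition uminus (v : R -> R) (u : R) : R := (v u - u) / 2.

Definition potential (K alpha N : R) (phi : R -> R) (eps : R) (rho : R -> R)
    (x : R) : R :=
  K * convolution (fun y => ln (rho y + Rpower eps N))
        (rescale phi (Rpower eps alpha)) x.

(** [transport v eps f u] is [(1/eps) [(f u^+)(x-eps) - (f v(u))(x) + (f u^-)(x+eps)]]. *)
Definition transport (v : R -> R) (eps : R) (f u : R -> R) (x : R) : R :=
  / eps * (f (x - eps) * uplus v (u (x - eps)) - f x * v (u x)
           + f (x + eps) * uminus v (u (x + eps))).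

Definition rhs_rho (beta : R) (v : R -> R) (eps : R) (rho m : R -> R)
    (x : R) : R :=
  transport v eps rho (velocity rho m) x + Rpower eps beta.

Definition rhs_m (K alpha N : R) (v phi : R -> R) (eps : R) (rho m : R -> R)
    (x : R) : R :=
  transport v eps (fun y => rho y * velocity rho m y) (velocity rho m) x
  - rho x * Derive (potential K alpha N phi eps rho) x.

(** [f] has derivative [l] at time [t] for the sup norm: on [R -> R] the
    neighbourhood filter [locally] is that of uniform convergence. *)
Definition is_derive_unif (f : R -> R -> R) (t : R) (l : R -> R) : Prop :=
  filterlim (fun h x => (f (t + h) x - f t x) / h) (locally' 0)
    (locally (T := fct_UniformSpace R R_UniformSpace) l).

Definition cvg_unif (f : R -> R -> R) (l : R -> R) : Prop :=
  filterlim f (at_right 0)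
    (locally (T := fct_UniformSpace R R_UniformSpace) l).

(** Solution on [|t| < T] of the system of ODEs, as a curve in [C(T) x C(T)];
    [rho t x], [m t x] have the time as first argument.  The right-hand side is
    meaningful only for nonvanishing density, hence the positivity clause: the
    phase space is the open set [rho > 0]. *)
Record ode_solution (K alpha beta N : R) (v phi rho0 m0 : R -> R)
    (eps T : R) (rho m : R -> R -> R) : Prop := {
  ode_rho_CT : forall t, Rabs t < T -> in_CT (rho t);
  ode_m_CT : forall t, Rabs t < T -> in_CT (m t);
  ode_rho_gt0 : forall t x, Rabs t < T -> 0 < rho t x;
  ode_rho_eq : forall t, Rabs t < T ->
    is_derive_unif rho t (rhs_rho beta v eps (rho t) (m t));
  ode_m_eq : forall t, Rabs t < T ->
    is_derive_unif m t (rhs_m K alpha N v phi eps (rho t) (m t));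
  ode_rho_init : forall x, rho 0 x = rho0 x;
  ode_m_init : forall x, m 0 x = m0 x
}.

(** Analytic solution on [|t| < T] of the isothermal gas equations. *)
Record classical_solution (K : R) (rho0 m0 : R -> R)
    (T : R) (rho m : R -> R -> R) : Prop := {
  cl_rho_analytic : forall t x, Rabs t < T -> analytic2_at rho t x;
  cl_m_analytic : forall t x, Rabs t < T -> analytic2_at m t x;
  cl_rho_periodic : forall t, Rabs t < T -> periodic (rho t);
  cl_m_periodic : forall t, Rabs t < T -> periodic (m t);
  cl_rho_gt0 : forall t x, Rabs t < T -> 0 < rho t x;
  cl_mass : forall t x, Rabs t < T ->
    Derive (fun s => rho s x) t + Derive (m t) x = 0;
  cl_momentum : forall t x, Rabs t < T ->
    Derive (fun s => m s x) t
    + Derive (fun y => rho t y * velocity (rho t) (m t) y ^ 2) x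
    + rho t x * Derive (fun y => K * ln (rho t y)) x = 0;
  cl_rho_init : forall x, rho 0 x = rho0 x;
  cl_m_init : forall x, m 0 x = m0 x
}.

(** [(rho, m)] is the unique solution for [sol] on [|t| < T]; any solution on
    [|t| < T'] coincides with it on the common interval. *)
Definition is_the_solution (sol : R -> (R -> R -> R) -> (R -> R -> R) -> Prop)
    (T : R) (rho m : R -> R -> R) : Prop :=
  sol T rho m /\
  forall T' rho' m', sol T' rho' m' ->
    forall t x, Rabs t < T -> Rabs t < T' ->
      rho' t x = rho t x /\ m' t x = m t x.

(* Main.v *)
Require Import Defs.
From Stdlib Require Import Arith ZArith Reals Lra Lia Psatz Classical ClassicalEpsilon.
From Coquelicot Require Import Coquelicot.
Open Scope R_scope.

(** Both systems are treated at once, the parameter [e] running over [0 <= e < 1]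
    with the gas equations at [e = 0].  At each point [x] the unknowns are
    expanded in formal series in [(t, z)], [z] being an increment of [x].
    Difference quotients are bounded by derivatives and convolution with the
    mollifier is a contraction, so one majorant, of the Cauchy-Kovalevska type,
    bounds the coefficients of the solution uniformly in [e].  Each coefficient
    of positive degree in [t] is given by those of lower degree, hence converges
    as [e -> 0]; dominated convergence of the power series in [t] then gives the
    uniform convergence of the solutions.  The solution of the ODE is unique
    since the right-hand side is Lipschitz on sets where the density is bounded
    below.  Two analytic solutions of the gas equations have the same Taylor
    coefficients in [t] at [t = 0], by induction on the degree, and agree by the
    identity theorem applied at each fixed [x]. *)

(** * Finite sums and weights *)

(** A shift by [e] and a convolution mix base points, so the unknown is the whole field of
    expansions at all [x], with bounds uniform in [x]. The predicate [reg] ties them together: the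
    formal [z]-derivative of a series is the [x]-derivative of its coefficients, and the mean value
    theorem then turns a difference quotient of coefficients into a formal derivative at another
    base point. The right-hand sides lose one derivative, a factor [n + k + 1] at degree [(n, k)].
    Time integration divides by [n + 1], and this quotient times the binomial [W n k] is
    [W (S n) k]; hence the binomials in the majorant. The factors [cw] make the weights stable under
    products with constant one. As [v], [ln] and the inverse have only local expansions, they are
    expanded at the value taken at [t = 0], [z = 0], fixed by the data (up to [e^N] inside the
    logarithm), and applied to a small remainder. Its size [eta] is chosen from the data alone,
    before the rates [sigma] and [tau], so that the choice of constants is not circular. *)

Lemma sum_ext (a b : nat -> R) (n : nat) :
  (forall i, (i <= n)%nat -> a i = b i) -> sum_f_R0 a n = sum_f_R0 b n.
Proof.
  intros H; induction n as [|n IH]; simpl.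
  - apply H; lia.
  - rewrite IH by (intros; apply H; lia). rewrite H by lia. reflexivity.
Qed.

Lemma sum_scal_l (a : nat -> R) (c : R) (n : nat) :
  sum_f_R0 (fun i => c * a i) n = c * sum_f_R0 a n.
Proof. induction n as [|n IH]; simpl; [|rewrite IH]; ring. Qed.

Lemma sum_minus_distr (a b : nat -> R) (n : nat) :
  sum_f_R0 (fun i => a i - b i) n = sum_f_R0 a n - sum_f_R0 b n.
Proof. induction n as [|n IH]; simpl; [|rewrite IH]; ring. Qed.

Lemma sum_zero (a : nat -> R) (n : nat) :
  (forall i, (i <= n)%nat -> a i = 0) -> sum_f_R0 a n = 0.
Proof.
  intros H; induction n as [|n IH]; simpl.
  - apply H; lia.
  - rewrite IH by (intros; apply H; lia). rewrite H by lia. ring.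
Qed.

Lemma sum_head (a : nat -> R) (n : nat) :
  sum_f_R0 a (S n) = a O + sum_f_R0 (fun i => a (S i)) n.
Proof. rewrite decomp_sum by lia. reflexivity. Qed.

Lemma sum_extend (a : nat -> R) (n m : nat) :
  (n <= m)%nat -> (forall i, (n < i <= m)%nat -> a i = 0) ->
  sum_f_R0 a m = sum_f_R0 a n.
Proof.
  intros Hnm H; induction m as [|m IH].
  - replace n with O by lia; reflexivity.
  - destruct (Nat.eq_dec n (S m)) as [->|Hne]; [reflexivity|].
    simpl. rewrite IH by (try lia; intros; apply H; lia). rewrite H by lia. ring.
Qed.

Lemma sum_abs_le (a b : nat -> R) (n : nat) :
  (forall i, (i <= n)%nat -> Rabs (a i) <= b i) ->
  Rabs (sum_f_R0 a n) <= sum_f_R0 b n.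
Proof.
  intros H. eapply Rle_trans; [apply Rsum_abs|]. apply sum_Rle; exact H.
Qed.

Lemma sum_half_pow (n : nat) : sum_f_R0 (fun j => (/2) ^ j) n <= 2.
Proof.
  assert (H : sum_f_R0 (fun j => (/2) ^ j) n = 2 - (/2) ^ n).
  { induction n as [|n IH]; simpl; [|rewrite IH]; field. }
  pose proof (pow_lt (/2) n ltac:(lra)); lra.
Qed.

(** The identity behind Leibniz' rule for products of formal power series. *)
Lemma sum_leibniz (p : nat -> nat -> R) (k : nat) :
  sum_f_R0 (fun l => INR (S l) * p (S l) (k - l)%nat) k
  + sum_f_R0 (fun l => INR (S (k - l)) * p l (S (k - l))) k
  = INR (S k) * sum_f_R0 (fun l => p l (S k - l)%nat) (S k).
Proof.
  transitivity (sum_f_R0 (fun l => INR l * p l (S k - l)%nat) (S k)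
    + sum_f_R0 (fun l => INR (S k - l) * p l (S k - l)%nat) (S k)).
  - f_equal.
    + rewrite sum_head. simpl INR at 2. rewrite Rmult_0_l, Rplus_0_l.
      apply sum_ext; intros; reflexivity.
    + rewrite tech5. replace (S k - S k)%nat with O by lia. simpl INR at 3.
      rewrite Rmult_0_l, Rplus_0_r. apply sum_ext; intros.
      replace (S k - i)%nat with (S (k - i)) by lia. reflexivity.
  - rewrite <- plus_sum, <- sum_scal_l. apply sum_ext; intros.
    rewrite <- Rmult_plus_distr_r, <- plus_INR. f_equal. f_equal. lia.
Qed.

Lemma INR_S_pos (n : nat) : 0 < INR (S n).
Proof. apply lt_0_INR; lia. Qed.

Lemma INR_S_ge1 (n : nat) : 1 <= INR (S n).
Proof. rewrite S_INR. pose proof (pos_INR n); lra. Qed.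

Lemma INR_S_le_pow2 (n : nat) : INR (S n) <= 2 ^ n.
Proof.
  induction n as [|n IH]; [simpl; lra|].
  rewrite S_INR. simpl pow. pose proof (INR_S_ge1 n). lra.
Qed.

(** The binomial coefficient of [n + k] over [n], written with factorials so that its recurrences in
    each index reduce to [field]. *)
Definition W (n k : nat) : R := INR (fact (n + k)) / (INR (fact n) * INR (fact k)).

Lemma W_0l (k : nat) : W 0 k = 1.
Proof. unfold W; simpl. field. apply INR_fact_neq_0. Qed.

Lemma W_0r (n : nat) : W n 0 = 1.
Proof. unfold W; rewrite Nat.add_0_r; simpl. field. apply INR_fact_neq_0. Qed.

Lemma W_succ_l (n k : nat) : INR (S n) * W (S n) k = INR (S (n + k)) * W n k.
Proof.
  unfold W. rewrite Nat.add_succ_l, !fact_simpl, !mult_INR. field.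
  repeat split; apply INR_fact_neq_0 || apply not_0_INR; lia.
Qed.

Lemma W_succ_r (n k : nat) : INR (S k) * W n (S k) = INR (S (n + k)) * W n k.
Proof.
  unfold W. rewrite Nat.add_succ_r, !fact_simpl, !mult_INR. field.
  repeat split; apply INR_fact_neq_0 || apply not_0_INR; lia.
Qed.

Lemma W_SS (n k : nat) : W (S n) (S k) = W n (S k) + W (S n) k.
Proof.
  unfold W. rewrite !Nat.add_succ_r, !Nat.add_succ_l, !fact_simpl, !mult_INR.
  rewrite !(S_INR (S (n + k))), !S_INR, plus_INR. field.
  pose proof (pos_INR n); pose proof (pos_INR k).
  repeat split; try apply INR_fact_neq_0; lra.
Qed.

Lemma W_ge1 (n k : nat) : 1 <= W n k.
Proof.
  revert k; induction n as [|n IHn]; intros k; [rewrite W_0l; lra|].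
  induction k as [|k IHk]; [rewrite W_0r; lra|].
  rewrite W_SS. specialize (IHn (S k)); lra.
Qed.

Lemma W_le_pow (n k : nat) : W n k <= 2 ^ (n + k).
Proof.
  revert k; induction n as [|n IHn]; intros k.
  - rewrite W_0l. apply pow_R1_Rle; lra.
  - induction k as [|k IHk]; [rewrite W_0r; apply pow_R1_Rle; lra|].
    rewrite W_SS. specialize (IHn (S k)).
    replace (S n + k)%nat with (n + S k)%nat in IHk by lia.
    replace (S n + S k)%nat with (S (n + S k)) by lia. simpl pow. lra.
Qed.

Lemma W_mono (n k l : nat) : W n k <= W n (k + l).
Proof.
  induction l as [|l IH]; [rewrite Nat.add_0_r; lra|].
  eapply Rle_trans; [exact IH|]. rewrite Nat.add_succ_r.
  destruct n as [|n]; [rewrite !W_0l; lra|].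
  rewrite W_SS. pose proof (W_ge1 n (S (k + l))); lra.
Qed.

Lemma W_sym (n k : nat) : W n k = W k n.
Proof. unfold W. rewrite (Nat.add_comm k n), (Rmult_comm (INR (fact n))). reflexivity. Qed.

(** The product is a single term of Vandermonde's sum for the right-hand side. The induction uses
    only Pascal's rule [W_SS] and monotonicity at the boundary. *)
Lemma W_submult (a b c d : nat) : W a b * W c d <= W (a + c) (b + d).
Proof.
  revert b; induction a as [|a IHa]; intros b.
  - rewrite W_0l, Rmult_1_l, (Nat.add_comm b). apply W_mono.
  - induction b as [|b IHb].
    + rewrite W_0r, Rmult_1_l, (W_sym c), (W_sym (S a + c)), (Nat.add_comm (S a)).
      apply W_mono.
    + rewrite W_SS, Rmult_plus_distr_r.
      replace (S a + c)%nat with (S (a + c)) in * by lia.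
      replace (S b + d)%nat with (S (b + d)) in * by lia.
      rewrite W_SS. specialize (IHa (S b)).
      replace (S b + d)%nat with (S (b + d)) in IHa by lia. lra.
Qed.

(** An inverse-square weight: its Cauchy square is of the order of the weight itself, and the factor
    [/ 8] brings the constant in [cw_conv] down to one, so that products accumulate no constants. *)
Definition cw (n : nat) : R := / 8 / INR (S n) ^ 2.

Lemma cw_pos (n : nat) : 0 < cw n.
Proof.
  unfold cw. apply Rdiv_lt_0_compat; [lra|].
  apply pow_lt, INR_S_pos.
Qed.

Lemma cw_decr (n : nat) : cw (S n) <= cw n.
Proof.
  unfold cw. apply Rmult_le_compat_l; [lra|].
  apply Rinv_le_contravar; [apply pow_lt, INR_S_pos|].
  apply pow_incr. rewrite (S_INR (S n)). pose proof (INR_S_pos n); lra.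
Qed.

Lemma cw_le1 (n : nat) : cw n <= 1.
Proof.
  induction n as [|n IH]; [unfold cw; change (INR 1) with 1; rewrite pow1; lra|].
  eapply Rle_trans; [apply cw_decr|exact IH].
Qed.

(** The price of raising a degree by one. The 4 reappears in [wt_succ_l], hence in [tau], and,
    iterated, in the comparison of [cw] with a geometric sequence that determines [sigma]. *)
Lemma cw_ratio (n : nat) : cw n <= 4 * cw (S n).
Proof.
  unfold cw. rewrite (S_INR (S n)).
  pose proof (INR_S_ge1 n) as H. set (x := INR (S n)) in *.
  replace (4 * (/ 8 / (x + 1) ^ 2)) with (/ 8 * / ((x + 1) ^ 2 / 4))
    by (field; lra).
  apply Rmult_le_compat_l; [lra|]. apply Rinv_le_contravar; [|nra].
  apply Rdiv_lt_0_compat; [apply pow_lt; lra|lra].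
Qed.

Lemma sum_rev (a : nat -> R) (n : nat) :
  sum_f_R0 (fun i => a (n - i)%nat) n = sum_f_R0 a n.
Proof.
  induction n as [|n IH]; [reflexivity|].
  rewrite sum_head, Nat.sub_0_r. simpl sum_f_R0. rewrite IH. ring.
Qed.

Lemma sum_inv_sqr (n : nat) :
  sum_f_R0 (fun i => / INR (S i) ^ 2) n <= 2 - / INR (S n).
Proof.
  induction n as [|n IH]; [simpl; rewrite !Rmult_1_l, Rinv_1; lra|].
  rewrite tech5, (S_INR (S n)).
  pose proof (INR_S_ge1 n) as H. set (x := INR (S n)) in *.
  assert (/ (x + 1) ^ 2 <= / x - / (x + 1)); [|lra].
  replace (/ x - / (x + 1)) with (/ (x * (x + 1))) by (field; lra).
  apply Rinv_le_contravar; nra.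
Qed.

(** [1/((i+1)(n-i+1))] is [1/(n+2)] times [1/(i+1) + 1/(n-i+1)]. *)
Lemma cw_conv (n : nat) :
  sum_f_R0 (fun i => cw i * cw (n - i)) n <= cw n.
Proof.
  apply Rle_trans with (sum_f_R0 (fun i => cw n *
    (/ 4 * (/ INR (S i) ^ 2) + / 4 * (/ INR (S (n - i)) ^ 2))) n).
  - apply sum_Rle; intros i Hi. unfold cw.
    assert (E : INR (S n) + 1 = INR (S i) + INR (S (n - i))).
    { rewrite <- S_INR, <- plus_INR. f_equal; lia. }
    pose proof (INR_S_ge1 i) as H1. pose proof (INR_S_ge1 (n - i)) as H2.
    set (x := INR (S i)) in *. set (y := INR (S (n - i))) in *.
    set (z := INR (S n)) in *.
    assert (Hz : 1 <= z) by lra.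
    replace (/ 8 / z ^ 2 * (/ 4 * / x ^ 2 + / 4 * / y ^ 2))
      with (/ 32 * (x ^ 2 + y ^ 2) / (z ^ 2 * (x ^ 2 * y ^ 2))) by (field; lra).
    replace (/ 8 / x ^ 2 * (/ 8 / y ^ 2))
      with (/ 64 * z ^ 2 / (z ^ 2 * (x ^ 2 * y ^ 2))) by (field; lra).
    apply Rmult_le_compat_r.
    + left; apply Rinv_0_lt_compat. repeat apply Rmult_lt_0_compat; nra.
    + assert (z ^ 2 <= (x + y) ^ 2) by (apply pow_incr; lra).
      pose proof (pow2_ge_0 (x - y)). simpl in *. lra.
  - rewrite sum_scal_l. rewrite <- (Rmult_1_r (cw n)) at 2.
    apply Rmult_le_compat_l; [left; apply cw_pos|].
    rewrite plus_sum, !sum_scal_l.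
    rewrite (sum_rev (fun i => / INR (S i) ^ 2)).
    pose proof (sum_inv_sqr n).
    pose proof (Rinv_0_lt_compat _ (INR_S_pos n)). lra.
Qed.

Lemma cw_0 : cw 0 = / 8.
Proof. unfold cw. simpl. field. Qed.

#[global] Opaque W cw.

(** * Formal power series in two variables *)

(** [f n k] is the coefficient of [t^n z^k] in the expansion of a function of
    [(t, x + z)] at the point [(0, x)]. *)
Definition arr := nat -> nat -> R.

Definition amul (f g : arr) : arr := fun n k =>
  sum_f_R0 (fun i => sum_f_R0 (fun l => f i l * g (n - i)%nat (k - l)%nat) k) n.

Definition aone : arr := fun n k =>
  match n, k with O, O => 1 | _, _ => 0 end.

Definition adz (f : arr) : arr := fun n k => INR (S k) * f n (S k).

Definition acut (f : arr) : arr := fun n k =>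
  match n, k with O, O => 0 | _, _ => f n k end.

Fixpoint apow (f : arr) (j : nat) : arr :=
  match j with O => aone | S j' => amul f (apow f j') end.

(** [H j] stands for [h^(j) / j!]; this is the expansion of [h o f]. *)
Definition acomp (H : nat -> R -> R) (f : arr) : arr := fun n k =>
  sum_f_R0 (fun j => H j (f O O) * apow (acut f) j n k) (n + k).

Lemma aone_eq0 (n k : nat) : (0 < n + k)%nat -> aone n k = 0.
Proof. destruct n, k; simpl; intros; lia || reflexivity. Qed.

Lemma acut_neq (f : arr) (n k : nat) : (0 < n + k)%nat -> acut f n k = f n k.
Proof. destruct n, k; simpl; intros; lia || reflexivity. Qed.

Lemma acut_split (f : arr) (n k : nat) :
  f n k = acut f n k + f O O * aone n k.
Proof. destruct n, k; simpl; ring. Qed.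

Lemma amul_ext (f f' g g' : arr) (n k : nat) :
  (forall i l, (i <= n)%nat -> (l <= k)%nat -> f i l = f' i l) ->
  (forall i l, (i <= n)%nat -> (l <= k)%nat -> g i l = g' i l) ->
  amul f g n k = amul f' g' n k.
Proof.
  intros Hf Hg. apply sum_ext; intros i Hi. apply sum_ext; intros l Hl.
  rewrite Hf, Hg by lia. reflexivity.
Qed.

Lemma amul_plus_l (f f' g : arr) (n k : nat) :
  amul (fun i l => f i l + f' i l) g n k = amul f g n k + amul f' g n k.
Proof.
  unfold amul. rewrite <- plus_sum. apply sum_ext; intros i _.
  rewrite <- plus_sum. apply sum_ext; intros; ring.
Qed.

Lemma amul_plus_r (f g g' : arr) (n k : nat) :
  amul f (fun i l => g i l + g' i l) n k = amul f g n k + amul f g' n k.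
Proof.
  unfold amul. rewrite <- plus_sum. apply sum_ext; intros i _.
  rewrite <- plus_sum. apply sum_ext; intros; ring.
Qed.

Lemma amul_scal_l (c : R) (f g : arr) (n k : nat) :
  amul (fun i l => c * f i l) g n k = c * amul f g n k.
Proof.
  unfold amul. rewrite <- sum_scal_l. apply sum_ext; intros i _.
  rewrite <- sum_scal_l. apply sum_ext; intros; ring.
Qed.

Lemma amul_scal_r (c : R) (f g : arr) (n k : nat) :
  amul f (fun i l => c * g i l) n k = c * amul f g n k.
Proof.
  unfold amul. rewrite <- sum_scal_l. apply sum_ext; intros i _.
  rewrite <- sum_scal_l. apply sum_ext; intros; ring.
Qed.

Lemma amul_1l (g : arr) (n k : nat) : amul aone g n k = g n k.
Proof.
  unfold amul. rewrite (sum_extend _ 0 n).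
  - simpl. rewrite Nat.sub_0_r, (sum_extend _ 0 k).
    + simpl. rewrite Nat.sub_0_r. ring.
    + lia.
    + intros i Hi. destruct i; [lia|simpl; ring].
  - lia.
  - intros i Hi. apply sum_zero; intros l _. destruct i; [lia|simpl; ring].
Qed.

Lemma amul_1r (g : arr) (n k : nat) : amul g aone n k = g n k.
Proof.
  unfold amul. rewrite <- sum_rev, (sum_extend _ 0 n).
  - simpl. rewrite Nat.sub_0_r, <- sum_rev, (sum_extend _ 0 k).
    + simpl. rewrite !Nat.sub_0_r, !Nat.sub_diag. simpl. ring.
    + lia.
    + intros i Hi. rewrite Nat.sub_diag.
      replace (k - (k - i))%nat with i by lia. destruct i; [lia|simpl; ring].
  - lia.
  - intros i Hi. apply sum_zero; intros l _.
    replace (n - (n - i))%nat with i by lia. destruct i; [lia|simpl; ring].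
Qed.

Lemma amul_00 (f g : arr) : amul f g O O = f O O * g O O.
Proof. reflexivity. Qed.

Lemma acomp_00 (H : nat -> R -> R) (f : arr) : acomp H f O O = H O (f O O).
Proof. unfold acomp; simpl. ring. Qed.

Lemma adz_amul (f g : arr) (n k : nat) :
  adz (amul f g) n k = amul (adz f) g n k + amul f (adz g) n k.
Proof.
  unfold adz, amul. rewrite <- sum_scal_l, <- plus_sum.
  apply sum_ext; intros i _.
  rewrite <- (sum_leibniz (fun a b => f i a * g (n - i)%nat b)).
  f_equal; apply sum_ext; intros l Hl; [ring|].
  ring.
Qed.

Lemma adz_aone (n k : nat) : adz aone n k = 0.
Proof. unfold adz. rewrite aone_eq0 by lia. ring. Qed.

(** Without constant term each factor has degree at least one, so the power [j] starts in total
    degree [j]. This makes the finite sum in [acomp] the complete composition. *)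
Lemma apow_order (f : arr) (j n k : nat) :
  f O O = 0 -> (n + k < j)%nat -> apow f j n k = 0.
Proof.
  intros H0. revert n k; induction j as [|j IH]; intros n k Hj; [lia|].
  simpl. apply sum_zero; intros i Hi. apply sum_zero; intros l Hl.
  destruct (Nat.eq_dec (i + l) 0) as [E|E].
  - replace i with O by lia; replace l with O by lia. rewrite H0; ring.
  - rewrite IH by lia. ring.
Qed.

Lemma acomp_trunc (H : nat -> R -> R) (f : arr) (n k J : nat) :
  (n + k <= J)%nat ->
  acomp H f n k = sum_f_R0 (fun j => H j (f O O) * apow (acut f) j n k) J.
Proof.
  intros HJ. symmetry. apply sum_extend; [exact HJ|].
  intros j Hj. rewrite apow_order; [ring|reflexivity|lia].
Qed.

Lemma apow_ext (f g : arr) (N j n k : nat) :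
  (forall i l, (i <= N)%nat -> f i l = g i l) -> (n <= N)%nat ->
  apow f j n k = apow g j n k.
Proof.
  intros H. revert n k; induction j as [|j IH]; intros n k Hn; [reflexivity|].
  simpl. apply amul_ext; intros; [apply H; lia|apply IH; lia].
Qed.

Lemma acomp_ext (H : nat -> R -> R) (f g : arr) (N n k : nat) :
  (forall i l, (i <= N)%nat -> f i l = g i l) -> (n <= N)%nat ->
  acomp H f n k = acomp H g n k.
Proof.
  intros E Hn. apply sum_ext; intros j _. rewrite E by lia. f_equal.
  apply (apow_ext _ _ N); [|exact Hn].
  intros i l Hi. destruct i, l; simpl; try reflexivity; apply E; exact Hi.
Qed.

(** * Weighted bounds *)

(** Since [W i l * W (n-i) (k-l) <= W n k] and [cw * cw <= cw] for the Cauchy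
    product, these weights are stable under products; and [W_succ_l], [W_succ_r]
    make them stable under one [x]-derivative followed by one integration in
    time, with a gain of [1 / tau]. *)
Definition wt (tau sigma : R) (n k : nat) : R :=
  W n k * cw n * cw k * tau ^ n * sigma ^ k.

Definition bd (tau sigma : R) (N : nat) (M : R) (f : arr) : Prop :=
  forall n k, (n <= N)%nat -> Rabs (f n k) <= M * wt tau sigma n k.

(** The extra factor accounts for one derivative. *)
Definition bd1 (tau sigma : R) (N : nat) (M : R) (f : arr) : Prop :=
  forall n k, (n <= N)%nat ->
    Rabs (f n k) <= M * (INR (S (n + k)) * wt tau sigma n k).

Lemma wt_pos (tau sigma : R) (n k : nat) :
  0 < tau -> 0 < sigma -> 0 < wt tau sigma n k.
Proof.
  intros Ht Hs. unfold wt. pose proof (W_ge1 n k).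
  repeat apply Rmult_lt_0_compat; try apply cw_pos; try apply pow_lt; lra.
Qed.

Lemma wt_submult (tau sigma : R) (n k i l : nat) :
  0 < tau -> 0 < sigma -> (i <= n)%nat -> (l <= k)%nat ->
  wt tau sigma i l * wt tau sigma (n - i) (k - l) <=
  W n k * tau ^ n * sigma ^ k
  * ((cw i * cw (n - i)) * (cw l * cw (k - l))).
Proof.
  intros Ht Hs Hi Hl. unfold wt.
  pose proof (W_submult i l (n - i) (k - l)) as HW.
  replace (i + (n - i))%nat with n in HW by lia.
  replace (l + (k - l))%nat with k in HW by lia.
  assert (E1 : tau ^ n = tau ^ i * tau ^ (n - i))
    by (rewrite <- pow_add; f_equal; lia).
  assert (E2 : sigma ^ k = sigma ^ l * sigma ^ (k - l))
    by (rewrite <- pow_add; f_equal; lia).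
  replace (W i l * cw i * cw l * tau ^ i * sigma ^ l *
    (W (n - i) (k - l) * cw (n - i) * cw (k - l) * tau ^ (n - i) * sigma ^ (k - l)))
    with ((W i l * W (n - i) (k - l)) * (tau ^ n * sigma ^ k
          * ((cw i * cw (n - i)) * (cw l * cw (k - l))))) by (rewrite E1, E2; ring).
  rewrite (Rmult_assoc (W n k)), (Rmult_assoc (W n k)).
  apply Rmult_le_compat_r; [|exact HW].
  pose proof (cw_pos i); pose proof (cw_pos l).
  pose proof (cw_pos (n - i)); pose proof (cw_pos (k - l)).
  pose proof (pow_lt tau n Ht); pose proof (pow_lt sigma k Hs).
  left; repeat apply Rmult_lt_0_compat; assumption.
Qed.

(** [D] is [1] or the factor of [bd1]. *)
Lemma wt_conv (tau sigma D M M' : R) (n k : nat) (f g : arr) :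
  0 < tau -> 0 < sigma -> 0 <= M -> 0 <= M' -> 0 <= D ->
  (forall i l, (i <= n)%nat -> Rabs (f i l) <= M * wt tau sigma i l) ->
  (forall i l, (i <= n)%nat -> (l <= k)%nat ->
     Rabs (g i l) <= M' * (D * wt tau sigma i l)) ->
  Rabs (amul f g n k) <= M * M' * (D * wt tau sigma n k).
Proof.
  intros Ht Hs HM HM' HD Hf Hg.
  assert (P : 0 <= M * M' * D * (W n k * tau ^ n * sigma ^ k)).
  { pose proof (W_ge1 n k).
    pose proof (pow_lt tau n Ht); pose proof (pow_lt sigma k Hs).
    repeat apply Rmult_le_pos; lra. }
  apply Rle_trans with (sum_f_R0 (fun i => sum_f_R0 (fun l =>
    M * M' * D * (W n k * tau ^ n * sigma ^ k)
    * ((cw i * cw (n - i)) * (cw l * cw (k - l)))) k) n).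
  - apply sum_abs_le; intros i Hi. apply sum_abs_le; intros l Hl.
    rewrite Rabs_mult.
    apply Rle_trans with ((M * wt tau sigma i l)
      * (M' * (D * wt tau sigma (n - i) (k - l)))).
    + apply Rmult_le_compat; try apply Rabs_pos; [apply Hf|apply Hg]; lia.
    + pose proof (wt_submult tau sigma n k i l Ht Hs Hi Hl) as H.
      apply Rmult_le_compat_l with (r := M * M' * D) in H;
        [|repeat apply Rmult_le_pos; lra].
      lra.
  - rewrite (sum_ext _ (fun i => (M * M' * D * (W n k * tau ^ n * sigma ^ k)
       * sum_f_R0 (fun l => cw l * cw (k - l)) k) * (cw i * cw (n - i)))).
    2:{ intros i _. rewrite (sum_ext _ (fun l =>
          (M * M' * D * (W n k * tau ^ n * sigma ^ k) * (cw i * cw (n - i)))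
          * (cw l * cw (k - l)))) by (intros; ring).
        rewrite sum_scal_l. ring. }
    rewrite sum_scal_l.
    pose proof (cw_conv n) as Hn. pose proof (cw_conv k) as Hk.
    assert (Hk0 : 0 <= sum_f_R0 (fun l => cw l * cw (k - l)) k).
    { apply cond_pos_sum; intros l. pose proof (cw_pos l); pose proof (cw_pos (k - l)).
      apply Rmult_le_pos; lra. }
    set (A := M * M' * D * (W n k * tau ^ n * sigma ^ k)) in *.
    apply Rle_trans with (A * cw k * cw n).
    + apply Rmult_le_compat; [apply Rmult_le_pos; assumption| |
        apply Rmult_le_compat_l; assumption|assumption].
      apply cond_pos_sum; intros l. pose proof (cw_pos l); pose proof (cw_pos (n - l)).
      apply Rmult_le_pos; lra.
    + right; unfold A, wt; ring.
Qed.

Lemma bd_mul (tau sigma : R) (N : nat) (M M' : R) (f g : arr) :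
  0 < tau -> 0 < sigma -> 0 <= M -> 0 <= M' ->
  bd tau sigma N M f -> bd tau sigma N M' g ->
  bd tau sigma N (M * M') (amul f g).
Proof.
  intros Ht Hs HM HM' Hf Hg n k Hn.
  rewrite <- (Rmult_1_l (wt _ _ _ _)).
  apply wt_conv; try assumption; try lra; intros.
  - apply Hf; lia.
  - rewrite Rmult_1_l; apply Hg; lia.
Qed.

Lemma bd1_mul (tau sigma : R) (N : nat) (M M' : R) (f g : arr) :
  0 < tau -> 0 < sigma -> 0 <= M -> 0 <= M' ->
  bd tau sigma N M f -> bd1 tau sigma N M' g ->
  bd1 tau sigma N (M * M') (amul f g).
Proof.
  intros Ht Hs HM HM' Hf Hg n k Hn.
  apply wt_conv; try assumption; try apply pos_INR; intros.
  - apply Hf; lia.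
  - eapply Rle_trans; [apply Hg; lia|]. apply Rmult_le_compat_l; [assumption|].
    apply Rmult_le_compat_r; [left; apply wt_pos; assumption|].
    apply le_INR; lia.
Qed.

Lemma wt_succ_r (tau sigma : R) (n k : nat) :
  0 < tau -> 0 < sigma ->
  INR (S k) * wt tau sigma n (S k) <=
  sigma * (INR (S (n + k)) * wt tau sigma n k).
Proof.
  intros Ht Hs. unfold wt.
  replace (INR (S k) * (W n (S k) * cw n * cw (S k) * tau ^ n * sigma ^ S k))
    with ((INR (S k) * W n (S k)) * cw n * tau ^ n * sigma ^ k * sigma * cw (S k))
    by (simpl; ring).
  rewrite W_succ_r.
  replace (sigma * (INR (S (n + k)) * (W n k * cw n * cw k * tau ^ n * sigma ^ k)))
    with ((INR (S (n + k)) * W n k) * cw n * tau ^ n * sigma ^ k * sigma * cw k)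
    by ring.
  apply Rmult_le_compat_l; [|apply cw_decr].
  pose proof (W_ge1 n k); pose proof (cw_pos n).
  pose proof (pow_lt tau n Ht); pose proof (pow_lt sigma k Hs).
  repeat apply Rmult_le_pos; try apply pos_INR; lra.
Qed.

Lemma wt_succ_l (tau sigma : R) (n k : nat) :
  0 < tau -> 0 < sigma ->
  INR (S (n + k)) * wt tau sigma n k / INR (S n) <= 4 / tau * wt tau sigma (S n) k.
Proof.
  intros Ht Hs. unfold wt. pose proof (INR_S_pos n) as Hp.
  replace (INR (S (n + k)) * (W n k * cw n * cw k * tau ^ n * sigma ^ k) / INR (S n))
    with ((INR (S (n + k)) * W n k) / INR (S n) * cw k * tau ^ n * sigma ^ k * cw n)
    by (field; lra).
  rewrite <- W_succ_l.
  replace (4 / tau * (W (S n) k * cw (S n) * cw k * tau ^ S n * sigma ^ k))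
    with (INR (S n) * W (S n) k / INR (S n) * cw k * tau ^ n * sigma ^ k * (4 * cw (S n)))
    by (rewrite <- (tech_pow_Rmult tau n); field; lra).
  apply Rmult_le_compat_l; [|apply cw_ratio].
  replace (INR (S n) * W (S n) k / INR (S n)) with (W (S n) k) by (field; lra).
  pose proof (W_ge1 (S n) k); pose proof (cw_pos k).
  pose proof (pow_lt tau n Ht); pose proof (pow_lt sigma k Hs).
  repeat apply Rmult_le_pos; lra.
Qed.

Lemma wt_00 (tau sigma : R) : wt tau sigma 0 0 = / 64.
Proof. unfold wt. rewrite W_0l, cw_0. simpl. field. Qed.

(** The constant 64 is the inverse of the weight at degree [(0, 0)]; it appears wherever a constant
    term is estimated together with the rest. *)
Lemma bd_aone (tau sigma : R) (N : nat) :
  0 < tau -> 0 < sigma -> bd tau sigma N 64 aone.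
Proof.
  intros Ht Hs n k _.
  destruct (Nat.eq_dec (n + k) 0) as [E|E].
  - replace n with O by lia; replace k with O by lia.
    rewrite wt_00; simpl. rewrite Rabs_R1; lra.
  - rewrite aone_eq0, Rabs_R0 by lia.
    pose proof (wt_pos tau sigma n k Ht Hs); lra.
Qed.

Lemma bd_le (tau sigma : R) (N : nat) (M M' : R) (f : arr) :
  0 < tau -> 0 < sigma -> M <= M' -> bd tau sigma N M f -> bd tau sigma N M' f.
Proof.
  intros Ht Hs HM H n k Hn. eapply Rle_trans; [apply H, Hn|].
  apply Rmult_le_compat_r; [left; apply wt_pos; assumption|exact HM].
Qed.

Lemma bd_plus (tau sigma : R) (N : nat) (M M' : R) (f g : arr) :
  bd tau sigma N M f -> bd tau sigma N M' g ->
  bd tau sigma N (M + M') (fun n k => f n k + g n k).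
Proof.
  intros Hf Hg n k Hn. specialize (Hf n k Hn); specialize (Hg n k Hn).
  eapply Rle_trans; [apply Rabs_triang|lra].
Qed.

Lemma bd1_plus (tau sigma : R) (N : nat) (M M' : R) (f g : arr) :
  bd1 tau sigma N M f -> bd1 tau sigma N M' g ->
  bd1 tau sigma N (M + M') (fun n k => f n k + g n k).
Proof.
  intros Hf Hg n k Hn. specialize (Hf n k Hn); specialize (Hg n k Hn).
  eapply Rle_trans; [apply Rabs_triang|lra].
Qed.

Lemma bd_scal (tau sigma : R) (N : nat) (c M : R) (f : arr) :
  bd tau sigma N M f -> bd tau sigma N (Rabs c * M) (fun n k => c * f n k).
Proof.
  intros Hf n k Hn. rewrite Rabs_mult, Rmult_assoc.
  apply Rmult_le_compat_l; [apply Rabs_pos|apply Hf, Hn].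
Qed.

Lemma bd1_scal (tau sigma : R) (N : nat) (c M : R) (f : arr) :
  bd1 tau sigma N M f -> bd1 tau sigma N (Rabs c * M) (fun n k => c * f n k).
Proof.
  intros Hf n k Hn. rewrite Rabs_mult, Rmult_assoc.
  apply Rmult_le_compat_l; [apply Rabs_pos|apply Hf, Hn].
Qed.

Lemma bd_bd1 (tau sigma : R) (N : nat) (M : R) (f : arr) :
  0 < tau -> 0 < sigma -> 0 <= M -> bd tau sigma N M f -> bd1 tau sigma N M f.
Proof.
  intros Ht Hs HM Hf n k Hn. eapply Rle_trans; [apply Hf, Hn|].
  apply Rmult_le_compat_l; [assumption|].
  pose proof (wt_pos tau sigma n k Ht Hs). pose proof (INR_S_ge1 (n + k)). nra.
Qed.

Lemma bd1_adz (tau sigma : R) (N : nat) (M : R) (f : arr) :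
  0 < tau -> 0 < sigma -> 0 <= M -> bd tau sigma N M f ->
  bd1 tau sigma N (sigma * M) (adz f).
Proof.
  intros Ht Hs HM Hf n k Hn. unfold adz.
  rewrite Rabs_mult, (Rabs_pos_eq (INR (S k))) by apply pos_INR.
  pose proof (wt_succ_r tau sigma n k Ht Hs) as H.
  apply Rmult_le_compat_l with (r := M) in H; [|assumption].
  apply Rle_trans with (INR (S k) * (M * wt tau sigma n (S k))); [|lra].
  apply Rmult_le_compat_l; [apply pos_INR|apply Hf, Hn].
Qed.

Lemma bd_pow (tau sigma : R) (N : nat) (eta : R) (f : arr) (j : nat) :
  0 < tau -> 0 < sigma -> 0 <= eta -> bd tau sigma N eta f ->
  bd tau sigma N (64 * eta ^ j) (apow f j).
Proof.
  intros Ht Hs He Hf; induction j as [|j IH].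
  - simpl. rewrite Rmult_1_r. apply bd_aone; assumption.
  - simpl apow. replace (64 * eta ^ S j) with (eta * (64 * eta ^ j)) by (simpl; ring).
    apply bd_mul; try assumption. pose proof (pow_le eta j He); lra.
Qed.

Lemma bd_acut (tau sigma : R) (N : nat) (eta : R) (f : arr) :
  0 < tau -> 0 < sigma -> 0 <= eta -> bd tau sigma N eta (acut f) ->
  bd tau sigma N (64 * Rabs (f O O) + eta) f.
Proof.
  intros Ht Hs He Hf n k Hn. rewrite (acut_split f n k), Rplus_comm.
  revert n k Hn.
  apply (bd_plus _ _ _ (64 * Rabs (f O O)) eta (fun n k => f O O * aone n k) (acut f)); [|exact Hf].
  rewrite Rmult_comm. apply bd_scal, bd_aone; assumption.
Qed.

Lemma acut_amul (f g : arr) (n k : nat) :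
  acut (amul f g) n k =
  (f O O * acut g n k + g O O * acut f n k) + amul (acut f) (acut g) n k.
Proof.
  assert (E : amul f g n k =
    f O O * g O O * aone n k
    + ((f O O * acut g n k + g O O * acut f n k) + amul (acut f) (acut g) n k)).
  { transitivity (amul (fun n k => acut f n k + f O O * aone n k)
                       (fun n k => acut g n k + g O O * aone n k) n k).
    { apply amul_ext; intros; apply acut_split. }
    rewrite amul_plus_l, !amul_plus_r, !amul_scal_l, !amul_scal_r, !amul_1l, !amul_1r.
    ring. }
  destruct (Nat.eq_dec (n + k) 0) as [E0|E0].
  - replace n with O by lia; replace k with O by lia. unfold amul; simpl. ring.
  - rewrite acut_neq, E, aone_eq0 by lia. ring.
Qed.

(** [bd_mul] would charge the constant terms with a factor 64 and lose smallness. Splitting them off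
    leaves a bound that is small with [eta] and [zeta]. *)
Lemma bd_acut_amul (tau sigma : R) (N : nat) (A B eta zeta : R) (f g : arr) :
  0 < tau -> 0 < sigma -> 0 <= eta -> 0 <= zeta ->
  Rabs (f O O) <= A -> Rabs (g O O) <= B ->
  bd tau sigma N eta (acut f) -> bd tau sigma N zeta (acut g) ->
  bd tau sigma N (A * zeta + B * eta + eta * zeta) (acut (amul f g)).
Proof.
  intros Ht Hs He Hz HA HB Hf Hg n k Hn. rewrite acut_amul. revert n k Hn.
  apply (bd_plus _ _ _ (A * zeta + B * eta) (eta * zeta)
    (fun n k => f O O * acut g n k + g O O * acut f n k)).
  - apply (bd_plus _ _ _ (A * zeta) (B * eta) (fun n k => f O O * acut g n k)).
    + apply bd_le with (Rabs (f O O) * zeta); try assumption; [nra|].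
      apply bd_scal, Hg.
    + apply bd_le with (Rabs (g O O) * eta); try assumption; [nra|].
      apply bd_scal, Hf.
  - apply bd_mul; assumption.
Qed.

(** The index [j = 0] only feeds the constant term, which [acut] removes. The others carry powers of
    [r * eta], at most one half, so their sum is at most twice the first bound [64 * C * r * eta].
    The outcome is linear in [eta]: composition keeps the oscillation small. *)
Lemma bd_acut_acomp (tau sigma : R) (N : nat) (C r eta : R) (H : nat -> R -> R) (f : arr) :
  0 < tau -> 0 < sigma -> 0 <= eta -> 0 <= C -> 0 <= r -> r * eta <= / 2 ->
  (forall j, Rabs (H j (f O O)) <= C * r ^ j) ->
  bd tau sigma N eta (acut f) ->
  bd tau sigma N (128 * C * r * eta) (acut (acomp H f)).
Proof.
  intros Ht Hs He HC Hr Hre HH Hf n k Hn.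
  pose proof (wt_pos tau sigma n k Ht Hs) as Hw.
  assert (P : 0 <= 64 * C * (r * eta)) by (assert (0 <= r * eta) by nra; nra).
  destruct (Nat.eq_dec (n + k) 0) as [E0|E0].
  { replace (acut (acomp H f) n k) with 0
      by (replace n with O by lia; replace k with O by lia; reflexivity).
    rewrite Rabs_R0. apply Rmult_le_pos; lra. }
  rewrite acut_neq by lia. unfold acomp.
  destruct (n + k)%nat as [|p] eqn:Ep; [lia|].
  rewrite sum_head. simpl apow at 1. rewrite aone_eq0, Rmult_0_r, Rplus_0_l by lia.
  apply Rle_trans with (sum_f_R0 (fun j => 64 * C * (r * eta) * wt tau sigma n k * (/2) ^ j) p).
  - apply sum_abs_le; intros j _. rewrite Rabs_mult.
    apply Rle_trans with ((C * r ^ S j) * (64 * eta ^ S j * wt tau sigma n k)).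
    + apply Rmult_le_compat; try apply Rabs_pos; [apply HH|].
      apply bd_pow with (N := N); assumption.
    + replace (C * r ^ S j * (64 * eta ^ S j * wt tau sigma n k))
        with (64 * C * (r * eta) * wt tau sigma n k * (r * eta) ^ j)
        by (rewrite Rpow_mult_distr; simpl; ring).
      apply Rmult_le_compat_l; [apply Rmult_le_pos; lra|].
      apply pow_incr; split; [apply Rmult_le_pos|]; assumption.
  - rewrite sum_scal_l. pose proof (sum_half_pow p).
    apply Rle_trans with (64 * C * (r * eta) * wt tau sigma n k * 2); [|right; ring].
    apply Rmult_le_compat_l; [apply Rmult_le_pos; lra|assumption].
Qed.

(** The weights [cw] are at most one and the binomial is at most [2 ^ (n + k)]: both rates double
    and what remains is purely geometric. *)
Lemma bd_geom (tau sigma : R) (N : nat) (M : R) (f : arr) (n k : nat) :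
  0 < tau -> 0 < sigma -> 0 <= M -> bd tau sigma N M f -> (n <= N)%nat ->
  Rabs (f n k) <= M * (2 * tau) ^ n * (2 * sigma) ^ k.
Proof.
  intros Ht Hs HM Hf Hn. eapply Rle_trans; [apply Hf, Hn|].
  rewrite Rmult_assoc. apply Rmult_le_compat_l; [assumption|].
  rewrite !Rpow_mult_distr. unfold wt.
  pose proof (W_le_pow n k) as HW. rewrite pow_add in HW.
  pose proof (cw_le1 n); pose proof (cw_le1 k).
  pose proof (cw_pos n); pose proof (cw_pos k). pose proof (W_ge1 n k).
  pose proof (pow_lt tau n Ht); pose proof (pow_lt sigma k Hs).
  replace (2 ^ n * tau ^ n * (2 ^ k * sigma ^ k))
    with (2 ^ n * 2 ^ k * (tau ^ n * sigma ^ k)) by ring.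
  replace (W n k * cw n * cw k * tau ^ n * sigma ^ k)
    with (W n k * (cw n * cw k) * (tau ^ n * sigma ^ k)) by ring.
  apply Rmult_le_compat_r; [apply Rmult_le_pos; lra|].
  assert (cw n * cw k <= 1) by nra. nra.
Qed.

(** * Power series with geometric bounds and Taylor families *)

Lemma mvt (f df : R -> R) (a b : R) :
  (forall x, Rmin a b <= x <= Rmax a b -> is_derive f x (df x)) ->
  exists c, Rmin a b <= c <= Rmax a b /\ f b - f a = df c * (b - a).
Proof.
  intros H. apply MVT_gen; intros x Hx.
  - apply H; lra.
  - apply continuity_pt_filterlim, (ex_derive_continuous f). exists (df x). apply H, Hx.
Qed.

Lemma mvt_lipschitz (f df : R -> R) (K a b : R) :
  (forall x, Rmin a b <= x <= Rmax a b ->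
     is_derive f x (df x) /\ Rabs (df x) <= K) ->
  Rabs (f b - f a) <= K * Rabs (b - a).
Proof.
  intros H. destruct (mvt f df a b) as [c [Hc E]]; [intros; apply H; assumption|].
  rewrite E, Rabs_mult. apply Rmult_le_compat_r; [apply Rabs_pos|apply H, Hc].
Qed.

(** The mean value theorem is used twice: the quotient is [f'] at an intermediate point, and [f'] is
    [K]-Lipschitz between that point and [x]. *)
Lemma diff_quot_error (f f' f'' : R -> R) (K x h : R) :
  h <> 0 ->
  (forall y, Rmin x (x + h) <= y <= Rmax x (x + h) ->
     is_derive f y (f' y) /\ is_derive f' y (f'' y) /\ Rabs (f'' y) <= K) ->
  Rabs ((f (x + h) - f x) / h - f' x) <= K * Rabs h.
Proof.
  intros Hh H.
  destruct (mvt f f' x (x + h)) as [c [Hc E]]; [intros; apply H; assumption|].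
  replace ((f (x + h) - f x) / h) with (f' c) by (rewrite E; field; exact Hh).
  assert (Hs : forall y, Rmin x c <= y <= Rmax x c ->
                 Rmin x (x + h) <= y <= Rmax x (x + h)).
  { intros y. unfold Rmin, Rmax in *.
    repeat destruct Rle_dec; intros; lra. }
  assert (HK : 0 <= K).
  { eapply Rle_trans; [apply Rabs_pos|apply (H x)].
    unfold Rmin, Rmax; destruct Rle_dec; lra. }
  eapply Rle_trans; [apply (mvt_lipschitz f' f'' K x c)|].
  - intros y Hy. apply Hs in Hy. split; apply H; exact Hy.
  - apply Rmult_le_compat_l; [exact HK|].
    unfold Rmin, Rmax in Hc; destruct Rle_dec in Hc;
      unfold Rabs; repeat destruct Rcase_abs; lra.
Qed.

Lemma is_derive_shift (f : R -> R) (h x l : R) :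
  is_derive f (x + h) l -> is_derive (fun y => f (y + h)) x l.
Proof.
  intros H. evar_last.
  - apply (is_derive_comp f (fun y => y + h)); [exact H|].
    apply (is_derive_plus (fun y => y) (fun _ => h)); [apply is_derive_id|apply is_derive_const].
  - unfold scal, plus, one, zero; simpl. unfold mult; simpl. rewrite Rplus_0_r. apply Rmult_1_l.
Qed.

Lemma is_series_err (a : nat -> R) (l C : R) :
  (forall n, Rabs (sum_f_R0 a n - l) <= C * (/2) ^ n) -> is_series a l.
Proof.
  intros H. change (is_lim_seq (sum_n a) l).
  assert (L : is_lim_seq (fun n => C * (/2) ^ n) 0).
  { evar_last; [apply is_lim_seq_scal_l, is_lim_seq_geom; rewrite Rabs_pos_eq; lra|].
    simpl. f_equal; ring. }
  apply is_lim_seq_le_le with (fun n => l - C * (/2) ^ n) (fun n => l + C * (/2) ^ n).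
  - intros n. rewrite sum_n_Reals. specialize (H n).
    apply Rabs_le_between in H. lra.
  - evar_last; [apply is_lim_seq_minus'; [apply is_lim_seq_const|exact L]|].
    f_equal; ring.
  - evar_last; [apply is_lim_seq_plus'; [apply is_lim_seq_const|exact L]|].
    f_equal; ring.
Qed.

Lemma sum_tail (a : nat -> R) (K : R) (N n : nat) :
  (forall j, Rabs (a j) <= K * (/2) ^ j) -> (N <= n)%nat ->
  Rabs (sum_f_R0 a n - sum_f_R0 a N) <= K * (/2) ^ N.
Proof.
  intros HK Hn. replace n with (N + (n - N))%nat by lia. generalize (n - N)%nat as m. clear n Hn.
  assert (H : forall m, Rabs (sum_f_R0 a (N + m) - sum_f_R0 a N)
                 <= K * (/2) ^ N * (1 - (/2) ^ m)).
  { intros n; induction n as [|n IH].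
    - rewrite Nat.add_0_r, Rminus_diag_eq, Rabs_R0 by reflexivity. simpl. lra.
    - rewrite Nat.add_succ_r, tech5.
      replace (sum_f_R0 a (N + n) + a (S (N + n)) - sum_f_R0 a N)
        with ((sum_f_R0 a (N + n) - sum_f_R0 a N) + a (S (N + n))) by ring.
      eapply Rle_trans; [apply Rabs_triang|].
      specialize (HK (S (N + n))). simpl pow in HK. rewrite pow_add in HK.
      simpl pow. lra. }
  intros m. eapply Rle_trans; [apply H|].
  pose proof (pow_lt (/2) m ltac:(lra)).
  assert (0 <= K * (/2) ^ N) by (eapply Rle_trans; [apply Rabs_pos|apply HK]).
  nra.
Qed.

Lemma is_series_tail (a : nat -> R) (l K : R) (N : nat) :
  is_series a l -> (forall n, Rabs (a n) <= K * (/2) ^ n) ->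
  Rabs (l - sum_f_R0 a N) <= K * (/2) ^ N.
Proof.
  intros Ha HK.
  assert (L : is_lim_seq (fun n => sum_f_R0 a (N + n) - sum_f_R0 a N)
                (l - sum_f_R0 a N)).
  { apply is_lim_seq_minus'; [|apply is_lim_seq_const].
    apply is_lim_seq_ext with (fun n => sum_n a (n + N)).
    - intros n. rewrite sum_n_Reals, Nat.add_comm. reflexivity.
    - apply (is_lim_seq_incr_n (sum_n a) N l), Ha. }
  apply is_lim_seq_abs in L.
  apply (is_lim_seq_le _ (fun _ => K * (/2) ^ N) _ (K * (/2) ^ N)) in L;
    [exact L| |apply is_lim_seq_const].
  intros n. apply sum_tail; [exact HK|lia].
Qed.

Lemma is_series_bound (a : nat -> R) (l K : R) :
  is_series a l -> (forall n, Rabs (a n) <= K * (/2) ^ n) -> Rabs l <= 2 * K.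
Proof.
  intros Ha HK. pose proof (is_series_tail a l K 0 Ha HK) as H.
  specialize (HK O). simpl in *.
  replace l with ((l - a O) + a O) by ring.
  eapply Rle_trans; [apply Rabs_triang|lra].
Qed.

Definition geom (M tau : R) (a : nat -> R) : Prop :=
  forall n, Rabs (a n) <= M * tau ^ n.

Lemma geom_term (M tau t : R) (a : nat -> R) (n : nat) :
  0 <= tau -> geom M tau a -> tau * Rabs t <= / 2 ->
  Rabs (a n * t ^ n) <= M * (/2) ^ n.
Proof.
  intros Htau Ha Ht. rewrite Rabs_mult, <- RPow_abs.
  apply Rle_trans with (M * tau ^ n * Rabs t ^ n).
  - apply Rmult_le_compat_r; [apply pow_le, Rabs_pos|apply Ha].
  - rewrite Rmult_assoc, <- Rpow_mult_distr. apply Rmult_le_compat_l.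
    + specialize (Ha O). simpl in Ha. pose proof (Rabs_pos (a O)); lra.
    + apply pow_incr. split; [|exact Ht]. apply Rmult_le_pos; [exact Htau|apply Rabs_pos].
Qed.

Lemma geom_radius (M tau t : R) (a : nat -> R) :
  0 < tau -> geom M tau a -> tau * Rabs t <= / 2 ->
  Rbar_lt (Rabs t) (CV_radius a).
Proof.
  intros Htau Ha Ht.
  apply Rbar_lt_le_trans with (Finite (/ tau)).
  - simpl. apply Rmult_lt_reg_l with tau; [exact Htau|].
    rewrite Rinv_r by lra. lra.
  - apply CV_radius_bounded. exists M. intros n. rewrite Rabs_mult.
    rewrite (Rabs_pos_eq ((/ tau) ^ n))
      by (apply pow_le; left; apply Rinv_0_lt_compat, Htau).
    apply Rle_trans with (M * tau ^ n * (/ tau) ^ n).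
    + apply Rmult_le_compat_r; [|apply Ha].
      apply pow_le; left; apply Rinv_0_lt_compat, Htau.
    + rewrite Rmult_assoc, <- Rpow_mult_distr, Rinv_r, pow1 by lra. lra.
Qed.

Lemma geom_pseries (M tau t : R) (a : nat -> R) :
  0 < tau -> geom M tau a -> tau * Rabs t <= / 2 ->
  is_pseries a t (PSeries a t).
Proof.
  intros Htau Ha Ht. apply PSeries_correct, CV_radius_inside.
  apply (geom_radius M tau); assumption.
Qed.

Lemma geom_PSeries_bound (M tau t : R) (a : nat -> R) :
  0 < tau -> geom M tau a -> tau * Rabs t <= / 2 ->
  Rabs (PSeries a t) <= 2 * M.
Proof.
  intros Htau Ha Ht. pose proof (geom_pseries M tau t a Htau Ha Ht) as H.
  apply is_pseries_R in H. apply (is_series_bound _ _ M H).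
  intros n. apply geom_term with tau; try assumption; lra.
Qed.

Lemma geom_PSeries_tail (M tau t : R) (a : nat -> R) (N : nat) :
  0 < tau -> geom M tau a -> tau * Rabs t <= / 2 ->
  Rabs (PSeries a t - sum_f_R0 (fun n => a n * t ^ n) N) <= M * (/2) ^ N.
Proof.
  intros Htau Ha Ht. pose proof (geom_pseries M tau t a Htau Ha Ht) as H.
  apply is_pseries_R in H. apply (is_series_tail _ _ M N H).
  intros n. apply geom_term with tau; try assumption; lra.
Qed.

(** The [j]-th Taylor coefficient, at a variable point, of the sum of [a]. *)
Definition shf (a : nat -> R) (j : nat) : R -> R :=
  PSeries (fun n => W n j * a (n + j)%nat).

(** The binomial costs [2 ^ (n + j)], of which [2 ^ n] doubles the rate and [2 ^ j] goes into the
    prefactor. Hence the condition [4 * tau * Rabs t <= 1] in the lemmas that follow. *)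
Lemma shf_geom (M tau : R) (a : nat -> R) (j : nat) :
  0 < tau -> geom M tau a ->
  geom (M * (2 * tau) ^ j) (2 * tau) (fun n => W n j * a (n + j)%nat).
Proof.
  intros Ht Ha n. rewrite Rabs_mult, (Rabs_pos_eq (W n j))
    by (pose proof (W_ge1 n j); lra).
  apply Rle_trans with (2 ^ (n + j) * (M * tau ^ (n + j))).
  - apply Rmult_le_compat; [pose proof (W_ge1 n j); lra|apply Rabs_pos|apply W_le_pow|apply Ha].
  - right. rewrite !Rpow_mult_distr, !pow_add. ring.
Qed.

Lemma shf_0 (a : nat -> R) (t : R) : shf a 0 t = PSeries a t.
Proof.
  apply PSeries_ext. intros n. rewrite W_0r, Nat.add_0_r. ring.
Qed.

Lemma shf_at_0 (a : nat -> R) (j : nat) : shf a j 0 = a j.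
Proof. unfold shf. rewrite PSeries_0, W_0l. simpl. ring. Qed.

Lemma shf_bound (M tau t : R) (a : nat -> R) (j : nat) :
  0 < tau -> geom M tau a -> 4 * tau * Rabs t <= 1 ->
  Rabs (shf a j t) <= 2 * M * (2 * tau) ^ j.
Proof.
  intros Ht Ha H. rewrite Rmult_assoc.
  apply geom_PSeries_bound with (2 * tau); [lra|apply shf_geom; assumption|lra].
Qed.

Lemma shf_derive (M tau t : R) (a : nat -> R) (j : nat) :
  0 < tau -> geom M tau a -> 4 * tau * Rabs t <= 1 ->
  is_derive (shf a j) t (INR (S j) * shf a (S j) t).
Proof.
  intros Ht Ha H.
  assert (E : INR (S j) * shf a (S j) t =
    PSeries (PS_derive (fun n => W n j * a (n + j)%nat)) t).
  { unfold shf. rewrite <- PSeries_scal. apply PSeries_ext; intros n.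
    unfold PS_scal, PS_derive. simpl scal. unfold scal; simpl; unfold mult; simpl.
    change (match j with O => 1 | S _ => INR j + 1 end) with (INR (S j)).
    change (match n with O => 1 | S _ => INR n + 1 end) with (INR (S n)).
    rewrite <- !Rmult_assoc, W_succ_r, W_succ_l, Nat.add_succ_r. reflexivity. }
  rewrite E. apply is_derive_PSeries.
  apply geom_radius with (M * (2 * tau) ^ j) (2 * tau);
    [lra|apply shf_geom; assumption|lra].
Qed.

(** As a function of the base point [s], the Taylor polynomial [sum H_j(s) (z - s)^j] has a
    telescoping derivative [(n + 1) H_{n+1}(s) (z - s)^n], and it equals [H_0(z)] at [s = z]. The
    mean value theorem between [y] and [z] gives the remainder. *)
Lemma taylor_remainder (H : nat -> R -> R) (C r y z : R) (n : nat) :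
  0 <= r ->
  (forall j x, Rmin y z <= x <= Rmax y z ->
     is_derive (H j) x (INR (S j) * H (S j) x) /\ Rabs (H j x) <= C * r ^ j) ->
  Rabs (H O z - sum_f_R0 (fun j => H j y * (z - y) ^ j) n) <=
  INR (S n) * C * (r * Rabs (z - y)) ^ S n.
Proof.
  intros Hr Hfam.
  assert (D : forall m x, Rmin y z <= x <= Rmax y z ->
    is_derive (fun s => sum_f_R0 (fun j => H j s * (z - s) ^ j) m) x
      (INR (S m) * H (S m) x * (z - x) ^ m)).
  { intros m x Hx; induction m as [|m IH].
    - simpl sum_f_R0. simpl pow. rewrite Rmult_1_r.
      apply is_derive_ext with (H O); [intros; simpl; ring|].
      apply Hfam, Hx.
    - simpl sum_f_R0. evar_last.
      + apply (is_derive_plus (fun s => sum_f_R0 (fun j => H j s * (z - s) ^ j) m)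
          (fun s => H (S m) s * (z - s) ^ (S m))); [exact IH|].
        apply (is_derive_mult (H (S m)) (fun s => (z - s) ^ (S m))).
        * apply Hfam, Hx.
        * apply is_derive_pow. apply (is_derive_minus (fun _ => z) (fun s => s)).
          -- apply is_derive_const.
          -- apply is_derive_id.
        * intros; apply Rmult_comm.
      + unfold plus, minus, mult, opp, zero, one, plus; simpl pred. cbn -[INR pow].
        change (Init.Nat.pred (S m)) with m. simpl pow. ring. }
  destruct (mvt (fun s => sum_f_R0 (fun j => H j s * (z - s) ^ j) n) _ y z
    (fun x Hx => D n x Hx)) as [c [Hc E]].
  assert (E0 : sum_f_R0 (fun j => H j z * (z - z) ^ j) n = H O z).
  { rewrite (sum_extend _ 0 n); [simpl; ring|lia|].
    intros i Hi. rewrite Rminus_diag_eq, pow_i by (reflexivity || lia). ring. }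
  rewrite E0 in E. rewrite E, !Rabs_mult, Rpow_mult_distr.
  rewrite (Rabs_pos_eq (INR (S n))) by apply pos_INR.
  destruct (Hfam (S n) c Hc) as [_ Hb].
  assert (Hd : Rabs (z - c) <= Rabs (z - y)).
  { unfold Rmin, Rmax in Hc; destruct Rle_dec in Hc;
      unfold Rabs; repeat destruct Rcase_abs; lra. }
  rewrite <- RPow_abs.
  replace (INR (S n) * C * (r ^ S n * Rabs (z - y) ^ S n)) with
    (INR (S n) * (C * r ^ S n) * Rabs (z - y) ^ n * Rabs (z - y)) by (simpl pow; ring).
  apply Rmult_le_compat_r; [apply Rabs_pos|].
  apply Rmult_le_compat.
  - apply Rmult_le_pos; [apply pos_INR|apply Rabs_pos].
  - apply pow_le, Rabs_pos.
  - apply Rmult_le_compat_l; [apply pos_INR|exact Hb].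
  - apply pow_incr; split; [apply Rabs_pos|exact Hd].
Qed.

(** The factor [n + 1] of the remainder is at most [2 ^ n]; against a ratio of one quarter it still
    leaves convergence like [(/ 2) ^ n]. *)
Lemma taylor_series (H : nat -> R -> R) (C r y z : R) :
  0 <= r -> r * Rabs (z - y) <= / 4 ->
  (forall j x, Rmin y z <= x <= Rmax y z ->
     is_derive (H j) x (INR (S j) * H (S j) x) /\ Rabs (H j x) <= C * r ^ j) ->
  is_series (fun j => H j y * (z - y) ^ j) (H O z).
Proof.
  intros Hr Hs Hfam. apply is_series_err with C. intros n.
  rewrite Rabs_minus_sym.
  eapply Rle_trans; [apply taylor_remainder with (C := C) (r := r); assumption|].
  assert (HC : 0 <= C).
  { destruct (Hfam O y) as [_ HC]; [unfold Rmin, Rmax; destruct Rle_dec; lra|].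
    simpl in HC. pose proof (Rabs_pos (H O y)); lra. }
  apply Rle_trans with (2 ^ n * C * (/4) ^ S n).
  - apply Rmult_le_compat; try (apply Rmult_le_compat_r; [exact HC|apply INR_S_le_pow2]).
    + apply Rmult_le_pos; [apply pos_INR|exact HC].
    + apply pow_le, Rmult_le_pos; [exact Hr|apply Rabs_pos].
    + apply pow_incr. split; [apply Rmult_le_pos; [exact Hr|apply Rabs_pos]|exact Hs].
  - simpl pow. replace (/ 4) with (/ 2 * / 2) at 2 by field.
    rewrite (Rpow_mult_distr (/2) (/2)).
    assert (E : 2 ^ n * (/2) ^ n = 1) by (rewrite <- Rpow_mult_distr, Rinv_r, pow1; lra).
    replace (2 ^ n * C * (/ 4 * ((/ 2) ^ n * (/ 2) ^ n)))
      with (/ 4 * C * (/2) ^ n * (2 ^ n * (/2) ^ n)) by ring.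
    rewrite E. pose proof (pow_lt (/2) n ltac:(lra)). nra.
Qed.

Lemma fam_Derive_n (H : nat -> R -> R) (f : R -> R) (x0 d : R) :
  (forall j x, Rabs (x - x0) < d -> is_derive (H j) x (INR (S j) * H (S j) x)) ->
  (forall x, Rabs (x - x0) < d -> f x = H O x) ->
  forall j x, Rabs (x - x0) < d ->
    ex_derive_n f j x /\ Derive_n f j x = INR (fact j) * H j x.
Proof.
  intros Hd Hf. 
  assert (Hloc : forall x, Rabs (x - x0) < d -> locally x (fun y => Rabs (y - x0) < d)).
  { intros x Hx. exists (mkposreal (d - Rabs (x - x0)) ltac:(lra)). intros y Hy.
    change (Rabs (y - x) < d - Rabs (x - x0)) in Hy.
    replace (y - x0) with ((y - x) + (x - x0)) by ring.
    eapply Rle_lt_trans; [apply Rabs_triang|lra]. }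
  induction j as [|j IH]; intros x Hx.
  - simpl. split; [exact I|]. rewrite Rmult_1_l. apply Hf, Hx.
  - assert (D : is_derive (Derive_n f j) x (INR (fact (S j)) * H (S j) x)).
    { apply is_derive_ext_loc with (fun y => INR (fact j) * H j y).
      - eapply filter_imp; [|apply Hloc, Hx]. intros y Hy; symmetry; apply IH, Hy.
      - evar_last; [apply (is_derive_scal (H j) x (INR (fact j))), Hd, Hx|].
        rewrite fact_simpl, mult_INR. ring. }
    split.
    + eexists; exact D.
    + apply is_derive_unique, D.
Qed.

(** * Compactness *)

(** The gauge at each point is taken below both the local radius and the inverse of the local bound.
    The positive lower bound of the gauge provided by compactness then bounds the constants from
    above as well. *)
Lemma compact_bound (Q : R -> R -> Prop) (a b : R) :
  (forall M M' y, M <= M' -> Q M y -> Q M' y) ->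
  (forall x, a <= x <= b ->
     exists d M, 0 < d /\ forall y, Rabs (y - x) < d -> Q M y) ->
  exists M, 0 < M /\ forall y, a <= y <= b -> Q M y.
Proof.
  intros Hmono Hloc.
  assert (F : forall x, {d : posreal | a <= x <= b ->
                forall y, Rabs (y - x) < d -> Q (/ d) y}).
  { intros x. apply constructive_indefinite_description.
    destruct (classic (a <= x <= b)) as [Hx|Hx];
      [|exists (mkposreal 1 Rlt_0_1); tauto].
    destruct (Hloc x Hx) as [d [M [Hd H]]].
    pose proof (Rabs_pos M).
    assert (Hp : 0 < Rmin d (/ (Rabs M + 1)))
      by (apply Rmin_glb_lt; [assumption|apply Rinv_0_lt_compat; lra]).
    exists (mkposreal _ Hp). simpl. intros _ y Hy.
    apply Hmono with M.
    - apply Rle_trans with (Rabs M + 1); [pose proof (Rle_abs M); lra|].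
      rewrite <- (Rinv_inv (Rabs M + 1)) at 1. apply Rinv_le_contravar; [exact Hp|apply Rmin_r].
    - apply H. eapply Rlt_le_trans; [exact Hy|apply Rmin_l]. }
  destruct (compactness_value_1d a b (fun x => proj1_sig (F x))) as [d Hd].
  exists (/ d). split; [apply Rinv_0_lt_compat, cond_pos|].
  intros y Hy. apply NNPP. intros Hn. apply (Hd y Hy). intros [t [Ht [H1 H2]]].
  apply Hn. apply Hmono with (/ proj1_sig (F t)).
  - apply Rinv_le_contravar; [apply cond_pos|exact H2].
  - apply (proj2_sig (F t)); assumption.
Qed.

Lemma periodic_reduce (x : R) :
  exists y, 0 <= y <= 2 * PI /\ forall f, periodic f -> f x = f y.
Proof.
  pose proof PI_RGT_0 as HP.
  assert (A : forall f, periodic f -> forall n y, f (y + INR n * (2 * PI)) = f y).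
  { intros f Hf n y; induction n as [|n IH]; [simpl; f_equal; ring|].
    rewrite S_INR.
    replace (y + (INR n + 1) * (2 * PI)) with (y + INR n * (2 * PI) + 2 * PI) by ring.
    rewrite Hf; exact IH. }
  destruct (base_Int_part (x / (2 * PI))) as [H1 H2].
  set (z := Int_part (x / (2 * PI))) in *.
  assert (E : x = x / (2 * PI) * (2 * PI)) by (field; lra).
  exists (x - IZR z * (2 * PI)). split.
  - split.
    + apply Rmult_le_compat_r with (r := 2 * PI) in H1; lra.
    + assert (x / (2 * PI) < IZR z + 1) by lra.
      apply Rmult_lt_compat_r with (r := 2 * PI) in H; lra.
  - intros f Hf. destruct (Z.le_gt_cases 0 z) as [Hz|Hz].
    + rewrite <- (A f Hf (Z.to_nat z) (x - IZR z * (2 * PI))).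
      f_equal. rewrite INR_IZR_INZ, Z2Nat.id by exact Hz. ring.
    + rewrite <- (A f Hf (Z.to_nat (- z)) x).
      f_equal. rewrite INR_IZR_INZ, Z2Nat.id by lia. rewrite opp_IZR. ring.
Qed.

(** * Taylor coefficients of analytic functions, bounded on compact sets *)

Definition tay (f : R -> R) (j : nat) (x : R) : R := Derive_n f j x / INR (fact j).

Lemma tay_0 (f : R -> R) (x : R) : tay f 0 x = f x.
Proof. unfold tay; simpl. field. Qed.

Lemma pow_S_mono (A M : R) (j : nat) : 0 <= A <= M -> A ^ S j <= M ^ S j.
Proof. intros; apply pow_incr; assumption. Qed.

Lemma pseries_geom (a : nat -> R) (x l : R) :
  0 < x -> is_pseries a x l -> exists M, 0 < M /\ geom M (/ x) a.
Proof.
  intros Hx Ha. apply is_pseries_R in Ha.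
  assert (L : is_lim_seq (fun n => a n * x ^ n) 0)
    by (apply ex_series_lim_0; eexists; exact Ha).
  destruct (filterlim_bounded (fun n => a n * x ^ n)) as [M HM]; [exists 0; exact L|].
  exists (Rabs M + 1). split; [pose proof (Rabs_pos M); lra|].
  intros n. specialize (HM n). change (Rabs (a n * x ^ n) <= M) in HM.
  pose proof (pow_lt x n Hx). rewrite pow_inv.
  apply Rmult_le_reg_r with (x ^ n); [assumption|].
  rewrite Rmult_assoc, Rinv_l, Rmult_1_r by lra.
  rewrite Rabs_mult, (Rabs_pos_eq (x ^ n)) in HM by lra.
  pose proof (Rle_abs M). lra.
Qed.

(** In the form [M ^ S j] one number controls both the size and the inverse radius, and for [M >= 0]
    the bound increases with [M], as [compact_bound] requires. On the radius [r / 8] a series of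
    rate [2 / r], doubled by re-expansion, still has ratio at most one half. *)
Lemma pseries_local (f : R -> R) (a : nat -> R) (x0 r : R) :
  0 < r -> (forall x, Rabs (x - x0) < r -> is_pseries a (x - x0) (f x)) ->
  exists d M, 0 < d /\ (forall x, Rabs (x - x0) < d ->
    forall j, ex_derive_n f j x /\ Rabs (tay f j x) <= M ^ S j) /\
    forall j, tay f j x0 = a j.
Proof.
  intros Hr Ha.
  destruct (pseries_geom a (r / 2) (f (x0 + r / 2))) as [M [HM HG]]; [lra| |].
  { replace (r / 2) with (x0 + r / 2 - x0) at 1 by ring. apply Ha.
    replace (x0 + r / 2 - x0) with (r / 2) by ring. rewrite Rabs_pos_eq; lra. }
  set (tau := / (r / 2)) in *.
  assert (Htau : 0 < tau) by (apply Rinv_0_lt_compat; lra).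
  assert (Hsm : forall x, Rabs (x - x0) < r / 8 -> 4 * tau * Rabs (x - x0) <= 1).
  { intros x Hx. unfold tau. apply Rmult_le_reg_l with (r / 2); [lra|].
    field_simplify; lra. }
  assert (HD : forall j x, Rabs (x - x0) < r / 8 ->
    ex_derive_n f j x /\ tay f j x = shf a j (x - x0)).
  { intros j x Hx.
    destruct (fam_Derive_n (fun j x => shf a j (x - x0)) f x0 (r / 8)) with (j := j) (x := x)
      as [E1 E2]; [| |exact Hx|].
    - intros i y Hy. apply (is_derive_shift (shf a i) (- x0)).
      apply shf_derive with M tau; try assumption. apply Hsm, Hy.
    - intros y Hy. rewrite shf_0. symmetry. apply is_pseries_unique. apply Ha. lra.
    - split; [exact E1|]. unfold tay. rewrite E2. field. apply INR_fact_neq_0. }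
  exists (r / 8), (2 * M + 2 * tau). split; [lra|]. split.
  - intros x Hx j. destruct (HD j x Hx) as [E1 E2]. split; [exact E1|]. rewrite E2.
    eapply Rle_trans; [apply shf_bound with (M := M) (tau := tau); try assumption; apply Hsm, Hx|].
    simpl pow. apply Rmult_le_compat; try lra; [apply pow_le; lra|].
    apply pow_incr; lra.
  - intros j. destruct (HD j x0) as [_ E]; [rewrite Rminus_diag_eq, Rabs_R0 by reflexivity; lra|].
    rewrite E, Rminus_diag_eq by reflexivity. apply shf_at_0.
Qed.

Lemma analytic_local (f : R -> R) (x0 : R) :
  analytic f ->
  exists d M, 0 < d /\ forall x, Rabs (x - x0) < d ->
    forall j, ex_derive_n f j x /\ Rabs (tay f j x) <= M ^ S j.
Proof.
  intros Hf. destruct (Hf x0) as [a [r [Hr Ha]]].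
  destruct (pseries_local f a x0 r Hr Ha) as (d & M & Hd & H & _).
  exists d, M. split; assumption.
Qed.

Lemma analytic_ex_derive_n (f : R -> R) (j : nat) (x : R) :
  analytic f -> ex_derive_n f j x.
Proof.
  intros Hf. destruct (analytic_local f x Hf) as [d [M [Hd H]]].
  apply H. rewrite Rminus_diag_eq, Rabs_R0 by reflexivity. exact Hd.
Qed.

Lemma tay_derive (f : R -> R) (j : nat) (x : R) :
  analytic f -> is_derive (tay f j) x (INR (S j) * tay f (S j) x).
Proof.
  intros Hf. pose proof (analytic_ex_derive_n f (S j) x Hf) as H. simpl in H.
  unfold tay at 1.
  apply is_derive_ext with (fun y => / INR (fact j) * Derive_n f j y);
    [intros; unfold Rdiv; apply Rmult_comm|].
  evar_last; [apply is_derive_scal, Derive_correct, H|].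
  unfold tay. rewrite fact_simpl, mult_INR. simpl Derive_n.
  field. split; [apply INR_fact_neq_0|apply not_0_INR; lia].
Qed.

Lemma tay_compact (f : R -> R) (a b : R) :
  analytic f ->
  exists M, 0 < M /\ forall x, a <= x <= b -> forall j, Rabs (tay f j x) <= M ^ S j.
Proof.
  intros Hf.
  destruct (compact_bound (fun M y => 0 <= M /\ forall j, Rabs (tay f j y) <= M ^ S j) a b)
    as [M [HM H]].
  - intros M M' y HMM [H0 H]. split; [lra|]. intros j.
    eapply Rle_trans; [apply H|]. apply pow_S_mono; lra.
  - intros x _. destruct (analytic_local f x Hf) as [d [M [Hd H]]].
    exists d, (Rabs M). split; [exact Hd|]. intros y Hy. split; [apply Rabs_pos|].
    intros j. eapply Rle_trans; [apply H, Hy|].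
    rewrite RPow_abs. apply Rle_abs.
  - exists M. split; [exact HM|]. intros x Hx. apply H, Hx.
Qed.

Lemma tay_periodic (f : R -> R) (j : nat) : periodic f -> periodic (tay f j).
Proof.
  intros Hf x. unfold tay. f_equal. rewrite <- Derive_n_comp_trans.
  apply Derive_n_ext. exact Hf.
Qed.

Lemma tay_periodic_bound (f : R -> R) :
  analytic f -> periodic f ->
  exists M, 0 < M /\ forall x j, Rabs (tay f j x) <= M ^ S j.
Proof.
  intros Hf Hp. destruct (tay_compact f 0 (2 * PI) Hf) as [M [HM H]].
  exists M. split; [exact HM|]. intros x j.
  destruct (periodic_reduce x) as [y [Hy E]].
  rewrite (E (tay f j)) by (apply tay_periodic, Hp). apply H, Hy.
Qed.

Lemma continuous_compact_bound (f : R -> R) (a b : R) :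
  (forall x, a <= x <= b -> continuous f x) ->
  exists M, 0 < M /\ forall x, a <= x <= b -> Rabs (f x) <= M.
Proof.
  intros Hc. apply (compact_bound (fun M x => Rabs (f x) <= M)); [intros; lra|].
  intros x Hx. destruct (Hc x Hx (ball (f x) 1)) as [d Hd]; [apply (locally_ball _ (mkposreal 1 Rlt_0_1))|].
  exists d, (Rabs (f x) + 1). split; [apply cond_pos|].
  intros y Hy. specialize (Hd y Hy). change (Rabs (f y - f x) < 1) in Hd.
  replace (f y) with ((f y - f x) + f x) by ring.
  eapply Rle_trans; [apply Rabs_triang|lra].
Qed.

Lemma in_CT_bound (f : R -> R) :
  in_CT f -> exists M, 0 < M /\ forall x, Rabs (f x) <= M.
Proof.
  intros [Hc Hp].
  destruct (continuous_compact_bound f 0 (2 * PI)) as [M [HM H]]; [intros; apply Hc|].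
  exists M. split; [exact HM|]. intros x.
  destruct (periodic_reduce x) as [y [Hy E]]. rewrite (E f Hp). apply H, Hy.
Qed.

(** The reciprocal is again continuous and periodic; the inverse of its upper bound is the lower
    bound sought. *)
Lemma in_CT_pos_lower (f : R -> R) :
  in_CT f -> (forall x, 0 < f x) -> exists a, 0 < a /\ forall x, a <= f x.
Proof.
  intros [Hc Hp] Hpos.
  destruct (in_CT_bound (fun x => / f x)) as [M [HM H]].
  - split.
    + intros x. apply continuous_comp; [apply Hc|].
      apply (continuous_Rinv (f x)). pose proof (Hpos x); lra.
    + intros x. rewrite Hp. reflexivity.
  - exists (/ M). split; [apply Rinv_0_lt_compat, HM|]. intros x.
    specialize (H x). pose proof (Hpos x) as Hx.
    rewrite Rabs_pos_eq in H by (left; apply Rinv_0_lt_compat, Hx).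
    rewrite <- (Rinv_inv (f x)). apply Rinv_le_contravar; [apply Rinv_0_lt_compat, Hx|exact H].
Qed.

Lemma analytic_in_CT (f : R -> R) : analytic f -> periodic f -> in_CT f.
Proof.
  intros Hf Hp. split; [|exact Hp]. intros x.
  apply (ex_derive_continuous f). apply (analytic_ex_derive_n f 1 x Hf).
Qed.

(** * Fields of power series and nonlocal operators *)

Definition fld := R -> arr.

(** Up to degree [N] in time, [g x] consists of expansions at [x] of the same
    periodic functions. *)
Definition reg (N : nat) (g : fld) : Prop :=
  forall n k, (n <= N)%nat ->
    (forall x, is_derive (fun y => g y n k) x (adz (g x) n k)) /\
    periodic (fun y => g y n k).

(** The value at [h = 0] is the limit [h -> 0]. *)
Definition dquo (h : R) (g : fld) : fld := fun x n k =>
  if Req_EM_T h 0 then adz (g x) n k else (g (x + h) n k - g x n k) / h.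

(** Convolution with the rescaled kernel after the substitution [y = mu * z]. The domain of
    integration no longer depends on [mu], and [mu = 0] becomes admissible, with the identity as
    operator ([cnv_0]): this is how the gas equations enter the same family. *)
Definition cnv (phi : R -> R) (A mu : R) (f : R -> R) (x : R) : R :=
  RInt (fun z => phi z * f (x - mu * z)) (- A) A.

Definition aconv (phi : R -> R) (A mu : R) (g : fld) : fld := fun x n k =>
  cnv phi A mu (fun y => g y n k) x.

(** The two orders of differentiability give the continuity of [phi] and of [Derive phi]; the latter
    serves when the derivative of a convolution falls on the kernel. *)
Record kernel (phi : R -> R) (A : R) : Prop := {
  kernel_A : 0 < A;
  kernel_derive : forall x, ex_derive phi x;
  kernel_derive2 : forall x, ex_derive (Derive phi) x;
  kernel_ge0 : forall x, 0 <= phi x;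
  kernel_support : forall x, A <= Rabs x -> phi x = 0;
  kernel_int : RInt phi (- A) A = 1
}.

Lemma ex_derive_cont (f : R -> R) (x : R) : ex_derive f x -> continuous f x.
Proof. apply (ex_derive_continuous f). Qed.

Lemma reg_plus (N : nat) (f g : fld) :
  reg N f -> reg N g -> reg N (fun x n k => f x n k + g x n k).
Proof.
  intros Hf Hg n k Hn. destruct (Hf n k Hn) as [F1 F2]. destruct (Hg n k Hn) as [G1 G2].
  split.
  - intros x. evar_last; [apply (is_derive_plus (fun y => f y n k) (fun y => g y n k)); auto|].
    unfold adz, plus; simpl; ring.
  - intros x. rewrite F2, G2. reflexivity.
Qed.

Lemma reg_scal (N : nat) (c : R) (f : fld) :
  reg N f -> reg N (fun x n k => c * f x n k).
Proof.
  intros Hf n k Hn. destruct (Hf n k Hn) as [F1 F2]. split.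
  - intros x. evar_last; [apply (is_derive_scal (fun y => f y n k)), F1|].
    unfold adz; ring.
  - intros x. rewrite F2. reflexivity.
Qed.

Lemma reg_const (N : nat) (c : R) : reg N (fun _ n k => c * aone n k).
Proof.
  intros n k _. split; [|intros x; reflexivity].
  intros x. evar_last; [apply (is_derive_const (c * aone n k))|].
  unfold adz, zero; simpl. rewrite aone_eq0 by lia. ring.
Qed.

Lemma is_derive_sum (f : nat -> R -> R) (df : nat -> R) (n : nat) (x : R) :
  (forall i, (i <= n)%nat -> is_derive (f i) x (df i)) ->
  is_derive (fun y => sum_f_R0 (fun i => f i y) n) x (sum_f_R0 df n).
Proof.
  intros H; induction n as [|n IH].
  - simpl. apply H; lia.
  - simpl. apply (is_derive_plus (fun y => sum_f_R0 (fun i => f i y) n) (f (S n))).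
    + apply IH; intros; apply H; lia.
    + apply H; lia.
Qed.

Lemma is_derive_amul (f g : fld) (f' g' : arr) (N n k : nat) (x : R) :
  (forall i l, (i <= N)%nat -> is_derive (fun y => f y i l) x (f' i l)) ->
  (forall i l, (i <= N)%nat -> is_derive (fun y => g y i l) x (g' i l)) ->
  (n <= N)%nat ->
  is_derive (fun y => amul (f y) (g y) n k) x (amul f' (g x) n k + amul (f x) g' n k).
Proof.
  intros Hf Hg Hn. unfold amul. rewrite <- plus_sum. apply is_derive_sum; intros i Hi.
  rewrite <- plus_sum.
  apply (is_derive_sum (fun l y => f y i l * g y (n - i)%nat (k - l)%nat)); intros l Hl.
  evar_last.
  - apply (is_derive_mult (fun y => f y i l) (fun y => g y (n - i)%nat (k - l)%nat));
      [apply Hf; lia|apply Hg; lia|intros; apply Rmult_comm].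
  - unfold plus, mult; simpl. ring.
Qed.

Lemma reg_mul (N : nat) (f g : fld) :
  reg N f -> reg N g -> reg N (fun x => amul (f x) (g x)).
Proof.
  intros Hf Hg n k Hn. split.
  - intros x. rewrite adz_amul. apply is_derive_amul with N; [| |exact Hn];
      intros i l Hi; [apply (Hf i l Hi)|apply (Hg i l Hi)].
  - intros x. apply amul_ext; intros i l Hi Hl; [apply (Hf i l); lia|apply (Hg i l); lia].
Qed.

(** The constant term being subtracted, [acut f] is not made of expansions of
    fixed functions; the correction [f_{01}] cancels in [acomp]. *)
Lemma is_derive_apow_acut (N : nat) (f : fld) (j n k : nat) (x : R) :
  reg N f -> (n <= N)%nat ->
  is_derive (fun y => apow (acut (f y)) j n k) x
    (adz (apow (acut (f x)) j) n k
     - INR j * (f x O 1%nat * apow (acut (f x)) (pred j) n k)).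
Proof.
  intros Hf. revert n k. induction j as [|j IH]; intros n k Hn.
  - simpl. rewrite adz_aone, Rmult_0_l, Rminus_0_r.
    apply (is_derive_const (aone n k)).
  - evar_last.
    + apply (is_derive_amul (fun y => acut (f y)) (fun y => apow (acut (f y)) j)
        (fun i l => adz (acut (f x)) i l + (- f x O 1%nat) * aone i l)
        (fun i l => adz (apow (acut (f x)) j) i l
           + (- (INR j * f x O 1%nat)) * apow (acut (f x)) (pred j) i l) N n k x);
        [| |exact Hn].
      * intros i l Hi. destruct (Nat.eq_dec (i + l) 0) as [E|E].
        -- replace i with O by lia; replace l with O by lia.
           evar_last; [apply (is_derive_const 0)|]. unfold adz, zero; simpl; ring.
        -- apply is_derive_ext with (fun y => f y i l);
             [intros; symmetry; apply acut_neq; lia|].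
           rewrite aone_eq0, Rmult_0_r, Rplus_0_r by lia.
           unfold adz. rewrite acut_neq by lia. apply (Hf i l Hi).
      * intros i l Hi. evar_last; [apply IH, Hi|]. ring.
    + rewrite amul_plus_l, amul_plus_r, amul_scal_l, amul_scal_r, amul_1l.
      simpl apow. simpl pred. rewrite adz_amul, S_INR.
      destruct j as [|j]; [simpl; ring|]. simpl apow. simpl pred. ring.
Qed.

Lemma reg_comp (N : nat) (H : nat -> R -> R) (f : fld) :
  reg N f ->
  (forall j x, is_derive (H j) (f x O O) (INR (S j) * H (S j) (f x O O))) ->
  reg N (fun x => acomp H (f x)).
Proof.
  intros Hf HH n k Hn. split.
  (* One above [n + k]: the derivative reads the degree [S k] in [z], and the boundary term of the
     telescoping below contains the power [J] at degree [(n, k)], which vanishes because [J] exceeds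
     [n + k]. *)
  - intros x. set (J := S (n + k)).
    apply is_derive_ext with (fun y => sum_f_R0
      (fun j => H j (f y O O) * apow (acut (f y)) j n k) J).
    { intros y; symmetry; apply acomp_trunc; unfold J; lia. }
    evar_last.
    + apply (is_derive_sum (fun j y => H j (f y O O) * apow (acut (f y)) j n k)).
      intros j Hj.
      apply (is_derive_mult (fun y => H j (f y O O)) (fun y => apow (acut (f y)) j n k)).
      * apply (is_derive_comp (H j) (fun y => f y O O)); [apply HH|].
        apply (Hf O O); lia.
      * apply is_derive_apow_acut with N; assumption.
      * intros; apply Rmult_comm.
    + unfold adz at 3. rewrite (acomp_trunc H (f x) n (S k) J) by (unfold J; lia).
      rewrite <- sum_scal_l.
      (* Telescoping: differentiating [H j] produces [(j + 1) H_{j+1}] times [f_{01}] and the power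
         [j], which cancels the correction carried by the power [j + 1]. Only the boundary term at
         [m] survives. *)
      assert (T : forall m, (m <= J)%nat -> sum_f_R0 (fun j =>
        (plus (mult (scal (adz (f x) 0%nat 0%nat) (INR (S j) * H (S j) (f x 0%nat 0%nat)))
            (apow (acut (f x)) j n k))
          (mult (H j (f x 0%nat 0%nat))
            (adz (apow (acut (f x)) j) n k -
             INR j * (f x 0%nat 1%nat * apow (acut (f x)) (Init.Nat.pred j) n k))))) m
        = sum_f_R0 (fun j => INR (S k) * (H j (f x O O) * apow (acut (f x)) j n (S k))) m
          + INR (S m) * (f x O 1%nat * (H (S m) (f x O O) * apow (acut (f x)) m n k))).
      { assert (F : adz (f x) 0%nat 0%nat = f x O 1%nat) by (unfold adz; simpl; ring).
        rewrite F. induction m as [|m IH]; intros Hm.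
        - simpl sum_f_R0. unfold adz, plus, mult, scal; simpl. unfold mult; simpl. ring.
        - rewrite !tech5, IH by lia. simpl Init.Nat.pred.
          unfold adz, plus, mult, scal. cbn -[INR]. unfold mult. cbn -[INR]. ring. }
      etransitivity; [exact (T J (le_n _))|].
      rewrite (apow_order (acut (f x)) J n k); [ring|reflexivity|unfold J; lia].
  - intros x. unfold acomp. apply sum_ext; intros j _.
    assert (E : forall i l, (i <= N)%nat -> f (x + 2 * PI) i l = f x i l)
      by (intros i l Hi; apply (Hf i l Hi)).
    rewrite E by lia. f_equal. apply (apow_ext _ _ N); [|exact Hn].
    intros i l Hi. destruct i, l; simpl; try reflexivity; apply E, Hi.
Qed.

Lemma reg_adz (N : nat) (f : fld) : reg N f -> reg N (fun x => adz (f x)).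
Proof.
  intros Hf n k Hn. destruct (Hf n (S k) Hn) as [F1 F2]. split.
  - intros x. unfold adz at 1 2. apply (is_derive_scal (fun y => f y n (S k))), F1.
  - intros x. unfold adz. rewrite F2. reflexivity.
Qed.

Lemma periodic_shift (f : R -> R) (h : R) : periodic f -> periodic (fun y => f (y + h)).
Proof.
  intros Hf x. replace (x + 2 * PI + h) with (x + h + 2 * PI) by ring. apply Hf.
Qed.

Lemma reg_dquo (N : nat) (h : R) (f : fld) : reg N f -> reg N (dquo h f).
Proof.
  intros Hf. unfold dquo. destruct (Req_EM_T h 0) as [E|E].
  - exact (reg_adz N f Hf).
  - intros n k Hn. destruct (Hf n k Hn) as [F1 F2]. split.
    + intros x. apply is_derive_ext with (fun y => / h * (f (y + h) n k - f y n k));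
        [intros; unfold Rdiv; apply Rmult_comm|].
      evar_last.
      * apply (is_derive_scal (fun y => f (y + h) n k - f y n k)).
        apply (is_derive_minus (fun y => f (y + h) n k) (fun y => f y n k)); [|apply F1].
        apply (is_derive_shift (fun y => f y n k)), F1.
      * unfold adz, minus, plus, opp; simpl; field; exact E.
    + intros x. pose proof (periodic_shift _ h F2 x) as H. simpl in H.
      rewrite H, F2. reflexivity.
Qed.

Lemma continuous_kernel_prod (phi f : R -> R) (A mu x z : R) :
  kernel phi A -> (forall y, continuous f y) ->
  continuous (fun z => phi z * f (x - mu * z)) z.
Proof.
  intros Hk Hf. apply (continuous_mult phi (fun z => f (x - mu * z))).
  - apply ex_derive_cont, (kernel_derive _ _ Hk).
  - apply (continuous_comp (fun z => x - mu * z) f); [|apply Hf].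
    apply ex_derive_cont. auto_derive. exact I.
Qed.

Lemma ex_RInt_kernel_prod (phi f : R -> R) (A mu x : R) :
  kernel phi A -> (forall y, continuous f y) ->
  ex_RInt (fun z => phi z * f (x - mu * z)) (- A) A.
Proof.
  intros Hk Hf. apply (ex_RInt_continuous (fun z => phi z * f (x - mu * z))). intros z _.
  apply (continuous_kernel_prod phi f A); assumption.
Qed.

Lemma cnv_derive (phi f f' : R -> R) (A mu x : R) :
  kernel phi A -> (forall y, is_derive f y (f' y)) -> (forall y, continuous f' y) ->
  is_derive (cnv phi A mu f) x (cnv phi A mu f' x).
Proof.
  intros Hk Hf Hf'.
  assert (D : forall z y, is_derive (fun u => phi z * f (u - mu * z)) y (phi z * f' (y - mu * z))).
  { intros z y. apply (is_derive_scal (fun u => f (u - mu * z))).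
    apply (is_derive_shift f (- (mu * z))), Hf. }
  assert (Cf : forall y, continuous f y) by (intros y; apply ex_derive_cont; eexists; apply Hf).
  evar_last.
  - apply (is_derive_RInt_param (fun y z => phi z * f (y - mu * z)) (- A) A x).
    + apply filter_forall. intros y z _. eexists; apply D.
    + intros z _. apply continuity_2d_pt_ext with (fun u v => phi v * f' (u - mu * v)).
      { intros u v; symmetry; apply is_derive_unique, D. }
      apply continuity_2d_pt_mult.
      * apply (continuity_1d_2d_pt_comp phi (fun u v => v)).
        -- apply continuity_pt_filterlim, ex_derive_cont, (kernel_derive _ _ Hk).
        -- apply continuity_2d_pt_id2.
      * apply (continuity_1d_2d_pt_comp f' (fun u v => u - mu * v)).
        -- apply continuity_pt_filterlim, Hf'.
        -- apply continuity_2d_pt_minus; [apply continuity_2d_pt_id1|].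
           apply continuity_2d_pt_mult; [apply continuity_2d_pt_const|apply continuity_2d_pt_id2].
    + apply filter_forall. intros y. apply ex_RInt_kernel_prod; assumption.
  - apply RInt_ext. intros z _. apply is_derive_unique, D.
Qed.

(** A nonnegative kernel of mass one takes averages. The difference is estimated only at the points
    [x - mu * z] that enter the average, so that one of the two functions may be the constant equal
    to a value at [x]. *)
Lemma cnv_minus_le (phi f g : R -> R) (A mu x M : R) :
  kernel phi A -> (forall y, continuous f y) -> (forall y, continuous g y) ->
  (forall z, - A <= z <= A -> Rabs (f (x - mu * z) - g (x - mu * z)) <= M) ->
  Rabs (cnv phi A mu f x - cnv phi A mu g x) <= M.
Proof.
  intros Hk Hf Hg HM. pose proof (kernel_A _ _ Hk) as HA.
  unfold cnv. rewrite <- (RInt_minus (V := R_CompleteNormedModule))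
    by (apply ex_RInt_kernel_prod; assumption).
  assert (Cphi : forall z, continuous phi z)
    by (intros; apply ex_derive_cont, (kernel_derive _ _ Hk)).
  assert (Iphi : ex_RInt phi (- A) A) by (apply (ex_RInt_continuous phi); intros; apply Cphi).
  assert (E : RInt (fun z => phi z * M) (- A) A = M).
  { rewrite (RInt_ext _ (fun z => scal M (phi z)))
      by (intros; unfold scal; simpl; unfold mult; simpl; ring).
    rewrite (RInt_scal (V := R_CompleteNormedModule)) by exact Iphi.
    rewrite (kernel_int _ _ Hk). unfold scal; simpl. apply Rmult_1_r. }
  eapply Rle_trans; [apply (abs_RInt_le (fun z => minus (phi z * f (x - mu * z)) (phi z * g (x - mu * z))))|].
  - lra.
  - apply (ex_RInt_minus (V := R_NormedModule)); apply ex_RInt_kernel_prod; assumption.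
  - rewrite <- E. apply RInt_le; [lra| | |].
    + apply (ex_RInt_continuous (V := R_CompleteNormedModule)). intros z _.
      apply (continuous_comp (fun z => minus (phi z * f (x - mu * z)) (phi z * g (x - mu * z))) Rabs);
        [|apply continuous_Rabs].
      apply (continuous_minus (fun z => phi z * f (x - mu * z)));
        apply continuous_kernel_prod with A; assumption.
    + apply (ex_RInt_continuous (V := R_CompleteNormedModule)). intros z _.
      apply (continuous_mult phi (fun _ => M)); [apply Cphi|apply continuous_const].
    + intros z Hz.
      replace (minus (phi z * f (x - mu * z)) (phi z * g (x - mu * z)))
        with (phi z * (f (x - mu * z) - g (x - mu * z)))
        by (unfold minus, plus, opp; simpl; ring).
      rewrite Rabs_mult, (Rabs_pos_eq (phi z)) by apply (kernel_ge0 _ _ Hk).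
      apply Rmult_le_compat_l; [apply (kernel_ge0 _ _ Hk)|apply HM; lra].
Qed.

Lemma cnv_const (phi : R -> R) (A mu c x : R) :
  kernel phi A -> cnv phi A mu (fun _ => c) x = c.
Proof.
  intros Hk. unfold cnv.
  rewrite (RInt_ext _ (fun z => scal c (phi z)))
    by (intros; unfold scal; simpl; unfold mult; simpl; ring).
  rewrite (RInt_scal (V := R_CompleteNormedModule)).
  - rewrite (kernel_int _ _ Hk). unfold scal; simpl. apply Rmult_1_r.
  - apply (ex_RInt_continuous phi). intros; apply ex_derive_cont, (kernel_derive _ _ Hk).
Qed.

Lemma cnv_0 (phi f : R -> R) (A x : R) : kernel phi A -> cnv phi A 0 f x = f x.
Proof.
  intros Hk. rewrite <- (cnv_const phi A 0 (f x) x Hk). unfold cnv.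
  apply RInt_ext. intros z _. f_equal. f_equal. ring.
Qed.

Lemma cnv_ext (phi f g : R -> R) (A mu x : R) :
  (forall y, f y = g y) -> cnv phi A mu f x = cnv phi A mu g x.
Proof. intros E. apply RInt_ext. intros z _. rewrite E. reflexivity. Qed.

Lemma cnv_le (phi f : R -> R) (A mu x M : R) :
  kernel phi A -> (forall y, continuous f y) -> (forall y, Rabs (f y) <= M) ->
  Rabs (cnv phi A mu f x) <= M.
Proof.
  intros Hk Hf HM. rewrite <- (Rminus_0_r (cnv _ _ _ _ _)).
  rewrite <- (cnv_const phi A mu 0 x Hk).
  apply cnv_minus_le; try assumption; [intros; apply continuous_const|].
  intros. rewrite Rminus_0_r. apply HM.
Qed.

Lemma cnv_scal (phi f : R -> R) (A mu c x : R) :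
  kernel phi A -> (forall y, continuous f y) ->
  cnv phi A mu (fun y => c * f y) x = c * cnv phi A mu f x.
Proof.
  intros Hk Hf. unfold cnv.
  rewrite (RInt_ext _ (fun z => scal c (phi z * f (x - mu * z))))
    by (intros; unfold scal; simpl; unfold mult; simpl; ring).
  rewrite (RInt_scal (V := R_CompleteNormedModule)); [reflexivity|].
  apply ex_RInt_kernel_prod; assumption.
Qed.

Lemma cnv_plus (phi f g : R -> R) (A mu x : R) :
  kernel phi A -> (forall y, continuous f y) -> (forall y, continuous g y) ->
  cnv phi A mu (fun y => f y + g y) x = cnv phi A mu f x + cnv phi A mu g x.
Proof.
  intros Hk Hf Hg. unfold cnv.
  rewrite (RInt_ext _ (fun z => plus (phi z * f (x - mu * z)) (phi z * g (x - mu * z))))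
    by (intros; unfold plus; simpl; ring).
  rewrite (RInt_plus (V := R_CompleteNormedModule)); [reflexivity| |];
    apply ex_RInt_kernel_prod; assumption.
Qed.

Lemma reg_continuous (N : nat) (f : fld) (n k : nat) :
  reg N f -> (n <= N)%nat -> forall y, continuous (fun y => f y n k) y.
Proof.
  intros Hf Hn y. apply ex_derive_cont. eexists. apply (Hf n k Hn).
Qed.

Lemma reg_aconv (N : nat) (phi : R -> R) (A mu : R) (f : fld) :
  kernel phi A -> reg N f -> reg N (aconv phi A mu f).
Proof.
  intros Hk Hf n k Hn. split.
  - intros x. unfold aconv at 1. evar_last.
    + apply (cnv_derive phi (fun y => f y n k) (fun y => adz (f y) n k) A mu x Hk).
      * apply (Hf n k Hn).
      * apply (reg_continuous N (fun x => adz (f x)) n k); [apply reg_adz, Hf|exact Hn].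
    + unfold adz, aconv. apply cnv_scal; [exact Hk|].
      apply (reg_continuous N); assumption.
  - intros x. unfold aconv, cnv. apply RInt_ext. intros z _. f_equal.
    replace (x + 2 * PI - mu * z) with (x - mu * z + 2 * PI) by ring.
    apply (Hf n k Hn).
Qed.

(** * Bounds for nonlocal operators *)

(** The quotient of coefficients is a formal derivative at an intermediate point. That point varies
    with the degree, which is harmless since the bound on [f] is uniform in the base point; no power
    of [1 / h] appears. *)
Lemma bd1_dquo (tau sigma : R) (N : nat) (M h : R) (f : fld) :
  0 < tau -> 0 < sigma -> 0 <= M -> reg N f ->
  (forall x, bd tau sigma N M (f x)) ->
  forall x, bd1 tau sigma N (sigma * M) (dquo h f x).
Proof.
  intros Ht Hs HM Hr Hf x. unfold dquo. destruct (Req_EM_T h 0) as [E|E].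
  - intros n k Hn. apply bd1_adz with N; auto.
  - intros n k Hn.
    destruct (mvt (fun y => f y n k) (fun y => adz (f y) n k) x (x + h)) as [c [_ Ec]].
    { intros y _. apply (Hr n k Hn). }
    replace ((f (x + h) n k - f x n k) / h) with (adz (f c) n k)
      by (rewrite Ec; field; exact E).
    apply bd1_adz with N; auto.
Qed.

Lemma bd_aconv (tau sigma : R) (N : nat) (M mu A : R) (phi : R -> R) (f : fld) :
  kernel phi A -> reg N f ->
  (forall x, bd tau sigma N M (f x)) ->
  forall x, bd tau sigma N M (aconv phi A mu f x).
Proof.
  intros Hk Hr Hf x n k Hn. apply cnv_le; [exact Hk| |].
  - apply (reg_continuous N); assumption.
  - intros y. apply Hf, Hn.
Qed.

(** * Uniform limits as the mesh size tends to zero *)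

Definition ubd (p : R -> R -> R) : Prop :=
  exists M, forall e, 0 <= e < 1 -> forall x, Rabs (p e x) <= M.

Definition ucv (p : R -> R -> R) : Prop :=
  forall d, 0 < d -> exists e0, 0 < e0 <= 1 /\
    forall e, 0 < e < e0 -> forall x, Rabs (p e x - p 0 x) <= d.

(** Boundedness travels with convergence because products of uniformly convergent families require
    it. *)
Definition ucb (p : R -> R -> R) : Prop := ubd p /\ ucv p.

Definition cok (N : nat) (g : R -> fld) : Prop :=
  forall n k, (n <= N)%nat -> ucb (fun e x => g e x n k).

Lemma ucb_ext (p q : R -> R -> R) :
  (forall e x, 0 <= e < 1 -> p e x = q e x) -> ucb p -> ucb q.
Proof.
  intros E [[M HM] Hp]. split.
  - exists M. intros e He x. rewrite <- E by exact He. apply HM, He.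
  - intros d Hd. destruct (Hp d Hd) as [e0 [He0 H]]. exists e0. split; [exact He0|].
    intros e He x. rewrite <- !E by lra. apply H, He.
Qed.

Lemma ucb_const (f : R -> R) (M : R) :
  (forall x, Rabs (f x) <= M) -> ucb (fun _ x => f x).
Proof.
  intros HM. split.
  - exists M. intros; apply HM.
  - intros d Hd. exists 1. split; [lra|]. intros e _ x.
    rewrite Rminus_diag_eq, Rabs_R0 by reflexivity. lra.
Qed.

Lemma ucv_bound (p : R -> R -> R) (q : nat -> R -> R -> R) (C : R) :
  0 <= C ->
  (exists n, forall e x, 0 < e < 1 ->
     Rabs (p e x - p 0 x) <= C * sum_f_R0 (fun i => Rabs (q i e x - q i 0 x)) n) ->
  (forall i, ucv (q i)) -> ucv p.
Proof.
  intros HC [n Hn] Hq.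
  assert (Hs : forall d, 0 < d -> exists e0, 0 < e0 <= 1 /\ forall e, 0 < e < e0 -> forall x,
    sum_f_R0 (fun i => Rabs (q i e x - q i 0 x)) n <= d).
  { clear Hn. induction n as [|n IH]; intros d Hd.
    - apply Hq, Hd.
    - destruct (IH (d / 2)) as [e1 [He1 H1]]; [lra|].
      destruct (Hq (S n) (d / 2)) as [e2 [He2 H2]]; [lra|].
      exists (Rmin e1 e2). split.
      + split; [apply Rmin_glb_lt; lra|]. eapply Rle_trans; [apply Rmin_l|lra].
      + intros e He x. pose proof (Rmin_l e1 e2); pose proof (Rmin_r e1 e2).
        simpl. specialize (H1 e ltac:(lra) x). specialize (H2 e ltac:(lra) x). lra. }
  intros d Hd. destruct (Hs (d / (C + 1))) as [e0 [He0 H]].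
  - apply Rdiv_lt_0_compat; lra.
  - exists e0. split; [exact He0|]. intros e He x.
    eapply Rle_trans; [apply Hn; lra|].
    apply Rle_trans with (C * (d / (C + 1))).
    + apply Rmult_le_compat_l; [exact HC|apply H, He].
    + apply Rmult_le_reg_r with (C + 1); [lra|]. field_simplify; [|lra]. nra.
Qed.

Lemma ucb_plus (p q : R -> R -> R) :
  ucb p -> ucb q -> ucb (fun e x => p e x + q e x).
Proof.
  intros [[M HM] Hp] [[M' HM'] Hq]. split.
  - exists (M + M'). intros e He x. specialize (HM e He x); specialize (HM' e He x).
    eapply Rle_trans; [apply Rabs_triang|lra].
  - apply (ucv_bound _ (fun i => match i with O => p | _ => q end) 1); [lra| |].
    + exists 1%nat. intros e x _. simpl.
      replace (p e x + q e x - (p 0 x + q 0 x)) with ((p e x - p 0 x) + (q e x - q 0 x)) by ring.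
      rewrite Rmult_1_l. apply Rabs_triang.
    + intros [|i]; assumption.
Qed.

Lemma ucb_mult (p q : R -> R -> R) :
  ucb p -> ucb q -> ucb (fun e x => p e x * q e x).
Proof.
  intros [[M HM] Hp] [[M' HM'] Hq].
  assert (HM0 : 0 <= M) by (eapply Rle_trans; [apply Rabs_pos|apply (HM 0 ltac:(lra) 0)]).
  assert (HM0' : 0 <= M') by (eapply Rle_trans; [apply Rabs_pos|apply (HM' 0 ltac:(lra) 0)]).
  split.
  - exists (M * M'). intros e He x. rewrite Rabs_mult.
    apply Rmult_le_compat; try apply Rabs_pos; auto.
  - apply (ucv_bound _ (fun i => match i with O => p | _ => q end) (M + M')); [lra| |].
    + exists 1%nat. intros e x He. simpl.
      replace (p e x * q e x - p 0 x * q 0 x)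
        with ((p e x - p 0 x) * q e x + p 0 x * (q e x - q 0 x)) by ring.
      eapply Rle_trans; [apply Rabs_triang|]. rewrite !Rabs_mult.
      specialize (HM 0 ltac:(lra) x). specialize (HM' e ltac:(lra) x).
      pose proof (Rabs_pos (p e x - p 0 x)). pose proof (Rabs_pos (q e x - q 0 x)). nra.
    + intros [|i]; assumption.
Qed.

Lemma ucb_scal (c : R) (p : R -> R -> R) : ucb p -> ucb (fun e x => c * p e x).
Proof.
  intros Hp. apply ucb_mult; [|exact Hp].
  apply (ucb_const (fun _ => c) (Rabs c)). intros; lra.
Qed.

Lemma ucb_sum (p : nat -> R -> R -> R) (n : nat) :
  (forall i, (i <= n)%nat -> ucb (p i)) -> ucb (fun e x => sum_f_R0 (fun i => p i e x) n).
Proof.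
  intros H; induction n as [|n IH].
  - apply H; lia.
  - simpl. apply ucb_plus; [apply IH; intros; apply H; lia|apply H; lia].
Qed.

Lemma cok_plus (N : nat) (f g : R -> fld) :
  cok N f -> cok N g -> cok N (fun e x n k => f e x n k + g e x n k).
Proof. intros Hf Hg n k Hn. apply ucb_plus; auto. Qed.

Lemma cok_scal (N : nat) (c : R) (f : R -> fld) :
  cok N f -> cok N (fun e x n k => c * f e x n k).
Proof. intros Hf n k Hn. apply ucb_scal; auto. Qed.

Lemma cok_aone (N : nat) (p : R -> R -> R) :
  ucb p -> cok N (fun e x n k => p e x * aone n k).
Proof.
  intros Hp n k _. apply ucb_mult; [exact Hp|].
  apply (ucb_const (fun _ => aone n k) (Rabs (aone n k))). intros; lra.
Qed.

Lemma cok_mul (N : nat) (f g : R -> fld) :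
  cok N f -> cok N g -> cok N (fun e x => amul (f e x) (g e x)).
Proof.
  intros Hf Hg n k Hn. unfold amul.
  apply (ucb_sum (fun i e x => sum_f_R0 (fun l => f e x i l * g e x (n - i)%nat (k - l)%nat) k)).
  intros i Hi. apply (ucb_sum (fun l e x => f e x i l * g e x (n - i)%nat (k - l)%nat)).
  intros l Hl. apply ucb_mult; [apply Hf; lia|apply Hg; lia].
Qed.

Lemma cok_acut (N : nat) (f : R -> fld) : cok N f -> cok N (fun e x => acut (f e x)).
Proof.
  intros Hf n k Hn. destruct (Nat.eq_dec (n + k) 0) as [E|E].
  - replace n with O by lia; replace k with O by lia.
    apply (ucb_const (fun _ => 0) 0). intros; rewrite Rabs_R0; lra.
  - apply ucb_ext with (fun e x => f e x n k); [|apply Hf, Hn].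
    intros; symmetry; apply acut_neq; lia.
Qed.

Lemma cok_apow (N : nat) (f : R -> fld) (j : nat) :
  cok N f -> cok N (fun e x => apow (f e x) j).
Proof.
  intros Hf; induction j as [|j IH].
  - intros n k _. apply (ucb_const (fun _ => aone n k) (Rabs (aone n k))). intros; simpl; lra.
  - apply (cok_mul N f (fun e x => apow (f e x) j)); assumption.
Qed.

Lemma cok_acomp (N : nat) (H : nat -> R -> R) (f : R -> fld) :
  cok N f -> (forall j, ucb (fun e x => H j (f e x O O))) ->
  cok N (fun e x => acomp H (f e x)).
Proof.
  intros Hf HH n k Hn. unfold acomp.
  apply (ucb_sum (fun j e x => H j (f e x O O) * apow (acut (f e x)) j n k)).
  intros j _. apply ucb_mult; [apply HH|].
  apply (cok_apow N (fun e x => acut (f e x))); [apply cok_acut, Hf|exact Hn].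
Qed.

Lemma cok_adz (N : nat) (f : R -> fld) : cok N f -> cok N (fun e x => adz (f e x)).
Proof. intros Hf n k Hn. unfold adz. apply ucb_scal, Hf, Hn. Qed.

(** Second [x]-derivatives of the coefficients are, up to factors, coefficients of higher degree in
    [z], which [cok] already bounds uniformly in [e]. The quotient thus differs from [adz] by
    [O(e)], and [adz] converges. The sign [s] covers forward and backward quotients. *)
Lemma cok_dquo (N : nat) (s : R) (f : R -> fld) :
  Rabs s = 1 -> cok N f -> (forall e, 0 <= e < 1 -> reg N (f e)) ->
  cok N (fun e => dquo (s * e) (f e)).
Proof.
  intros Hs Hf Hr n k Hn.
  assert (Hs0 : s <> 0) by (intros E; rewrite E, Rabs_R0 in Hs; lra).
  assert (Hf1 := cok_adz N f Hf). assert (Hf2 := cok_adz N _ Hf1).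
  destruct (Hf1 n k Hn) as [[M1 HM1] C1]. destruct (Hf2 n k Hn) as [[M2 HM2] _].
  assert (HM20 : 0 <= M2) by (eapply Rle_trans; [apply Rabs_pos|apply (HM2 0 ltac:(lra) 0)]).
  assert (Q : forall e x, 0 < e < 1 ->
     Rabs (dquo (s * e) (f e) x n k - adz (f e x) n k) <= M2 * e).
  { intros e x He. unfold dquo. destruct (Req_EM_T (s * e) 0) as [E|E].
    - rewrite Rminus_diag_eq, Rabs_R0 by reflexivity. nra.
    - replace (M2 * e) with (M2 * Rabs (s * e))
        by (rewrite Rabs_mult, Hs, Rmult_1_l, Rabs_pos_eq; lra).
      apply (diff_quot_error (fun y => f e y n k) (fun y => adz (f e y) n k)
        (fun y => adz (adz (f e y)) n k)); [exact E|].
      assert (He' : 0 <= e < 1) by lra. intros y _. split; [|split].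
      + apply (Hr e He' n k Hn).
      + apply (proj1 (reg_adz N (f e) (Hr e He') n k Hn)).
      + apply HM2, He'. }
  split.
  - exists (M1 + M2). intros e He x.
    destruct (Req_EM_T e 0) as [->|Hne].
    + unfold dquo. destruct (Req_EM_T (s * 0) 0) as [E|E]; [|exfalso; apply E; ring].
      specialize (HM1 0 He x). lra.
    + specialize (Q e x ltac:(lra)). specialize (HM1 e He x).
      replace (dquo (s * e) (f e) x n k)
        with ((dquo (s * e) (f e) x n k - adz (f e x) n k) + adz (f e x) n k) by ring.
      eapply Rle_trans; [apply Rabs_triang|]. nra.
  - intros d Hd. destruct (C1 (d / 2)) as [e1 [He1 H1]]; [lra|].
    assert (Hp : 0 < d / (2 * (M2 + 1))) by (apply Rdiv_lt_0_compat; lra).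
    exists (Rmin e1 (d / (2 * (M2 + 1)))). split.
    + split; [apply Rmin_glb_lt; lra|]. eapply Rle_trans; [apply Rmin_l|lra].
    + intros e He x.
      pose proof (Rmin_l e1 (d / (2 * (M2 + 1)))); pose proof (Rmin_r e1 (d / (2 * (M2 + 1)))).
      specialize (Q e x ltac:(lra)). specialize (H1 e ltac:(lra) x).
      replace (dquo (s * 0) (f 0) x n k) with (adz (f 0 x) n k)
        by (unfold dquo; destruct (Req_EM_T (s * 0) 0) as [E|E]; [reflexivity|exfalso; apply E; ring]).
      replace (dquo (s * e) (f e) x n k - adz (f 0 x) n k) with
        ((dquo (s * e) (f e) x n k - adz (f e x) n k) + (adz (f e x) n k - adz (f 0 x) n k)) by ring.
      eapply Rle_trans; [apply Rabs_triang|].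
      assert (M2 * e <= d / 2); [|lra].
      assert (E : (M2 + 1) * (d / (2 * (M2 + 1))) = d / 2) by (field; lra). nra.
Qed.

Lemma cok_aconv (N : nat) (phi : R -> R) (A : R) (mu : R -> R) (f : R -> fld) :
  kernel phi A -> mu 0 = 0 -> ucv (fun e _ => mu e) ->
  cok N f -> (forall e, 0 <= e < 1 -> reg N (f e)) ->
  cok N (fun e => aconv phi A (mu e) (f e)).
Proof.
  intros Hk Hmu0 Hmu Hf Hr n k Hn. pose proof (kernel_A _ _ Hk) as HA.
  destruct (Hf n k Hn) as [[M HM] C]. destruct (cok_adz N f Hf n k Hn) as [[M1 HM1] _].
  assert (HM10 : 0 <= M1) by (eapply Rle_trans; [apply Rabs_pos|apply (HM1 0 ltac:(lra) 0)]).
  split.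
  - exists M. intros e He x. apply cnv_le; [exact Hk| |intros; apply HM, He].
    apply (reg_continuous N); [apply Hr, He|exact Hn].
  - intros d Hd. destruct (C (d / 2)) as [e1 [He1 H1]]; [lra|].
    assert (Hp : 0 < d / (2 * (M1 * A + 1)))
      by (apply Rdiv_lt_0_compat; [lra|]; assert (0 <= M1 * A) by nra; lra).
    destruct (Hmu _ Hp) as [e2 [He2 H2]].
    exists (Rmin e1 e2). split.
    + split; [apply Rmin_glb_lt; lra|]. eapply Rle_trans; [apply Rmin_l|lra].
    + intros e He x. pose proof (Rmin_l e1 e2); pose proof (Rmin_r e1 e2).
      specialize (H2 e ltac:(lra) 0). simpl in H2. rewrite Hmu0, Rminus_0_r in H2.
      assert (R0 : reg N (f 0)) by (apply Hr; lra).
      unfold aconv. rewrite Hmu0, (cnv_0 _ _ _ _ Hk).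
      (* The limit value is written as the average of a constant, so that two averages with the same
         kernel are compared; [f 0] being Lipschitz, the displacement [mu e * z] costs at most
         [M1 * A * mu e]. *)
      rewrite <- (cnv_const phi A (mu e) (f 0 x n k) x Hk).
      apply cnv_minus_le; [exact Hk| |intros; apply continuous_const|].
      { apply (reg_continuous N); [apply Hr; lra|exact Hn]. }
      intros z Hz.
      replace (f e (x - mu e * z) n k - f 0 x n k) with
        ((f e (x - mu e * z) n k - f 0 (x - mu e * z) n k)
         + (f 0 (x - mu e * z) n k - f 0 x n k)) by ring.
      eapply Rle_trans; [apply Rabs_triang|].
      specialize (H1 e ltac:(lra) (x - mu e * z)).
      assert (L : Rabs (f 0 (x - mu e * z) n k - f 0 x n k)
                  <= M1 * Rabs (x - mu e * z - x)).
      { apply (mvt_lipschitz (fun y => f 0 y n k) (fun y => adz (f 0 y) n k)).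
        intros y _. split; [apply (R0 n k Hn)|apply HM1; lra]. }
      replace (x - mu e * z - x) with (- (mu e * z)) in L by ring.
      rewrite Rabs_Ropp, Rabs_mult in L.
      assert (Rabs z <= A) by (apply Rabs_le; lra).
      assert (Rabs (mu e) * Rabs z <= d / (2 * (M1 * A + 1)) * A)
        by (apply Rmult_le_compat; try apply Rabs_pos; assumption).
      assert (E : (M1 * A + 1) * (d / (2 * (M1 * A + 1))) = d / 2)
        by (field; assert (0 <= M1 * A) by nra; lra).
      nra.
Qed.

(** * The regularized system on power series *)

(** [invH j] and, below, [lnH j] are the [j]-th derivatives of [1 / y] and [ln y] divided by [j!],
    the form that [acomp] expects. *)
Definition invH (j : nat) (y : R) : R := (-1) ^ j * (/ y) ^ S j.

Definition lnH (j : nat) (y : R) : R :=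
  match j with O => ln y | S i => (-1) ^ i / INR (S i) * (/ y) ^ S i end.

Lemma invH_derive (j : nat) (y : R) :
  0 < y -> is_derive (invH j) y (INR (S j) * invH (S j) y).
Proof.
  intros Hy. unfold invH. evar_last.
  - apply (is_derive_scal (fun y => (/ y) ^ S j)). apply is_derive_pow.
    apply (is_derive_inv (fun y => y) y 1); [apply (is_derive_id (K := R_AbsRing) y)|lra].
  - change (Init.Nat.pred (S j)) with j.
    rewrite <- !(tech_pow_Rmult (/ y)), <- (tech_pow_Rmult (-1)). field. lra.
Qed.

Lemma lnH_derive (j : nat) (y : R) :
  0 < y -> is_derive (lnH j) y (INR (S j) * lnH (S j) y).
Proof.
  intros Hy. destruct j as [|i].
  - evar_last; [apply (is_derive_ln y Hy)|]. simpl. field. lra.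
  - unfold lnH. evar_last.
    + apply (is_derive_scal (fun y => (/ y) ^ S i)). apply is_derive_pow.
      apply (is_derive_inv (fun y => y) y 1); [apply (is_derive_id (K := R_AbsRing) y)|lra].
    + change (Init.Nat.pred (S i)) with i.
      rewrite <- !(tech_pow_Rmult (/ y)), <- (tech_pow_Rmult (-1)). field.
      repeat split; lra || (apply not_0_INR; lia).
Qed.

Lemma invH_bound (b y : R) (j : nat) :
  0 < b -> / b <= y -> Rabs (invH j y) <= b * b ^ j.
Proof.
  intros Hb Hy. unfold invH. rewrite Rabs_mult, pow_1_abs, Rmult_1_l.
  pose proof (Rinv_0_lt_compat b Hb).
  rewrite Rabs_pos_eq by (apply pow_le; left; apply Rinv_0_lt_compat; lra).
  change (b * b ^ j) with (b ^ S j). apply pow_incr. split.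
  - left; apply Rinv_0_lt_compat; lra.
  - rewrite <- (Rinv_inv b). apply Rinv_le_contravar; lra.
Qed.

Lemma lnH_bound (b B y : R) (j : nat) :
  1 <= b -> 1 <= B -> / b <= y <= B -> Rabs (lnH j y) <= (b + B) * (b + B) ^ j.
Proof.
  intros Hb HB Hy. pose proof (Rinv_0_lt_compat b ltac:(lra)) as Hib.
  assert (L : forall z, 0 < z -> ln z <= z).
  { intros z Hz. rewrite <- (ln_exp z) at 2. apply ln_le; [exact Hz|].
    left. eapply Rlt_trans; [|apply exp_ineq1; lra]. lra. }
  destruct j as [|i].
  - simpl. rewrite Rmult_1_r. apply Rabs_le. split.
    + pose proof (L (/ y) ltac:(apply Rinv_0_lt_compat; lra)) as H.
      rewrite ln_Rinv in H by lra.
      assert (/ y <= b) by (rewrite <- (Rinv_inv b); apply Rinv_le_contravar; lra). lra.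
    + pose proof (L y ltac:(lra)). lra.
  - unfold lnH, Rdiv. rewrite !Rabs_mult, pow_1_abs, Rmult_1_l.
    pose proof (INR_S_ge1 i) as H1.
    rewrite Rabs_inv, (Rabs_pos_eq (INR (S i))) by apply pos_INR.
    assert (Hy0 : 0 < / y) by (apply Rinv_0_lt_compat; lra).
    rewrite Rabs_pos_eq by (apply pow_le; lra).
    apply Rmult_le_compat.
    + left; apply Rinv_0_lt_compat; lra.
    + apply pow_le; lra.
    + apply Rle_trans with (/ 1); [apply Rinv_le_contravar; lra|lra].
    + apply pow_incr. split; [lra|].
      assert (/ y <= b) by (rewrite <- (Rinv_inv b); apply Rinv_le_contravar; lra). lra.
Qed.

(** [e^p], with the value [0] at [e = 0] (whereas [Rpower 0 p = 1]). *)
Definition pw (e p : R) : R := if Req_EM_T e 0 then 0 else Rpower e p.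

Lemma pw_0 (p : R) : pw 0 p = 0.
Proof. unfold pw. destruct (Req_EM_T 0 0); congruence. Qed.

Lemma pw_pos (e p : R) : 0 < e -> pw e p = Rpower e p.
Proof. intros H. unfold pw. destruct (Req_EM_T e 0); [lra|reflexivity]. Qed.

Lemma pw_bound (e p : R) : 0 <= e < 1 -> 0 < p -> 0 <= pw e p <= 1.
Proof.
  intros He Hp. unfold pw. destruct (Req_EM_T e 0); [lra|].
  split; [left; apply exp_pos|]. rewrite <- exp_0.
  unfold Rpower. left. apply exp_increasing.
  assert (ln e < 0) by (rewrite <- ln_1; apply ln_increasing; lra). nra.
Qed.

Lemma pw_ucv (p : R) : 0 < p -> ucv (fun e _ => pw e p).
Proof.
  intros Hp d Hd. pose proof (exp_pos (ln d / p)) as Hx.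
  exists (Rmin 1 (exp (ln d / p))). split.
  - split; [apply Rmin_glb_lt; lra|apply Rmin_l].
  - intros e He _. rewrite pw_0, Rminus_0_r, pw_pos by lra.
    unfold Rpower. rewrite Rabs_pos_eq by (left; apply exp_pos).
    rewrite <- (exp_ln d Hd). left. apply exp_increasing.
    assert (H : ln e < ln d / p).
    { rewrite <- (ln_exp (ln d / p)). apply ln_increasing; [lra|].
      eapply Rlt_le_trans; [apply He|apply Rmin_r]. }
    apply Rmult_lt_compat_l with (r := p) in H; [|exact Hp].
    replace (p * (ln d / p)) with (ln d) in H by (field; lra). exact H.
Qed.

Lemma pw_ucb (p : R) : 0 < p -> ucb (fun e _ => pw e p).
Proof.
  intros Hp. split; [|apply pw_ucv, Hp]. exists 1. intros e He _.
  pose proof (pw_bound e p He Hp). rewrite Rabs_pos_eq; lra.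
Qed.

(** [pc] controls the size of the data and [pd] the Taylor coefficients of the
    data and of [v], [1/y], [ln] on the range of the solution. *)
Record setup := {
  pK : R; pal : R; pbe : R; pN : R;
  pv : R -> R; pphi : R -> R; pr : R -> R; pm : R -> R;
  pA : R; pc : R; pd : R;
  h_K : 0 <= pK;
  h_al : 0 < pal;
  h_be : 0 < pbe;
  h_N : 0 < pN;
  h_v : analytic pv;
  h_ker : kernel pphi pA;
  h_r : analytic pr;
  h_rp : periodic pr;
  h_m : analytic pm;
  h_mp : periodic pm;
  h_c : 1 <= pc;
  h_cd : 2 * pc <= pd;
  h_cd2 : pc ^ 2 <= pd;
  h_rge : forall x, / pc <= pr x;
  h_rle : forall x, pr x <= pc;
  h_mle : forall x, Rabs (pm x) <= pc;
  h_tr : forall x k, Rabs (tay pr k x) <= pd ^ S k;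
  h_tm : forall x k, Rabs (tay pm k x) <= pd ^ S k;
  h_tv : forall y j, Rabs y <= pc ^ 2 + 1 -> Rabs (tay pv j y) <= pd * pd ^ j;
  h_tinv : forall y j, / (2 * pc) <= y -> Rabs (invH j y) <= pd * pd ^ j;
  h_tln : forall y j, / (2 * pc) <= y <= pc + 2 -> Rabs (lnH j y) <= pd * pd ^ j
}.

Definition fq (rho : fld) : fld := fun x => acomp invH (rho x).
Definition fu (rho m : fld) : fld := fun x => amul (m x) (fq rho x).
Definition fv (v : R -> R) (rho m : fld) : fld := fun x => acomp (tay v) (fu rho m x).
Definition fup (v : R -> R) (rho m : fld) : fld :=
  fun x n k => / 2 * (fv v rho m x n k + fu rho m x n k).
Definition fum (v : R -> R) (rho m : fld) : fld :=
  fun x n k => / 2 * (fv v rho m x n k + (-1) * fu rho m x n k).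
(** Since [v(u) = u^+ + u^-], the three-point bracket splits into a backward quotient of [f u^+] and
    a forward quotient of [f u^-]. At [e = 0] it becomes minus the derivative of [f u], because
    [u^+ - u^- = u]. *)
Definition ftr (v : R -> R) (e : R) (f rho m : fld) : fld := fun x n k =>
  (-1) * dquo (-1 * e) (fun y => amul (f y) (fup v rho m y)) x n k
  + dquo (1 * e) (fun y => amul (f y) (fum v rho m y)) x n k.
Definition fL (b : R) (rho : fld) : fld := fun x =>
  acomp lnH (fun n k => rho x n k + b * aone n k).

Definition Frho (U : setup) (e : R) (rho m : fld) : fld := fun x n k =>
  ftr (pv U) e rho rho m x n k + pw e (pbe U) * aone n k.
(** The transported quantity is [m] itself, equal to [rho * u] where the density does not vanish.
    The derivative of the potential is the formal one, taken after averaging. *)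
Definition Fm (U : setup) (e : R) (rho m : fld) : fld := fun x n k =>
  ftr (pv U) e m rho m x n k
  + (- pK U) * amul (rho x)
      (adz (aconv (pphi U) (pA U) (pw e (pal U)) (fL (pw e (pN U)) rho) x)) n k.

Definition upd (N : nat) (f F : fld) : fld := fun x n k =>
  if Nat.eq_dec n (S N) then F x N k / INR (S N) else f x n k.

Definition init (f : R -> R) : fld := fun x n k =>
  match n with O => tay f k x | _ => 0 end.

Fixpoint iter (U : setup) (e : R) (N : nat) : fld * fld :=
  match N with
  | O => (init (pr U), init (pm U))
  | S N' =>
      let (rho, m) := iter U e N' in
      (upd N' rho (Frho U e rho m), upd N' m (Fm U e rho m))
  end.

(** Degree [n] is final after [n] iterations because [Frho] and [Fm] are causal. *)
Definition arho (U : setup) (e : R) : fld := fun x n k => fst (iter U e n) x n k.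
Definition am (U : setup) (e : R) : fld := fun x n k => snd (iter U e n) x n k.

(** Equality up to time degree [N], the relation that expresses causality: each operation below
    sends arguments that agree to degree [N] to results that agree to degree [N]. *)
Definition agree (N : nat) (f g : fld) : Prop :=
  forall x n k, (n <= N)%nat -> f x n k = g x n k.

Lemma iter_agree (U : setup) (e : R) (N : nat) :
  agree N (arho U e) (fst (iter U e N)) /\ agree N (am U e) (snd (iter U e N)).
Proof.
  assert (H : forall N n, (n <= N)%nat -> forall x k,
    fst (iter U e n) x n k = fst (iter U e N) x n k /\
    snd (iter U e n) x n k = snd (iter U e N) x n k).
  { clear N. induction N as [|N IH]; intros n Hn x k.
    - replace n with O by lia. split; reflexivity.
    - destruct (Nat.eq_dec n (S N)) as [->|E]; [split; reflexivity|].
      destruct (IH n ltac:(lia) x k) as [E1 E2]. rewrite E1, E2.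
      simpl. destruct (iter U e N) as [rho m]. simpl. unfold upd.
      destruct (Nat.eq_dec n (S N)); [lia|]. split; reflexivity. }
  split; intros x n k Hn; apply (H N n Hn x k).
Qed.

Lemma agree_mul (N : nat) (f f' g g' : fld) :
  agree N f f' -> agree N g g' ->
  agree N (fun x => amul (f x) (g x)) (fun x => amul (f' x) (g' x)).
Proof.
  intros Hf Hg x n k Hn. apply amul_ext; intros; [apply Hf|apply Hg]; lia.
Qed.

Lemma agree_comp (N : nat) (H : nat -> R -> R) (f f' : fld) :
  agree N f f' -> agree N (fun x => acomp H (f x)) (fun x => acomp H (f' x)).
Proof.
  intros Hf x n k Hn. apply (acomp_ext H _ _ N); [|exact Hn].
  intros i l Hi. apply Hf, Hi.
Qed.

Lemma agree_dquo (N : nat) (h : R) (f f' : fld) :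
  agree N f f' -> agree N (dquo h f) (dquo h f').
Proof.
  intros Hf x n k Hn. unfold dquo. destruct (Req_EM_T h 0).
  - unfold adz. rewrite Hf by exact Hn. reflexivity.
  - rewrite !Hf by exact Hn. reflexivity.
Qed.

Lemma agree_fu (N : nat) (rho rho' m m' : fld) :
  agree N rho rho' -> agree N m m' -> agree N (fu rho m) (fu rho' m').
Proof.
  intros H1 H2. apply (agree_mul N m m' (fq rho) (fq rho') H2).
  apply (agree_comp N invH rho rho'), H1.
Qed.

Lemma agree_fv (N : nat) (v : R -> R) (rho rho' m m' : fld) :
  agree N rho rho' -> agree N m m' -> agree N (fv v rho m) (fv v rho' m').
Proof.
  intros H1 H2. apply (agree_comp N (tay v) (fu rho m) (fu rho' m')).
  apply agree_fu; assumption.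
Qed.

Lemma agree_ftr (N : nat) (v : R -> R) (e : R) (f f' rho rho' m m' : fld) :
  agree N f f' -> agree N rho rho' -> agree N m m' ->
  agree N (ftr v e f rho m) (ftr v e f' rho' m').
Proof.
  intros Hf H1 H2 x n k Hn. unfold ftr.
  assert (Hu := agree_fu N _ _ _ _ H1 H2). assert (Hv := agree_fv N v _ _ _ _ H1 H2).
  assert (Hup : agree N (fup v rho m) (fup v rho' m'))
    by (intros y i l Hi; unfold fup; rewrite Hu, Hv by exact Hi; reflexivity).
  assert (Hum : agree N (fum v rho m) (fum v rho' m'))
    by (intros y i l Hi; unfold fum; rewrite Hu, Hv by exact Hi; reflexivity).
  f_equal; [f_equal|]; apply (agree_dquo N); try exact Hn; apply agree_mul; assumption.
Qed.

Lemma agree_Frho (U : setup) (e : R) (N : nat) (rho rho' m m' : fld) :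
  agree N rho rho' -> agree N m m' -> agree N (Frho U e rho m) (Frho U e rho' m').
Proof.
  intros H1 H2 x n k Hn. unfold Frho.
  rewrite (agree_ftr N _ _ rho rho' rho rho' m m') by assumption. reflexivity.
Qed.

Lemma agree_Fm (U : setup) (e : R) (N : nat) (rho rho' m m' : fld) :
  agree N rho rho' -> agree N m m' -> agree N (Fm U e rho m) (Fm U e rho' m').
Proof.
  intros H1 H2 x n k Hn. unfold Fm.
  rewrite (agree_ftr N _ _ m m' rho rho' m m') by assumption. f_equal. f_equal.
  apply amul_ext; intros i l Hi Hl; [apply H1; lia|].
  unfold adz. f_equal. apply cnv_ext. intros y.
  apply (acomp_ext lnH _ _ N); [|lia]. intros. rewrite H1 by assumption. reflexivity.
Qed.

Lemma arho_0 (U : setup) (e x : R) (k : nat) : arho U e x 0%nat k = tay (pr U) k x.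
Proof. reflexivity. Qed.

Lemma am_0 (U : setup) (e x : R) (k : nat) : am U e x 0%nat k = tay (pm U) k x.
Proof. reflexivity. Qed.

Lemma arho_succ (U : setup) (e x : R) (n k : nat) :
  INR (S n) * arho U e x (S n) k = Frho U e (arho U e) (am U e) x n k.
Proof.
  destruct (iter_agree U e n) as [H1 H2].
  rewrite (agree_Frho U e n _ _ _ _ H1 H2) by lia.
  unfold arho. simpl iter. destruct (iter U e n) as [rho m]. simpl fst. simpl snd. unfold upd.
  destruct (Nat.eq_dec _ _); [|lia]. field. apply not_0_INR; lia.
Qed.

Lemma am_succ (U : setup) (e x : R) (n k : nat) :
  INR (S n) * am U e x (S n) k = Fm U e (arho U e) (am U e) x n k.
Proof.
  destruct (iter_agree U e n) as [H1 H2].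
  rewrite (agree_Fm U e n _ _ _ _ H1 H2) by lia.
  unfold am. simpl iter. destruct (iter U e n) as [rho m]. simpl fst. simpl snd. unfold upd.
  destruct (Nat.eq_dec _ _); [|lia]. field. apply not_0_INR; lia.
Qed.

(** * Regularity and bounds of the coefficients *)

Lemma pc_pos (U : setup) : 0 < / pc U <= 1.
Proof.
  pose proof (h_c U). split; [apply Rinv_0_lt_compat; lra|].
  rewrite <- Rinv_1. apply Rinv_le_contravar; lra.
Qed.

Lemma pr_pos (U : setup) (x : R) : 0 < pr U x.
Proof. pose proof (pc_pos U); pose proof (h_rge U x); lra. Qed.

Lemma invH_0 (y : R) : invH 0 y = / y.
Proof. unfold invH; simpl; ring. Qed.

Lemma reg_F (U : setup) (e : R) (N : nat) (rho m : fld) :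
  0 <= e < 1 -> (forall x, rho x O O = pr U x) -> reg N rho -> reg N m ->
  reg N (fu rho m) /\ reg N (fv (pv U) rho m) /\ reg N (fup (pv U) rho m) /\
  reg N (fum (pv U) rho m) /\ reg N (fL (pw e (pN U)) rho) /\
  reg N (Frho U e rho m) /\ reg N (Fm U e rho m).
Proof.
  intros He H0 Hr Hm.
  pose proof (pw_bound e (pN U) He (h_N U)) as Hw.
  assert (Rq : reg N (fq rho)).
  { apply reg_comp; [exact Hr|]. intros j x. rewrite H0. apply invH_derive, pr_pos. }
  assert (Ru : reg N (fu rho m)) by (apply reg_mul; assumption).
  assert (Rv : reg N (fv (pv U) rho m)).
  { apply reg_comp; [exact Ru|]. intros j x. apply tay_derive, h_v. }
  assert (Rup : reg N (fup (pv U) rho m))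
    by (apply (reg_scal N (/2) (fun x n k => fv (pv U) rho m x n k + fu rho m x n k)), reg_plus; assumption).
  assert (Rum : reg N (fum (pv U) rho m)).
  { apply (reg_scal N (/2) (fun x n k => fv (pv U) rho m x n k + (-1) * fu rho m x n k)), reg_plus;
      [assumption|apply reg_scal; assumption]. }
  assert (RL : reg N (fL (pw e (pN U)) rho)).
  { apply (reg_comp N lnH (fun x n k => rho x n k + pw e (pN U) * aone n k)).
    - apply reg_plus; [assumption|apply reg_const].
    - intros j x. apply lnH_derive. rewrite H0. simpl. pose proof (pr_pos U x). lra. }
  assert (Rtr : forall f, reg N f -> reg N (ftr (pv U) e f rho m)).
  { intros f Hf. apply (reg_plus N
      (fun x n k => -1 * dquo (-1 * e) (fun y => amul (f y) (fup (pv U) rho m y)) x n k)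
      (dquo (1 * e) (fun y => amul (f y) (fum (pv U) rho m y)))).
    - apply reg_scal, reg_dquo, reg_mul; assumption.
    - apply reg_dquo, reg_mul; assumption. }
  do 5 (split; [assumption|]). split.
  - apply (reg_plus N (ftr (pv U) e rho rho m)); [apply Rtr, Hr|apply reg_const].
  - apply (reg_plus N (ftr (pv U) e m rho m)); [apply Rtr, Hm|].
    apply (reg_scal N (- pK U) (fun x => amul (rho x)
      (adz (aconv (pphi U) (pA U) (pw e (pal U)) (fL (pw e (pN U)) rho) x)))).
    apply (reg_mul N rho (fun x => adz (aconv (pphi U) (pA U) (pw e (pal U)) (fL (pw e (pN U)) rho) x)));
      [exact Hr|].
    apply reg_adz, reg_aconv; [apply h_ker|exact RL].
Qed.

Lemma reg_step (f F : fld) (N : nat) :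
  (forall x n k, INR (S n) * f x (S n) k = F x n k) -> reg N f -> reg N F -> reg (S N) f.
Proof.
  intros E Hf HF n k Hn. destruct (Nat.eq_dec n (S N)) as [->|Hne]; [|apply Hf; lia].
  destruct (HF N k (le_n _)) as [F1 F2].
  assert (E' : forall x l, f x (S N) l = / INR (S N) * F x N l).
  { intros x l. rewrite <- E. field. apply not_0_INR; lia. }
  split.
  - intros x. apply is_derive_ext with (fun y => / INR (S N) * F y N k);
      [intros; symmetry; apply E'|].
    unfold adz. rewrite E'. evar_last; [apply (is_derive_scal (fun y => F y N k)), F1|].
    unfold adz. ring.
  - intros x. rewrite !E'. f_equal. apply F2.
Qed.

Lemma reg_init (f : fld) (f0 : R -> R) :
  analytic f0 -> periodic f0 -> (forall x k, f x O k = tay f0 k x) -> reg 0 f.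
Proof.
  intros Ha Hp E n k Hn. replace n with O by lia. split.
  - intros x. apply is_derive_ext with (tay f0 k); [intros; symmetry; apply E|].
    unfold adz. rewrite E. apply tay_derive, Ha.
  - intros x. rewrite !E. apply tay_periodic, Hp.
Qed.

Lemma arho_00 (U : setup) (e x : R) : arho U e x O O = pr U x.
Proof. rewrite arho_0. apply tay_0. Qed.

Lemma am_00 (U : setup) (e x : R) : am U e x O O = pm U x.
Proof. rewrite am_0. apply tay_0. Qed.

Lemma reg_sol (U : setup) (e : R) (N : nat) :
  0 <= e < 1 -> reg N (arho U e) /\ reg N (am U e).
Proof.
  intros He; induction N as [|N [IH1 IH2]].
  - split; [apply reg_init with (pr U)|apply reg_init with (pm U)];
      try apply h_r; try apply h_rp; try apply h_m; try apply h_mp; reflexivity.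
  - destruct (reg_F U e N _ _ He (arho_00 U e) IH1 IH2) as (_ & _ & _ & _ & _ & R1 & R2).
    split.
    + apply reg_step with (Frho U e (arho U e) (am U e)); [apply arho_succ|assumption..].
    + apply reg_step with (Fm U e (arho U e) (am U e)); [apply am_succ|assumption..].
Qed.

(** [eta] is small enough for the compositions to converge, [sigma] then large
    enough for the initial data to lie in [ball], and [tau] large enough for
    time integration to preserve [ball]. *)
Definition eta (U : setup) : R := / (4000 * pd U ^ 4).
(** Oscillations of [1 / rho] and of [u] when those of [rho] and [m] are at most [eta]. The first is
    [bd_acut_acomp] with [C = r = pd]; the second covers the three terms of [bd_acut_amul], whence
    [257 = 128 + 1 + 128]. *)
Definition etaq (U : setup) : R := 128 * pd U * pd U * eta U.
Definition etau (U : setup) : R := 257 * pd U ^ 3 * eta U.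
Definition sigma (U : setup) : R := 256 * pd U ^ 2 / eta U.
Definition bigM (U : setup) : R := 200 * pd U ^ 2.
(** The summands bound the two difference quotients of the transport term, the pressure term, and
    the source [e^beta] through the 64 of [bd_aone]. One value serves both equations. *)
Definition bigQ (U : setup) : R :=
  2 * (sigma U * (bigM U * bigM U)) + pK U * (bigM U * (sigma U * bigM U)) + 64.
(** The 4 is the loss in [wt_succ_l]. With this value [4 * bigQ / tau] equals [eta], which closes
    the induction on the degree in [t]. *)
Definition tau (U : setup) : R := 4 * bigQ U / eta U.

Lemma pd_ge (U : setup) : 2 <= pd U.
Proof. pose proof (h_c U); pose proof (h_cd U); lra. Qed.

Lemma eta_facts (U : setup) :
  0 < eta U /\ eta U * pd U <= / 4000 /\ eta U <= / 4000 /\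
  0 < etaq U /\ 0 < etau U /\ pd U * etau U <= / 8 /\
  pd U * etaq U + pd U * eta U + eta U * etaq U <= etau U.
Proof.
  pose proof (pd_ge U) as Hd. unfold etaq, etau, eta. set (d := pd U) in *.
  assert (H4 : 0 < 4000 * d ^ 4) by (apply Rmult_lt_0_compat; [lra|apply pow_lt; lra]).
  set (h := / (4000 * d ^ 4)) in *.
  assert (Hh : 0 < h) by (apply Rinv_0_lt_compat, H4).
  assert (E : h * d ^ 4 = / 4000) by (unfold h; field; lra).
  assert (P3 : 0 < d ^ 3) by (apply pow_lt; lra).
  assert (D2 : d <= d ^ 2) by nra.
  assert (D32 : d ^ 2 <= d ^ 3) by (change (d ^ 3) with (d * d ^ 2); nra).
  assert (D3 : d <= d ^ 3) by lra.
  assert (D4 : d ^ 3 <= d ^ 4) by (change (d ^ 4) with (d * d ^ 3); nra).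
  assert (B1 : h * d <= h * d ^ 4) by (apply Rmult_le_compat_l; lra).
  assert (B2 : h <= h * d) by nra.
  repeat split; try lra.
  - repeat apply Rmult_lt_0_compat; lra.
  - repeat apply Rmult_lt_0_compat; lra.
  - replace (d * (128 * d * d * h) + d * h + h * (128 * d * d * h))
      with (h * (128 * d ^ 3 + d + 128 * d ^ 2 * h)) by ring.
    replace (257 * d ^ 3 * h) with (h * (257 * d ^ 3)) by ring.
    apply Rmult_le_compat_l; [lra|].
    assert (128 * d ^ 2 * h <= 128 * d ^ 2 * 1) by (apply Rmult_le_compat_l; lra). lra.
Qed.

Lemma sigma_pos (U : setup) : 0 < sigma U.
Proof.
  destruct (eta_facts U) as [H _]. pose proof (pd_ge U). unfold sigma.
  apply Rdiv_lt_0_compat; [|exact H]. apply Rmult_lt_0_compat; [lra|apply pow_lt; lra].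
Qed.

Lemma bigM_ge (U : setup) : 1 <= bigM U.
Proof.
  pose proof (pd_ge U). pose proof (pow_R1_Rle (pd U) 2 ltac:(lra)). unfold bigM. lra.
Qed.

Lemma bigQ_ge (U : setup) : 64 <= bigQ U.
Proof.
  pose proof (sigma_pos U); pose proof (bigM_ge U); pose proof (h_K U). unfold bigQ.
  assert (0 <= sigma U * (bigM U * bigM U)) by (apply Rmult_le_pos; [|apply Rmult_le_pos]; lra).
  assert (0 <= pK U * (bigM U * (sigma U * bigM U)))
    by (apply Rmult_le_pos; [|apply Rmult_le_pos; [|apply Rmult_le_pos]]; lra).
  lra.
Qed.

Lemma tau_pos (U : setup) : 0 < tau U.
Proof.
  destruct (eta_facts U) as [H _]. pose proof (bigQ_ge U). unfold tau.
  apply Rdiv_lt_0_compat; lra.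
Qed.

(** The constant terms are pinned to the data, so that the Taylor families of [1 / y], [ln] and [v]
    are evaluated where the setup controls them. Smallness is asked of the other coefficients
    only. *)
Definition ball (U : setup) (N : nat) (rho m : fld) : Prop := forall x,
  rho x O O = pr U x /\ m x O O = pm U x /\
  bd (tau U) (sigma U) N (eta U) (acut (rho x)) /\
  bd (tau U) (sigma U) N (eta U) (acut (m x)).

Lemma fq_00 (U : setup) (N : nat) (rho m : fld) (x : R) :
  ball U N rho m -> fq rho x O O = / pr U x /\ fu rho m x O O = pm U x / pr U x.
Proof.
  intros H. destruct (H x) as (E1 & E2 & _).
  assert (E : fq rho x O O = / pr U x)
    by (unfold fq; rewrite acomp_00, E1, invH_0; reflexivity).
  split; [exact E|]. unfold fu. rewrite amul_00, E, E2. reflexivity.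
Qed.

Lemma inv_pr_bound (U : setup) (x : R) : 0 < / pr U x <= pc U.
Proof.
  pose proof (pr_pos U x). pose proof (h_rge U x). pose proof (pc_pos U).
  split; [apply Rinv_0_lt_compat; assumption|].
  rewrite <- (Rinv_inv (pc U)). apply Rinv_le_contravar; lra.
Qed.

Lemma u00_bound (U : setup) (x : R) : Rabs (pm U x / pr U x) <= pc U ^ 2.
Proof.
  unfold Rdiv. rewrite Rabs_mult. pose proof (inv_pr_bound U x).
  rewrite (Rabs_pos_eq (/ pr U x)) by lra. simpl. rewrite Rmult_1_r.
  apply Rmult_le_compat; try apply Rabs_pos; try lra. apply h_mle.
Qed.

Lemma half_pc (U : setup) (x : R) : / (2 * pc U) <= pr U x.
Proof.
  pose proof (h_rge U x). pose proof (pc_pos U). pose proof (h_c U).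
  rewrite Rinv_mult. lra.
Qed.

Lemma bd_comp_total (U : setup) (N : nat) (zeta : R) (H : nat -> R -> R) (f : arr) :
  0 <= zeta -> pd U * zeta <= / 2 ->
  (forall j, Rabs (H j (f O O)) <= pd U * pd U ^ j) ->
  bd (tau U) (sigma U) N zeta (acut f) ->
  bd (tau U) (sigma U) N (bigM U) (acomp H f).
Proof.
  intros Hz0 Hz HH Hf.
  pose proof (tau_pos U) as Ht; pose proof (sigma_pos U) as Hs; pose proof (pd_ge U) as Hd.
  apply bd_le with (64 * Rabs (acomp H f O O) + 128 * pd U * pd U * zeta); try assumption.
  - rewrite acomp_00. specialize (HH O). simpl in HH. rewrite Rmult_1_r in HH.
    assert (128 * pd U * pd U * zeta <= 64 * pd U).
    { replace (128 * pd U * pd U * zeta) with (128 * pd U * (pd U * zeta)) by ring. nra. }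
    unfold bigM. nra.
  - apply bd_acut; try assumption.
    + repeat apply Rmult_le_pos; lra.
    + apply bd_acut_acomp; try assumption; lra.
Qed.

Lemma ball_bounds (U : setup) (e : R) (N : nat) (rho m : fld) :
  0 <= e < 1 -> ball U N rho m -> forall x,
  bd (tau U) (sigma U) N (etau U) (acut (fu rho m x)) /\
  bd (tau U) (sigma U) N (bigM U) (rho x) /\
  bd (tau U) (sigma U) N (bigM U) (m x) /\
  bd (tau U) (sigma U) N (bigM U) (fq rho x) /\
  bd (tau U) (sigma U) N (bigM U) (fu rho m x) /\
  bd (tau U) (sigma U) N (bigM U) (fv (pv U) rho m x) /\
  bd (tau U) (sigma U) N (bigM U) (fup (pv U) rho m x) /\
  bd (tau U) (sigma U) N (bigM U) (fum (pv U) rho m x) /\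
  bd (tau U) (sigma U) N (bigM U) (fL (pw e (pN U)) rho x).
Proof.
  intros He HB x. destruct (HB x) as (E1 & E2 & B1 & B2).
  destruct (fq_00 U N rho m x HB) as [E3 E4].
  pose proof (tau_pos U) as Ht; pose proof (sigma_pos U) as Hs; pose proof (pd_ge U) as Hd.
  destruct (eta_facts U) as (P1 & P2 & P3 & P4 & P5 & P6 & P7).
  pose proof (bigM_ge U) as HM.
  pose proof (inv_pr_bound U x) as Hi. pose proof (u00_bound U x) as Hu0.
  pose proof (h_cd U) as Hcd. pose proof (h_c U) as Hc. pose proof (h_cd2 U) as Hcd2.
  assert (HQ : forall j, Rabs (invH j (rho x O O)) <= pd U * pd U ^ j).
  { intros j. rewrite E1. apply h_tinv, half_pc. }
  assert (Cq : bd (tau U) (sigma U) N (etaq U) (acut (fq rho x))).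
  { apply bd_acut_acomp; try assumption; lra. }
  assert (Cu : bd (tau U) (sigma U) N (etau U) (acut (fu rho m x))).
  { eapply bd_le; [exact Ht|exact Hs|exact P7|].
    apply bd_acut_amul; try assumption; try lra.
    - rewrite E2. pose proof (h_mle U x). lra.
    - rewrite E3, Rabs_pos_eq; lra. }
  assert (Cv : bd (tau U) (sigma U) N (bigM U) (fv (pv U) rho m x)).
  { apply (bd_comp_total U N (etau U)); try lra; [|exact Cu].
    intros j. rewrite E4. apply h_tv. lra. }
  assert (Bu : bd (tau U) (sigma U) N (bigM U) (fu rho m x)).
  { apply bd_le with (64 * Rabs (fu rho m x O O) + etau U); try assumption.
    - rewrite E4. assert (etau U <= 1) by nra. unfold bigM. nra.
    - apply bd_acut; try assumption; lra. }
  assert (Hinit : forall f : arr, Rabs (f O O) <= pc U ->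
    bd (tau U) (sigma U) N (eta U) (acut f) -> bd (tau U) (sigma U) N (bigM U) f).
  { intros f Hf0 Hf. apply bd_le with (64 * Rabs (f O O) + eta U); try assumption.
    - unfold bigM. nra.
    - apply bd_acut; try assumption; lra. }
  assert (Hhalf : forall M (f : arr), bd (tau U) (sigma U) N (M + M) f ->
     bd (tau U) (sigma U) N M (fun n k => / 2 * f n k)).
  { intros M f Hf. replace M with (Rabs (/ 2) * (M + M)) by (rewrite Rabs_pos_eq; lra).
    apply bd_scal, Hf. }
  split; [exact Cu|]. split; [|split; [|split; [|split; [exact Bu|split; [exact Cv|split; [|split]]]]]].
  - apply Hinit; [|exact B1]. rewrite E1, Rabs_pos_eq by (pose proof (pr_pos U x); lra).
    apply h_rle.
  - apply Hinit; [|exact B2]. rewrite E2. apply h_mle.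
  - apply (bd_comp_total U N (eta U)); try lra; assumption.
  - apply (Hhalf (bigM U) (fun n k => fv (pv U) rho m x n k + fu rho m x n k)).
    apply (bd_plus _ _ _ _ _ (fv (pv U) rho m x)); assumption.
  - apply (Hhalf (bigM U) (fun n k => fv (pv U) rho m x n k + (-1) * fu rho m x n k)).
    apply (bd_plus _ _ _ _ _ (fv (pv U) rho m x) (fun n k => (-1) * fu rho m x n k)); [assumption|].
    replace (bigM U) with (Rabs (-1) * bigM U) by (rewrite Rabs_left; lra).
    apply bd_scal, Bu.
  - pose proof (pw_bound e (pN U) He (h_N U)) as Hw.
    apply (bd_comp_total U N (eta U)); try lra.
    + intros j. apply h_tln. rewrite E1. simpl. pose proof (half_pc U x). pose proof (h_rle U x). lra.
    + intros n k Hn. destruct (Nat.eq_dec (n + k) 0) as [E|E].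
      * replace n with O by lia; replace k with O by lia. simpl. rewrite Rabs_R0.
        pose proof (wt_pos (tau U) (sigma U) 0 0 Ht Hs). apply Rmult_le_pos; lra.
      * rewrite acut_neq by lia. rewrite aone_eq0, Rmult_0_r, Rplus_0_r by lia.
        rewrite <- (acut_neq (rho x)) by lia. apply B1, Hn.
Qed.

(** Each term costs at most one derivative: a difference quotient, or the [adz] of an averaged
    logarithm, costs one and the source none. Nothing in the constant depends on [e]. *)
Lemma bd1_F (U : setup) (e : R) (N : nat) (rho m : fld) :
  0 <= e < 1 -> ball U N rho m -> reg N rho -> reg N m -> forall x,
  bd1 (tau U) (sigma U) N (bigQ U) (Frho U e rho m x) /\
  bd1 (tau U) (sigma U) N (bigQ U) (Fm U e rho m x).
Proof.
  intros He HB Hr Hm.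
  pose proof (ball_bounds U e N rho m He HB) as HBB.
  assert (H00 : forall x, rho x O O = pr U x) by (intros x; apply (HB x)).
  destruct (reg_F U e N rho m He H00 Hr Hm) as (Ru & Rv & Rup & Rum & RL & _ & _).
  pose proof (tau_pos U) as Ht; pose proof (sigma_pos U) as Hs. pose proof (bigM_ge U) as HM.
  pose proof (h_K U) as HK.
  set (M2 := bigM U * bigM U).
  assert (HM2 : 0 <= M2) by (unfold M2; apply Rmult_le_pos; lra).
  assert (Btr : forall f x, reg N f -> (forall x, bd (tau U) (sigma U) N (bigM U) (f x)) ->
    bd1 (tau U) (sigma U) N (2 * (sigma U * M2)) (ftr (pv U) e f rho m x)).
  { intros f x Rf Bf. replace (2 * (sigma U * M2)) with (sigma U * M2 + sigma U * M2) by ring.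
    apply (bd1_plus _ _ _ _ _
      (fun n k => -1 * dquo (-1 * e) (fun y => amul (f y) (fup (pv U) rho m y)) x n k)
      (dquo (1 * e) (fun y => amul (f y) (fum (pv U) rho m y)) x)).
    - replace (sigma U * M2) with (Rabs (-1) * (sigma U * M2)) by (rewrite Rabs_left; lra).
      apply bd1_scal. apply bd1_dquo; try assumption; [apply reg_mul; assumption|].
      intros y. apply bd_mul; try assumption; try lra; [apply Bf|apply (HBB y)].
    - apply bd1_dquo; try assumption; [apply reg_mul; assumption|].
      intros y. apply bd_mul; try assumption; try lra; [apply Bf|apply (HBB y)]. }
  assert (BK : 0 <= pK U * (bigM U * (sigma U * bigM U)))
    by (apply Rmult_le_pos; [|apply Rmult_le_pos; [|apply Rmult_le_pos]]; lra).
  assert (Hle : forall c (f : arr), c <= bigQ U -> bd1 (tau U) (sigma U) N c f ->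
            bd1 (tau U) (sigma U) N (bigQ U) f).
  { intros c f Hc Hf n k Hn. eapply Rle_trans; [apply Hf, Hn|].
    apply Rmult_le_compat_r; [|exact Hc].
    apply Rmult_le_pos; [apply pos_INR|left; apply wt_pos; assumption]. }
  intros x. split.
  - apply Hle with (2 * (sigma U * M2) + 64); [unfold bigQ; fold M2; lra|].
    apply (bd1_plus _ _ _ _ _ (ftr (pv U) e rho rho m x)).
    + apply Btr; [exact Hr|]. intros y; apply (HBB y).
    + apply bd_bd1; try assumption; [lra|].
      apply bd_le with (Rabs (pw e (pbe U)) * 64); try assumption.
      * pose proof (pw_bound e (pbe U) He (h_be U)). rewrite Rabs_pos_eq; lra.
      * apply bd_scal, bd_aone; assumption.
  - apply Hle with (2 * (sigma U * M2) + pK U * (bigM U * (sigma U * bigM U)));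
      [unfold bigQ; fold M2; lra|].
    apply (bd1_plus _ _ _ _ _ (ftr (pv U) e m rho m x)).
    + apply Btr; [exact Hm|]. intros y; apply (HBB y).
    + replace (pK U * (bigM U * (sigma U * bigM U)))
        with (Rabs (- pK U) * (bigM U * (sigma U * bigM U)))
        by (rewrite Rabs_Ropp, Rabs_pos_eq; lra).
      apply bd1_scal. apply bd1_mul; try assumption; try lra.
      * apply Rmult_le_pos; lra.
      * apply (HBB x).
      * apply bd1_adz; try assumption; [lra|].
        apply bd_aconv; [apply h_ker|exact RL|]. intros y; apply (HBB y).
Qed.

(** Here the value of [sigma] is used. Its factor 4 compensates the decay of [cw], at worst
    [/ 8 * (/ 4) ^ k]; one factor [pd] matches the growth of the Taylor coefficients; the remaining
    [64 * pd / eta], at least one, absorbs the prefactor as soon as [k > 0]. Degree zero is excluded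
    by [acut]. *)
Lemma init_bound (U : setup) (k : nat) :
  (0 < k)%nat -> pd U ^ S k <= eta U * wt (tau U) (sigma U) 0 k.
Proof.
  intros Hk. destruct k as [|k]; [lia|].
  unfold wt. rewrite W_0l, cw_0. simpl (tau U ^ 0).
  destruct (eta_facts U) as (P1 & _ & P3 & _). pose proof (pd_ge U) as Hd.
  set (d := pd U) in *. set (h := eta U) in *.
  assert (Hcw : / 8 * (/ 4) ^ S k <= cw (S k)).
  { generalize (S k) as n. intros n. induction n as [|n IH]; [rewrite cw_0; simpl; lra|].
    pose proof (cw_ratio n). simpl. lra. }
  assert (Es : sigma U = 4 * (64 * d / h * d)) by (unfold sigma; fold d h; field; lra).
  assert (Hx : 1 <= 64 * d / h).
  { apply Rmult_le_reg_r with h; [exact P1|].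
    replace (64 * d / h * h) with (64 * d) by (field; lra). lra. }
  assert (Hs : 0 < sigma U) by apply sigma_pos.
  apply Rle_trans with (h * (1 * / 8 * (/ 8 * (/ 4) ^ S k) * 1 * sigma U ^ S k)).
  - replace (h * (1 * / 8 * (/ 8 * (/ 4) ^ S k) * 1 * sigma U ^ S k))
      with (h * / 64 * (/ 4 * sigma U) ^ S k) by (rewrite Rpow_mult_distr; field).
    replace (/ 4 * sigma U) with (64 * d / h * d) by (rewrite Es; field; lra).
    rewrite Rpow_mult_distr.
    replace ((64 * d / h) ^ S k) with (64 * d / h * (64 * d / h) ^ k) by reflexivity.
    replace (h * / 64 * (64 * d / h * (64 * d / h) ^ k * d ^ S k))
      with ((64 * d / h) ^ k * (d * d ^ S k)) by (field; lra).
    change (d ^ S (S k)) with (d * d ^ S k).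
    pose proof (pow_R1_Rle (64 * d / h) k Hx).
    assert (0 <= d * d ^ S k) by (apply Rmult_le_pos; [|apply pow_le]; lra).
    nra.
  - apply Rmult_le_compat_l; [lra|].
    apply Rmult_le_compat_r; [apply pow_le; lra|]. lra.
Qed.

(** In time degree zero this is [init_bound]. Afterwards the coefficient of degree [N + 1] is the
    right-hand side at degree [N] divided by [N + 1]; by [wt_succ_l] that division pays for the
    derivative lost in [bd1_F] and leaves [4 * bigQ / tau], that is [eta]. *)
Lemma ball_sol (U : setup) (e : R) (N : nat) :
  0 <= e < 1 -> ball U N (arho U e) (am U e).
Proof.
  intros He.
  pose proof (tau_pos U) as Ht; pose proof (sigma_pos U) as Hs.
  destruct (eta_facts U) as (P1 & _).
  induction N as [|N IH]; intros x.
  - rewrite arho_00, am_00. split; [reflexivity|]. split; [reflexivity|].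
    assert (G : forall (f : arr) g, (forall k, f O k = g k) ->
      (forall k, Rabs (g k) <= pd U ^ S k) ->
      bd (tau U) (sigma U) 0 (eta U) (acut f)).
    { intros f g E Hg n k Hn. replace n with O by lia. destruct k as [|k].
      - simpl. rewrite Rabs_R0. apply Rmult_le_pos; [lra|left; apply wt_pos; assumption].
      - simpl. rewrite E. eapply Rle_trans; [apply Hg|]. apply init_bound; lia. }
    split.
    + apply (G _ (fun k => tay (pr U) k x)); [intros; reflexivity|intros; apply h_tr].
    + apply (G _ (fun k => tay (pm U) k x)); [intros; reflexivity|intros; apply h_tm].
  - destruct (reg_sol U e N He) as [R1 R2].
    destruct (bd1_F U e N _ _ He IH R1 R2 x) as [D1 D2].
    destruct (IH x) as (E1 & E2 & B1 & B2).
    split; [exact E1|]. split; [exact E2|].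
    assert (G : forall f F : arr, (forall n k, INR (S n) * f (S n) k = F n k) ->
      bd (tau U) (sigma U) N (eta U) (acut f) ->
      bd1 (tau U) (sigma U) N (bigQ U) F -> bd (tau U) (sigma U) (S N) (eta U) (acut f)).
    { intros f F E Hf HF n k Hn. destruct (Nat.eq_dec n (S N)) as [->|Hne]; [|apply Hf; lia].
      change (acut f (S N) k) with (f (S N) k).
      pose proof (INR_S_pos N) as HN.
      replace (f (S N) k) with (F N k / INR (S N))
        by (rewrite <- E; field; lra).
      unfold Rdiv. rewrite Rabs_mult, Rabs_inv, (Rabs_pos_eq (INR _)) by lra.
      specialize (HF N k (le_n _)).
      apply Rle_trans with (bigQ U * (INR (S (N + k)) * wt (tau U) (sigma U) N k) * / INR (S N)).
      { apply Rmult_le_compat_r; [left; apply Rinv_0_lt_compat, HN|exact HF]. }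
      pose proof (wt_succ_l (tau U) (sigma U) N k Ht Hs) as HW. unfold Rdiv in HW.
      pose proof (bigQ_ge U) as HQ.
      apply Rmult_le_compat_l with (r := bigQ U) in HW; [|lra].
      replace (eta U * wt (tau U) (sigma U) (S N) k)
        with (bigQ U * (4 * / tau U * wt (tau U) (sigma U) (S N) k)).
      { lra. }
      replace (eta U) with (4 * bigQ U / tau U)
        by (unfold tau; field; unfold tau in Ht; split; lra).
      field. lra. }
    split.
    + apply (G _ (Frho U e (arho U e) (am U e) x)); [intros; apply arho_succ|exact B1|exact D1].
    + apply (G _ (Fm U e (arho U e) (am U e) x)); [intros; apply am_succ|exact B2|exact D2].
Qed.

(** * Convergence of the coefficients as [e] tends to zero *)

Lemma tay_ucb (f : R -> R) (k : nat) (d : R) :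
  (forall x, Rabs (tay f k x) <= d) -> ucb (fun _ x => tay f k x).
Proof. intros H. apply (ucb_const (tay f k) d H). Qed.

(** The constant terms of the unknowns do not vary with [e], so that a bound is all that remains to
    be supplied. *)
Lemma ucb_center (H : nat -> R -> R) (f g : R -> R -> R) (j : nat) (d : R) :
  (forall e x, 0 <= e < 1 -> f e x = f 0 x) ->
  (forall e x, 0 <= e < 1 -> Rabs (H j (f e x)) <= d) ->
  ucb (fun e x => H j (f e x)).
Proof.
  intros E Hd. apply ucb_ext with (fun _ x => H j (f 0 x)).
  - intros e x He. rewrite (E e x He). reflexivity.
  - apply (ucb_const (fun x => H j (f 0 x)) d). intros x. apply Hd. lra.
Qed.

(** The regularisation [e^N] displaces the argument of the logarithm, so convergence does have to be
    proved: the family is Lipschitz on the range of [h_tln], and [e^N] tends to zero. *)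
Lemma ucb_ln_center (U : setup) (j : nat) :
  ucb (fun e x => lnH j (pr U x + pw e (pN U))).
Proof.
  pose proof (pd_ge U) as Hd.
  assert (HB : forall e x i, 0 <= e < 1 -> Rabs (lnH i (pr U x + pw e (pN U))) <= pd U * pd U ^ i).
  { intros e x i He. apply h_tln. pose proof (pw_bound e (pN U) He (h_N U)).
    pose proof (half_pc U x). pose proof (h_rle U x). lra. }
  split; [exists (pd U * pd U ^ j); intros; apply HB; assumption|].
  apply (ucv_bound _ (fun _ e _ => pw e (pN U))
           (INR (S j) * (pd U * pd U ^ S j))).
  - apply Rmult_le_pos; [apply pos_INR|apply Rmult_le_pos; [lra|apply pow_le; lra]].
  - exists O. intros e x He. simpl sum_f_R0.
    replace (pw e (pN U) - pw 0 (pN U)) with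
      ((pr U x + pw e (pN U)) - (pr U x + pw 0 (pN U))) by ring.
    apply (mvt_lipschitz (lnH j) (fun y => INR (S j) * lnH (S j) y)).
    intros y Hy. pose proof (pw_bound e (pN U) ltac:(lra) (h_N U)).
    rewrite pw_0 in Hy. rewrite Rmin_left, Rmax_right in Hy by lra.
    pose proof (half_pc U x). pose proof (h_rle U x).
    split; [apply lnH_derive; pose proof (pr_pos U x); lra|].
    rewrite Rabs_mult, (Rabs_pos_eq (INR _)) by apply pos_INR.
    apply Rmult_le_compat_l; [apply pos_INR|]. apply h_tln. lra.
  - intros _. apply pw_ucv, h_N.
Qed.

Lemma cok_F (U : setup) (N : nat) (rho m : R -> fld) :
  (forall e, 0 <= e < 1 -> ball U N (rho e) (m e) /\ reg N (rho e) /\ reg N (m e)) ->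
  cok N rho -> cok N m ->
  cok N (fun e => Frho U e (rho e) (m e)) /\ cok N (fun e => Fm U e (rho e) (m e)).
Proof.
  intros HB Cr Cm.
  assert (Cq : cok N (fun e => fq (rho e))).
  { apply (cok_acomp N invH rho Cr). intros j.
    apply (ucb_center invH (fun e x => rho e x O O) (fun e x => rho e x O O) j (pd U * pd U ^ j)).
    - intros e x He. destruct (HB e He) as [B _]. destruct (HB 0 ltac:(lra)) as [B0 _].
      rewrite (proj1 (B x)), (proj1 (B0 x)). reflexivity.
    - intros e x He. destruct (HB e He) as [B _]. rewrite (proj1 (B x)).
      apply h_tinv, half_pc. }
  assert (Cu : cok N (fun e => fu (rho e) (m e)))
    by (apply (cok_mul N m (fun e => fq (rho e))); assumption).
  assert (Cv : cok N (fun e => fv (pv U) (rho e) (m e))).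
  { apply (cok_acomp N (tay (pv U)) (fun e => fu (rho e) (m e)) Cu). intros j.
    apply (ucb_center (tay (pv U)) (fun e x => fu (rho e) (m e) x O O)
       (fun e x => fu (rho e) (m e) x O O) j (pd U * pd U ^ j)).
    - intros e x He. destruct (HB e He) as [B _]. destruct (HB 0 ltac:(lra)) as [B0 _].
      rewrite (proj2 (fq_00 U N _ _ x B)), (proj2 (fq_00 U N _ _ x B0)). reflexivity.
    - intros e x He. destruct (HB e He) as [B _]. rewrite (proj2 (fq_00 U N _ _ x B)).
      apply h_tv. pose proof (u00_bound U x). lra. }
  assert (Cup : cok N (fun e => fup (pv U) (rho e) (m e))).
  { apply (cok_scal N (/ 2) (fun e x n k => fv (pv U) (rho e) (m e) x n k + fu (rho e) (m e) x n k)).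
    apply (cok_plus N (fun e => fv (pv U) (rho e) (m e))); assumption. }
  assert (Cum : cok N (fun e => fum (pv U) (rho e) (m e))).
  { apply (cok_scal N (/ 2) (fun e x n k => fv (pv U) (rho e) (m e) x n k + (-1) * fu (rho e) (m e) x n k)).
    apply (cok_plus N (fun e => fv (pv U) (rho e) (m e)) (fun e x n k => (-1) * fu (rho e) (m e) x n k));
      [assumption|]. apply (cok_scal N (-1) (fun e => fu (rho e) (m e))), Cu. }
  assert (CL : cok N (fun e => fL (pw e (pN U)) (rho e))).
  { apply (cok_acomp N lnH (fun e x n k => rho e x n k + pw e (pN U) * aone n k)).
    - apply (cok_plus N rho); [assumption|].
      apply (cok_aone N (fun e _ => pw e (pN U))), pw_ucb, h_N.
    - intros j. apply ucb_ext with (fun e x => lnH j (pr U x + pw e (pN U)));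
        [|apply ucb_ln_center].
      intros e x He. destruct (HB e He) as [B _]. rewrite (proj1 (B x)). simpl. f_equal. ring. }
  assert (HR : forall e, 0 <= e < 1 -> reg N (fup (pv U) (rho e) (m e)) /\
     reg N (fum (pv U) (rho e) (m e)) /\ reg N (fL (pw e (pN U)) (rho e))).
  { intros e He. destruct (HB e He) as (B & R1 & R2).
    destruct (reg_F U e N _ _ He (fun x => proj1 (B x)) R1 R2) as (? & ? & ? & ? & ? & ? & ?). auto. }
  assert (Ctr : forall f, cok N f -> (forall e, 0 <= e < 1 -> reg N (f e)) ->
     cok N (fun e => ftr (pv U) e (f e) (rho e) (m e))).
  { intros f Cf Rf.
    apply (cok_plus N (fun e x n k =>
      -1 * dquo (-1 * e) (fun y => amul (f e y) (fup (pv U) (rho e) (m e) y)) x n k)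
      (fun e => dquo (1 * e) (fun y => amul (f e y) (fum (pv U) (rho e) (m e) y)))).
    - apply (cok_scal N (-1) (fun e => dquo (-1 * e) (fun y => amul (f e y) (fup (pv U) (rho e) (m e) y)))).
      apply (cok_dquo N (-1) (fun e y => amul (f e y) (fup (pv U) (rho e) (m e) y)));
        [rewrite Rabs_left; lra|apply cok_mul; assumption|].
      intros e He. apply reg_mul; [apply Rf, He|apply HR, He].
    - apply (cok_dquo N 1 (fun e y => amul (f e y) (fum (pv U) (rho e) (m e) y)));
        [rewrite Rabs_pos_eq; lra|apply cok_mul; assumption|].
      intros e He. apply reg_mul; [apply Rf, He|apply HR, He]. }
  split.
  - apply (cok_plus N (fun e => ftr (pv U) e (rho e) (rho e) (m e))).
    + apply Ctr; [assumption|]. intros e He. apply (HB e He).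
    + apply (cok_aone N (fun e _ => pw e (pbe U))), pw_ucb, h_be.
  - apply (cok_plus N (fun e => ftr (pv U) e (m e) (rho e) (m e))).
    + apply Ctr; [assumption|]. intros e He. apply (HB e He).
    + apply (cok_scal N (- pK U) (fun e x => amul (rho e x)
        (adz (aconv (pphi U) (pA U) (pw e (pal U)) (fL (pw e (pN U)) (rho e)) x)))).
      apply (cok_mul N rho (fun e x =>
        adz (aconv (pphi U) (pA U) (pw e (pal U)) (fL (pw e (pN U)) (rho e)) x))); [assumption|].
      apply (cok_adz N (fun e => aconv (pphi U) (pA U) (pw e (pal U)) (fL (pw e (pN U)) (rho e)))).
      apply (cok_aconv N (pphi U) (pA U) (fun e => pw e (pal U)) (fun e => fL (pw e (pN U)) (rho e)));
        [apply h_ker|apply pw_0|apply pw_ucv, h_al|exact CL|].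
      intros e He. apply HR, He.
Qed.

Lemma cok_sol (U : setup) (N : nat) : cok N (arho U) /\ cok N (am U).
Proof.
  induction N as [|N [C1 C2]].
  - split; intros n k Hn; replace n with O by lia.
    + apply (tay_ucb (pr U) k (pd U ^ S k)). intros; apply h_tr.
    + apply (tay_ucb (pm U) k (pd U ^ S k)). intros; apply h_tm.
  - destruct (cok_F U N (arho U) (am U)) as [D1 D2]; [|assumption..|].
    { intros e He. split; [apply ball_sol, He|apply reg_sol, He]. }
    split; intros n k Hn; (destruct (Nat.eq_dec n (S N)) as [->|Hne]; [|auto with arith]).
    + apply ucb_ext with (fun e x => / INR (S N) * Frho U e (arho U e) (am U e) x N k).
      * intros e x _. rewrite <- arho_succ. field. apply not_0_INR; lia.
      * apply ucb_scal, D1. lia.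
    + apply C1; lia.
    + apply ucb_ext with (fun e x => / INR (S N) * Fm U e (arho U e) (am U e) x N k).
      * intros e x _. rewrite <- am_succ. field. apply not_0_INR; lia.
      * apply ucb_scal, D2. lia.
    + apply C2; lia.
Qed.

(** * Summation of the series *)

Lemma is_derive_err (f : R -> R) (x l K d : R) :
  0 < d ->
  (forall h, h <> 0 -> Rabs h < d -> Rabs ((f (x + h) - f x) / h - l) <= K * Rabs h) ->
  is_derive f x l.
Proof.
  intros Hd H. apply is_derive_Reals. intros eps Heps.
  pose proof (Rabs_pos K) as HK.
  assert (Hp : 0 < Rmin d (eps / (Rabs K + 1)))
    by (apply Rmin_glb_lt; [exact Hd|apply Rdiv_lt_0_compat; lra]).
  exists (mkposreal _ Hp). intros h Hh Hlt. simpl in Hlt.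
  eapply Rle_lt_trans; [apply H; [exact Hh|]|].
  - eapply Rlt_le_trans; [exact Hlt|apply Rmin_l].
  - assert (Rabs h < eps / (Rabs K + 1)) by (eapply Rlt_le_trans; [exact Hlt|apply Rmin_r]).
    apply Rle_lt_trans with ((Rabs K + 1) * Rabs h).
    + apply Rmult_le_compat_r; [apply Rabs_pos|]. pose proof (Rle_abs K); lra.
    + apply Rmult_lt_compat_l with (r := Rabs K + 1) in H0; [|lra].
      replace ((Rabs K + 1) * (eps / (Rabs K + 1))) with eps in H0 by (field; lra). exact H0.
Qed.

Lemma series_pseries (a : nat -> R) (t l : R) :
  is_series (fun n => a n * t ^ n) l -> is_pseries a t l.
Proof. intros H. exact (proj2 (is_pseries_R a t l) H). Qed.

Lemma pseries_series (a : nat -> R) (t l : R) :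
  is_pseries a t l -> is_series (fun n => a n * t ^ n) l.
Proof. intros H. exact (proj1 (is_pseries_R a t l) H). Qed.

Lemma pseries_plus (t la lb : R) (a b : nat -> R) :
  is_pseries a t la -> is_pseries b t lb -> is_pseries (fun n => a n + b n) t (la + lb).
Proof. intros Ha Hb. apply (is_pseries_plus a b); assumption. Qed.

Lemma pseries_scal (c t l : R) (a : nat -> R) :
  is_pseries a t l -> is_pseries (fun n => c * a n) t (c * l).
Proof. intros Ha. apply (is_pseries_scal c a); [apply Rmult_comm|exact Ha]. Qed.

Lemma pseries_aone (t : R) : is_pseries (fun n => aone n O) t 1.
Proof.
  apply series_pseries, is_series_err with 0. intros n.
  rewrite (sum_extend _ 0 n); [simpl; rewrite Rmult_1_r, Rminus_diag_eq, Rabs_R0 by reflexivity; lra|lia|].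
  intros i Hi. rewrite aone_eq0 by lia. ring.
Qed.

(** For each [n] the difference quotient in the parameter misses the derivative by at most
    [M2 * T ^ n * Rabs h], and these errors sum geometrically to [O(h)]. *)
Lemma pseries_derive_param (a a1 a2 : nat -> R -> R) (M M2 T t x d : R) :
  0 < T -> T * Rabs t <= / 2 -> 0 < d ->
  (forall n y, Rabs (y - x) < d ->
     is_derive (a n) y (a1 n y) /\ is_derive (a1 n) y (a2 n y)) ->
  (forall y, Rabs (y - x) < d ->
     geom M T (fun n => a n y) /\ geom M T (fun n => a1 n y) /\ geom M2 T (fun n => a2 n y)) ->
  is_derive (fun y => PSeries (fun n => a n y) t) x (PSeries (fun n => a1 n x) t).
Proof.
  intros HT Ht Hd Hder Hg. apply is_derive_err with (2 * M2) d; [exact Hd|].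
  intros h Hh Hhd.
  assert (H0 : Rabs (x - x) < d) by (rewrite Rminus_diag_eq, Rabs_R0 by reflexivity; exact Hd).
  assert (H1 : Rabs (x + h - x) < d) by (replace (x + h - x) with h by ring; exact Hhd).
  destruct (Hg x H0) as (G0 & G1 & _). destruct (Hg (x + h) H1) as (G2 & _ & _).
  apply (geom_pseries _ _ t) in G0; [|assumption..].
  apply (geom_pseries _ _ t) in G1; [|assumption..].
  apply (geom_pseries _ _ t) in G2; [|assumption..].
  apply pseries_series in G0, G1, G2.
  set (F := PSeries (fun n => a n x) t) in *. set (F1 := PSeries (fun n => a1 n x) t) in *.
  set (F2 := PSeries (fun n => a n (x + h)) t) in *.
  assert (HS : is_series (fun n => ((a n (x + h) - a n x) / h - a1 n x) * t ^ n)
                 ((F2 - F) / h - F1)).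
  { replace ((F2 - F) / h - F1) with (minus (scal (/ h) (minus F2 F)) F1)
      by (unfold minus, plus, opp, scal; simpl; unfold mult; simpl; field; exact Hh).
    eapply is_series_ext; [|apply (is_series_minus _ _ _ _ (is_series_scal (/ h) _ _
      (is_series_minus _ _ _ _ G2 G0)) G1)].
    intros n. unfold minus, plus, opp, scal; simpl; unfold mult; simpl. field. exact Hh. }
  replace (2 * M2 * Rabs h) with (2 * (M2 * Rabs h)) by ring.
  apply (is_series_bound _ _ _ HS). intros n. rewrite Rabs_mult.
  assert (Hy : forall y, Rmin x (x + h) <= y <= Rmax x (x + h) -> Rabs (y - x) < d).
  { intros y Hy. eapply Rle_lt_trans; [|exact Hhd].
    unfold Rmin, Rmax in Hy. destruct (Rle_dec x (x + h));
      unfold Rabs; repeat destruct Rcase_abs; lra. }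
  assert (Q := diff_quot_error (a n) (a1 n) (a2 n) (M2 * T ^ n) x h Hh).
  assert (Q' : Rabs ((a n (x + h) - a n x) / h - a1 n x) <= M2 * T ^ n * Rabs h).
  { apply Q. intros y Hyy. apply Hy in Hyy. split; [apply Hder, Hyy|split; [apply Hder, Hyy|]].
    apply (Hg y Hyy). }
  apply Rle_trans with (M2 * T ^ n * Rabs h * Rabs (t ^ n)).
  { apply Rmult_le_compat_r; [apply Rabs_pos|exact Q']. }
  rewrite <- RPow_abs.
  replace (M2 * T ^ n * Rabs h * Rabs t ^ n) with (M2 * Rabs h * (T * Rabs t) ^ n)
    by (rewrite Rpow_mult_distr; ring).
  apply Rmult_le_compat_l.
  - apply Rmult_le_pos; [|apply Rabs_pos].
    destruct (Hg x H0) as (_ & _ & G). specialize (G O). simpl in G.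
    pose proof (Rabs_pos (a2 O x)). lra.
  - apply pow_incr. split; [apply Rmult_le_pos; [lra|apply Rabs_pos]|exact Ht].
Qed.

Lemma pseries_apow (U : arr) (T t zeta : R) (j : nat) :
  0 < T -> T * Rabs t <= / 2 ->
  (forall j n, Rabs (apow U j n O) <= 64 * zeta ^ j * T ^ n) ->
  (forall n, Rabs (U n O) <= zeta * T ^ n) ->
  is_pseries (fun n => apow U j n O) t (PSeries (fun n => U n O) t ^ j).
Proof.
  intros HT Ht Hp HU. induction j as [|j IH].
  - simpl. replace 1 with (PSeries (fun n => aone n O) t).
    + apply geom_pseries with 64 T; try assumption.
      intros n. specialize (Hp O n). simpl in Hp. lra.
    + apply is_pseries_unique. apply series_pseries.
      apply is_series_err with 0. intros n.
      rewrite (sum_extend _ 0 n); [simpl; rewrite Rmult_1_r, Rminus_diag_eq, Rabs_R0 by reflexivity; lra|lia|].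
      intros i Hi. rewrite aone_eq0 by lia. ring.
  - simpl. apply (is_pseries_mult (fun n => U n O) (fun n => apow U j n O)).
    + apply geom_pseries with zeta T; assumption.
    + exact IH.
    + apply geom_radius with zeta T; assumption.
    + apply geom_radius with (64 * zeta ^ j) T; try assumption. intros n; apply Hp.
Qed.

(** Both sides are the limit as [J] grows of the sum over [j <= J] of the
    [H_j(g_00) s^j], where [s] is the sum of [acut g]. *)
Lemma pseries_acomp (H : nat -> R -> R) (g : arr) (T t zeta C r : R) :
  0 < T -> T * Rabs t <= / 2 -> 0 <= zeta -> 0 <= r -> r * zeta <= / 8 ->
  (forall j n, Rabs (apow (acut g) j n O) <= 64 * zeta ^ j * T ^ n) ->
  (forall n, Rabs (acut g n O) <= zeta * T ^ n) ->
  (forall j y, Rabs (y - g O O) <= 2 * zeta ->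
     is_derive (H j) y (INR (S j) * H (S j) y) /\ Rabs (H j y) <= C * r ^ j) ->
  is_pseries (fun n => acomp H g n O) t (H O (PSeries (fun n => g n O) t)).
Proof.
  intros HT Ht Hz Hr Hrz Hp HU HH.
  set (s := PSeries (fun n => acut g n O) t).
  assert (Hg00 : Rabs (g O O - g O O) <= 2 * zeta)
    by (rewrite Rminus_diag_eq, Rabs_R0 by reflexivity; lra).
  assert (HC : 0 <= C).
  { destruct (HH O (g O O) Hg00) as [_ HC]. simpl in HC. pose proof (Rabs_pos (H O (g O O))). lra. }
  assert (Hs : Rabs s <= 2 * zeta) by (apply geom_PSeries_bound with T; assumption).
  assert (Es : PSeries (fun n => g n O) t = g O O + s).
  { apply is_pseries_unique. pose proof (geom_pseries zeta T t _ HT HU Ht) as H1. fold s in H1.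
    apply is_pseries_ext with (fun n => g O O * aone n O + acut g n O).
    { intros n. rewrite (acut_split g n O). apply Rplus_comm. }
    apply pseries_plus; [|exact H1]. 
    pose proof (pseries_scal (g O O) t 1 _ (pseries_aone t)) as H2.
    rewrite Rmult_1_r in H2. exact H2. }
  assert (Hrz' : 0 <= r * zeta) by (apply Rmult_le_pos; assumption).
  assert (B : forall j n, Rabs (H j (g O O) * apow (acut g) j n O) <= 64 * C * T ^ n * (/ 2) ^ j).
  { intros j n. rewrite Rabs_mult. destruct (HH j (g O O) Hg00) as [_ Hj].
    apply Rle_trans with (C * r ^ j * (64 * zeta ^ j * T ^ n)).
    - apply Rmult_le_compat; try apply Rabs_pos; [exact Hj|apply Hp].
    - replace (C * r ^ j * (64 * zeta ^ j * T ^ n)) with (64 * C * T ^ n * (r * zeta) ^ j)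
        by (rewrite Rpow_mult_distr; ring).
      apply Rmult_le_compat_l.
      + pose proof (pow_lt T n HT). repeat apply Rmult_le_pos; lra.
      + apply pow_incr; lra. }
  assert (G : geom (128 * C) T (fun n => acomp H g n O)).
  { intros n. unfold acomp. eapply Rle_trans; [apply sum_abs_le; intros j _; apply B|].
    rewrite sum_scal_l. pose proof (sum_half_pow (n + 0)). pose proof (pow_lt T n HT).
    apply Rle_trans with (64 * C * T ^ n * 2); [|lra].
    apply Rmult_le_compat_l; [repeat apply Rmult_le_pos; lra|assumption]. }
  pose proof (geom_pseries _ _ t _ HT G Ht) as HA.
  set (L := PSeries (fun n => acomp H g n O) t) in *.
  assert (E : L = H O (PSeries (fun n => g n O) t)); [|rewrite <- E; exact HA].
  rewrite Es. apply pseries_series in HA.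
  assert (S1 : is_series (fun j => H j (g O O) * s ^ j) L).
  { apply is_series_err with (128 * C). intros J.
    assert (S2 : is_pseries (fun n => sum_f_R0 (fun j => H j (g O O) * apow (acut g) j n O) J) t
                  (sum_f_R0 (fun j => H j (g O O) * s ^ j) J)).
    { induction J as [|J IH].
      - apply (pseries_scal (H O (g O O)) t _ (fun n => apow (acut g) 0 n O)).
        apply pseries_apow with T zeta; assumption.
      - apply (pseries_plus t _ _ (fun n => sum_f_R0 (fun j => H j (g O O) * apow (acut g) j n O) J)
          (fun n => H (S J) (g O O) * apow (acut g) (S J) n O)); [exact IH|].
        apply (pseries_scal (H (S J) (g O O)) t _ (fun n => apow (acut g) (S J) n O)).
        apply pseries_apow with T zeta; assumption. }
    apply pseries_series in S2.
    pose proof (is_series_minus _ _ _ _ S2 HA) as S3.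
    replace (128 * C * (/ 2) ^ J) with (2 * (64 * C * (/ 2) ^ J)) by ring.
    apply (is_series_bound _ _ _ S3). intros n.
    unfold minus, plus, opp; simpl.
    replace (sum_f_R0 (fun j => H j (g O O) * apow (acut g) j n O) J * t ^ n +
      - (acomp H g n O * t ^ n)) with
      (- (acomp H g n O - sum_f_R0 (fun j => H j (g O O) * apow (acut g) j n O) J) * t ^ n) by ring.
    rewrite Rabs_mult, Rabs_Ropp, <- RPow_abs.
    apply Rle_trans with (64 * C * T ^ n * (/ 2) ^ J * Rabs t ^ n).
    - apply Rmult_le_compat_r; [apply pow_le, Rabs_pos|].
      (* Up to degree [J] in [t] the truncated composition is exact; beyond it, what is missing is a
         geometric tail in [j]. *)
      destruct (le_dec n J) as [Hn|Hn].
      + rewrite (acomp_trunc H g n 0 J) by lia. rewrite Rminus_diag_eq, Rabs_R0 by reflexivity.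
        pose proof (pow_lt T n HT). pose proof (pow_lt (/ 2) J ltac:(lra)).
        repeat apply Rmult_le_pos; lra.
      + unfold acomp. apply sum_tail; [|lia]. intros j. apply B.
    - replace (64 * C * T ^ n * (/ 2) ^ J * Rabs t ^ n)
        with (64 * C * (/ 2) ^ J * (T * Rabs t) ^ n) by (rewrite Rpow_mult_distr; ring).
      apply Rmult_le_compat_l.
      + pose proof (pow_lt (/ 2) J ltac:(lra)). repeat apply Rmult_le_pos; lra.
      + apply pow_incr. split; [apply Rmult_le_pos; [lra|apply Rabs_pos]|exact Ht]. }
  assert (S4 : is_series (fun j => H j (g O O) * s ^ j) (H O (g O O + s))).
  { apply (is_series_ext (fun j => H j (g O O) * (g O O + s - g O O) ^ j)).
    { intros j. f_equal. f_equal. ring. }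
    apply taylor_series with C r; [exact Hr| |].
    - replace (g O O + s - g O O) with s by ring.
      apply Rmult_le_compat_l with (r := r) in Hs; [|exact Hr]. lra.
    - intros j y Hy. apply HH. eapply Rle_trans; [|exact Hs].
      unfold Rmin, Rmax in Hy. destruct (Rle_dec (g O O) (g O O + s));
        unfold Rabs; repeat destruct Rcase_abs; lra. }
  rewrite <- (is_series_unique _ _ S1). apply is_series_unique, S4.
Qed.

(** Only the column [k = 0] is summed, because [z = 0] is the point [x] itself; the other columns
    account for the [x]-derivatives. *)
Definition fsum (f : fld) (t x : R) : R := PSeries (fun n => f x n O) t.

Definition gbd (T s M : R) (f : fld) : Prop :=
  forall x n k, Rabs (f x n k) <= M * T ^ n * s ^ k.

Lemma gbd_geom (T s M : R) (f : fld) (x : R) :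
  gbd T s M f -> geom M T (fun n => f x n O).
Proof. intros Hf n. specialize (Hf x n O). simpl in Hf. lra. Qed.

Lemma gbd_adz (T s M : R) (f : fld) :
  0 < T -> 0 < s -> 0 <= M -> gbd T s M f -> gbd T (2 * s) (M * s) (fun x => adz (f x)).
Proof.
  intros HT Hs HM Hf x n k. unfold adz.
  rewrite Rabs_mult, (Rabs_pos_eq (INR _)) by apply pos_INR.
  apply Rle_trans with (2 ^ k * (M * T ^ n * s ^ S k)).
  - apply Rmult_le_compat; [apply pos_INR|apply Rabs_pos|apply INR_S_le_pow2|apply Hf].
  - right. rewrite Rpow_mult_distr. simpl. ring.
Qed.

Lemma fsum_pseries (T s M t x : R) (f : fld) :
  0 < T -> T * Rabs t <= / 2 -> gbd T s M f ->
  is_pseries (fun n => f x n O) t (fsum f t x).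
Proof.
  intros HT Ht Hf. apply geom_pseries with M T; try assumption.
  apply gbd_geom with s, Hf.
Qed.

Lemma pseries_amul (T M M' t la lb : R) (f g : arr) :
  0 < T -> T * Rabs t <= / 2 ->
  geom M T (fun n => f n O) -> geom M' T (fun n => g n O) ->
  is_pseries (fun n => f n O) t la -> is_pseries (fun n => g n O) t lb ->
  is_pseries (fun n => amul f g n O) t (la * lb).
Proof.
  intros HT Ht Hf Hg Ha Hb.
  apply (is_pseries_mult (fun n => f n O) (fun n => g n O)); try assumption;
    [apply geom_radius with M T|apply geom_radius with M' T]; assumption.
Qed.

Lemma pseries_dquo (h t x l l' : R) (f : fld) :
  h <> 0 -> is_pseries (fun n => f (x + h) n O) t l' -> is_pseries (fun n => f x n O) t l ->
  is_pseries (fun n => dquo h f x n O) t ((l' - l) / h).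
Proof.
  intros Hh H' H0. unfold dquo. destruct (Req_EM_T h 0) as [E|_]; [contradiction|].
  replace ((l' - l) / h) with (/ h * (l' + (-1) * l)) by (field; exact Hh).
  apply is_pseries_ext with (fun n => / h * (f (x + h) n O + (-1) * f x n O)).
  { intros n. simpl. field. exact Hh. }
  apply pseries_scal. apply pseries_plus; [exact H'|apply pseries_scal, H0].
Qed.

Lemma fsum_derive (T s M t x : R) (f : fld) :
  0 < T -> 0 < s -> 0 <= M -> T * Rabs t <= / 2 -> gbd T s M f -> (forall N, reg N f) ->
  is_derive (fsum f t) x (fsum (fun x => adz (f x)) t x).
Proof.
  intros HT Hs HM Ht Hf Hr.
  pose proof (gbd_adz T s M f HT Hs HM Hf) as H1.
  assert (HMs : 0 <= M * s) by (apply Rmult_le_pos; lra).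
  pose proof (gbd_adz T (2 * s) (M * s) _ HT ltac:(lra) HMs H1) as H2.
  apply (pseries_derive_param (fun n y => f y n O) (fun n y => adz (f y) n O)
    (fun n y => adz (adz (f y)) n O) (M + M * s) (M * s * (2 * s)) T t x 1); try assumption; try lra.
  - intros n y _. split; [apply (Hr n n O (le_n _))|].
    apply (reg_adz n f (Hr n) n O (le_n _)).
  - intros y _. assert (G : forall a b (u : nat -> R), a <= b -> geom a T u -> geom b T u).
    { intros a b u Hab Hu n. eapply Rle_trans; [apply Hu|].
      apply Rmult_le_compat_r; [apply pow_le; lra|exact Hab]. }
    split; [|split].
    + apply G with M; [lra|apply gbd_geom with s, Hf].
    + apply G with (M * s); [lra|apply (gbd_geom T (2 * s) (M * s) (fun x => adz (f x))), H1].
    + apply (gbd_geom T (2 * (2 * s)) _ (fun x => adz (adz (f x)))), H2.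
Qed.

Lemma cnv_sum (phi : R -> R) (A mu t x : R) (f : nat -> R -> R) (N : nat) :
  kernel phi A -> (forall n y, continuous (f n) y) ->
  (forall y, continuous (fun y => sum_f_R0 (fun n => f n y * t ^ n) N) y) /\
  cnv phi A mu (fun y => sum_f_R0 (fun n => f n y * t ^ n) N) x =
  sum_f_R0 (fun n => cnv phi A mu (f n) x * t ^ n) N.
Proof.
  intros Hk Hf.
  assert (Hc : forall n y, continuous (fun y => f n y * t ^ n) y)
    by (intros n y; apply (continuous_mult (f n) (fun _ => t ^ n)); [apply Hf|apply continuous_const]).
  assert (Ht : forall n, cnv phi A mu (fun y => f n y * t ^ n) x = cnv phi A mu (f n) x * t ^ n).
  { intros n. rewrite (cnv_ext _ _ (fun y => t ^ n * f n y)) by (intros; ring).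
    rewrite cnv_scal by (assumption || apply Hf). ring. }
  induction N as [|N [IH1 IH2]].
  - simpl sum_f_R0. split; [apply (Hc O)|apply (Ht O)].
  - split.
    + intros y. simpl sum_f_R0.
      apply (continuous_plus (fun y => sum_f_R0 (fun n => f n y * t ^ n) N)); [apply IH1|apply Hc].
    + rewrite tech5, <- IH2, <- Ht.
      rewrite (cnv_ext _ _ (fun y => sum_f_R0 (fun n => f n y * t ^ n) N + f (S N) y * t ^ S N))
        by (intros; reflexivity).
      apply (cnv_plus phi _ (fun y => f (S N) y * t ^ S N)); [exact Hk|exact IH1|apply Hc].
Qed.

(** Convolution commutes with partial sums by linearity and, being a contraction, does not enlarge
    the remainder, which is small uniformly in the base point. *)
Lemma pseries_aconv (phi : R -> R) (A mu T s M t x : R) (f : fld) :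
  kernel phi A -> 0 < T -> 0 < s -> 0 <= M -> T * Rabs t <= / 2 ->
  gbd T s M f -> (forall N, reg N f) ->
  is_pseries (fun n => aconv phi A mu f x n O) t (cnv phi A mu (fsum f t) x).
Proof.
  intros Hk HT Hs HM Ht Hf Hr. apply series_pseries, is_series_err with M. intros N.
  destruct (cnv_sum phi A mu t x (fun n y => f y n O) N Hk) as [Hc E].
  { intros n y. apply (reg_continuous n f); [apply Hr|lia]. }
  unfold aconv. rewrite <- E. apply cnv_minus_le; [exact Hk|exact Hc| |].
  - intros y. apply ex_derive_cont. eexists. apply fsum_derive with T s M; assumption.
  - intros z _. rewrite Rabs_minus_sym. apply geom_PSeries_tail with T; try assumption.
    apply gbd_geom with s, Hf.
Qed.

(** * Solution of the regularized system *)

Lemma geom_PS_derive (M T : R) (a : nat -> R) :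
  0 < T -> geom M T a -> geom (M * T) (2 * T) (PS_derive a).
Proof.
  intros HT Ha n. unfold PS_derive.
  rewrite Rabs_mult, (Rabs_pos_eq (INR _)) by apply pos_INR.
  apply Rle_trans with (2 ^ n * (M * T ^ S n)).
  - apply Rmult_le_compat; [apply pos_INR|apply Rabs_pos|apply INR_S_le_pow2|apply Ha].
  - right. rewrite Rpow_mult_distr. simpl. ring.
Qed.

Lemma is_derive_unif_err (f : R -> R -> R) (t K d : R) (l : R -> R) :
  0 < d ->
  (forall h, h <> 0 -> Rabs h < d -> forall x,
     Rabs ((f (t + h) x - f t x) / h - l x) <= K * Rabs h) ->
  is_derive_unif f t l.
Proof.
  intros Hd H P [eps HP]. pose proof (Rabs_pos K) as HK.
  assert (Hp : 0 < Rmin d (eps / (Rabs K + 1)))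
    by (apply Rmin_glb_lt; [exact Hd|apply Rdiv_lt_0_compat; [apply cond_pos|lra]]).
  exists (mkposreal _ Hp). intros h Hh Hne. apply HP. intros x.
  change (Rabs (h - 0) < Rmin d (eps / (Rabs K + 1))) in Hh. rewrite Rminus_0_r in Hh.
  change (Rabs ((f (t + h) x - f t x) / h - l x) < eps).
  eapply Rle_lt_trans; [apply H; [exact Hne|]|].
  - eapply Rlt_le_trans; [exact Hh|apply Rmin_l].
  - assert (H0 : Rabs h < eps / (Rabs K + 1)) by (eapply Rlt_le_trans; [exact Hh|apply Rmin_r]).
    apply Rle_lt_trans with ((Rabs K + 1) * Rabs h).
    + apply Rmult_le_compat_r; [apply Rabs_pos|]. pose proof (Rle_abs K); lra.
    + apply Rmult_lt_compat_l with (r := Rabs K + 1) in H0; [|lra].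
      replace ((Rabs K + 1) * (eps / (Rabs K + 1))) with (pos eps) in H0 by (field; lra). exact H0.
Qed.

(** Two termwise derivatives in [t] double the rate twice, to [4 * T]; hence [8 * T * t0 <= 1]. The
    coefficient bounds do not involve [x], so neither does the error of the difference quotient. *)
Lemma fsum_derive_unif (T s M t0 t : R) (f : fld) :
  0 < T -> 8 * T * t0 <= 1 -> Rabs t < t0 -> gbd T s M f ->
  is_derive_unif (fsum f) t (fun x => PSeries (PS_derive (fun n => f x n O)) t).
Proof.
  intros HT Ht0 Ht Hf.
  apply is_derive_unif_err with (2 * (M * T * (2 * T))) (t0 - Rabs t); [lra|].
  intros h Hh Hhd x. pose proof (gbd_geom T s M f x Hf) as G.
  set (a := fun n => f x n O) in *.
  pose proof (geom_PS_derive M T a HT G) as G1.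
  pose proof (geom_PS_derive _ (2 * T) _ ltac:(lra) G1) as G2.
  apply (diff_quot_error (PSeries a) (PSeries (PS_derive a)) (PSeries (PS_derive (PS_derive a))));
    [exact Hh|].
  intros y Hy.
  assert (Hyt : Rabs y < t0).
  { unfold Rmin, Rmax in Hy. unfold Rabs in *.
    repeat destruct Rle_dec; repeat destruct Rcase_abs; lra. }
  pose proof (Rabs_pos y) as Hy0.
  assert (HTy : T * Rabs y <= T * t0) by (apply Rmult_le_compat_l; lra).
  split; [|split].
  - apply is_derive_PSeries. apply geom_radius with M T; [assumption..|lra].
  - apply is_derive_PSeries. apply geom_radius with (M * T) (2 * T); [lra|assumption|lra].
  - apply geom_PSeries_bound with (2 * (2 * T)); [lra|exact G2|lra].
Qed.

Lemma is_RInt_gen_support (f : R -> R) (B : R) :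
  0 < B -> (forall x, continuous f x) -> (forall x, B <= Rabs x -> f x = 0) ->
  is_RInt_gen f (Rbar_locally m_infty) (Rbar_locally p_infty) (RInt f (- B) B).
Proof.
  intros HB Hc Hs P HP.
  assert (Z : forall a b, (forall x, Rmin a b < x < Rmax a b -> B <= Rabs x) -> is_RInt f a b 0).
  { intros a b Hab. apply is_RInt_ext with (fun _ => 0).
    - intros x Hx. symmetry. apply Hs, Hab, Hx.
    - evar_last; [apply (is_RInt_const a b 0)|]. unfold scal; simpl; unfold mult; simpl; ring. }
  apply Filter_prod with (fun a => a < - B) (fun b => B < b).
  - exists (- B). tauto.
  - exists B. tauto.
  - intros a b Ha Hb. exists (RInt f (- B) B). split; [|apply (locally_singleton _ _ HP)].
    simpl. evar_last.
    { apply (is_RInt_Chasles (V := R_NormedModule) f a B b (plus 0 (RInt f (- B) B)) 0);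
        [apply (is_RInt_Chasles (V := R_NormedModule) f a (- B) B 0)|].
    + apply Z. intros x Hx. rewrite Rmin_left, Rmax_right in Hx by lra. rewrite Rabs_left; lra.
    + apply (RInt_correct f), (ex_RInt_continuous f). intros; apply Hc.
    + apply Z. intros x Hx. rewrite Rmin_left, Rmax_right in Hx by lra. rewrite Rabs_pos_eq; lra. }
    unfold plus; simpl; ring.
Qed.

Lemma mollifier_kernel (phi : R -> R) : mollifier phi -> exists A, kernel phi A.
Proof.
  intros [Hsm [A0 Hs] Hge Hev Hint].
  assert (D1 : forall x, ex_derive phi x) by (intros x; apply (Hsm 1%nat x)).
  pose proof (Rabs_pos A0).
  (* [A0] may be negative, and it gives vanishing only for [A0 < Rabs x]; this choice is positive
     and allows the non-strict inequality of [kernel_support]. *)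
  exists (Rabs A0 + 1). split; try assumption; try lra.
  - intros x. apply (Hsm 2%nat x).
  - intros x Hx. apply Hs. pose proof (Rle_abs A0). lra.
  - assert (HI : is_RInt_gen phi (Rbar_locally m_infty) (Rbar_locally p_infty)
                   (RInt phi (- (Rabs A0 + 1)) (Rabs A0 + 1))).
    { apply is_RInt_gen_support; [lra| |].
      - intros x. apply ex_derive_cont, D1.
      - intros x Hx. apply Hs. pose proof (Rle_abs A0). lra. }
    rewrite <- (is_RInt_gen_unique _ _ HI). apply is_RInt_gen_unique, Hint.
Qed.

(** The substitution [y = mu * z], once the support of the kernel has reduced the improper integral
    to a compact interval. *)
Lemma convolution_cnv (phi f : R -> R) (A mu x : R) :
  kernel phi A -> 0 < mu -> (forall y, continuous f y) ->
  convolution f (rescale phi mu) x = cnv phi A mu f x.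
Proof.
  intros Hk Hmu Hf. pose proof (kernel_A _ _ Hk) as HA.
  assert (HB : 0 < mu * A) by nra.
  unfold convolution. apply is_RInt_gen_unique.
  replace (cnv phi A mu f x) with
    (RInt (fun y => f (x - y) * rescale phi mu y) (- (mu * A)) (mu * A)).
  - apply is_RInt_gen_support; [exact HB| |].
    + intros y. apply (continuous_mult (fun y => f (x - y)) (rescale phi mu)).
      * apply (continuous_comp (fun y => x - y) f); [|apply Hf].
        apply ex_derive_cont. auto_derive. exact I.
      * apply (continuous_mult (fun _ => / mu) (fun y => phi (y / mu))); [apply continuous_const|].
        apply (continuous_comp (fun y => y / mu) phi).
        -- apply ex_derive_cont. auto_derive. exact I.
        -- apply ex_derive_cont, (kernel_derive _ _ Hk).
    + intros y Hy. unfold rescale. rewrite (kernel_support _ _ Hk); [ring|].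
      unfold Rdiv. rewrite Rabs_mult, Rabs_inv, (Rabs_pos_eq mu) by lra.
      apply Rmult_le_reg_r with mu; [exact Hmu|].
      rewrite Rmult_assoc, Rinv_l by lra. lra.
  - apply is_RInt_unique.
    apply is_RInt_ext with (fun y => scal (/ mu) (phi (/ mu * y + 0) * f (x - mu * (/ mu * y + 0)))).
    + intros y _. unfold rescale, scal; simpl; unfold mult; simpl.
      replace (x - mu * (/ mu * y + 0)) with (x - y) by (field; lra).
      replace (/ mu * y + 0) with (y / mu) by (field; lra). ring.
    + apply (is_RInt_comp_lin (fun z => phi z * f (x - mu * z)) (/ mu) 0).
      replace (/ mu * - (mu * A) + 0) with (- A) by (field; lra).
      replace (/ mu * (mu * A) + 0) with A by (field; lra).
      apply (RInt_correct (fun z => phi z * f (x - mu * z))).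
      apply ex_RInt_kernel_prod; assumption.
Qed.

(** * Rates, time interval and sums of the constructed series *)

Definition TT (U : setup) : R := 2 * tau U.
Definition SS (U : setup) : R := 2 * sigma U.
(** The margin 64 leaves room for every doubling of the rate: two time derivatives, and the
    re-expansion about nonzero times on which joint analyticity rests. *)
Definition tmax (U : setup) : R := / (64 * TT U).

Lemma TT_pos (U : setup) : 0 < TT U.
Proof. pose proof (tau_pos U). unfold TT. lra. Qed.

Lemma SS_pos (U : setup) : 0 < SS U.
Proof. pose proof (sigma_pos U). unfold SS. lra. Qed.

Lemma tmax_pos (U : setup) : 0 < tmax U.
Proof. pose proof (TT_pos U). unfold tmax. apply Rinv_0_lt_compat. lra. Qed.

Lemma TT_small (U : setup) (t : R) : Rabs t < tmax U -> 64 * (TT U * Rabs t) <= 1.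
Proof.
  intros Ht. pose proof (TT_pos U) as HT.
  assert (E : 64 * TT U * tmax U = 1) by (unfold tmax; field; lra).
  apply Rmult_lt_compat_l with (r := 64 * TT U) in Ht; lra.
Qed.

Lemma bd_gbd (U : setup) (M : R) (f : fld) :
  0 <= M -> (forall N x, bd (tau U) (sigma U) N M (f x)) -> gbd (TT U) (SS U) M f.
Proof.
  intros HM H x n k. apply bd_geom with n; [apply tau_pos|apply sigma_pos|exact HM|apply H|lia].
Qed.

Lemma comp_sum (U : setup) (H : nat -> R -> R) (g : arr) (t zeta C : R) :
  Rabs t < tmax U -> 0 <= zeta -> pd U * zeta <= / 8 ->
  (forall N, bd (tau U) (sigma U) N zeta (acut g)) ->
  (forall j y, Rabs (y - g O O) <= 2 * zeta ->
     is_derive (H j) y (INR (S j) * H (S j) y) /\ Rabs (H j y) <= C * pd U ^ j) ->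
  is_pseries (fun n => acomp H g n O) t (H O (PSeries (fun n => g n O) t)).
Proof.
  intros Ht Hz Hdz Hb HH. pose proof (TT_small U t Ht) as HTt. pose proof (Rabs_pos t).
  pose proof (tau_pos U); pose proof (sigma_pos U); pose proof (TT_pos U); pose proof (pd_ge U).
  apply pseries_acomp with (TT U) zeta C (pd U); try assumption; try lra.
  - intros j n. pose proof (pow_le zeta j Hz).
    assert (B := bd_geom (tau U) (sigma U) n (64 * zeta ^ j) (apow (acut g) j) n 0).
    rewrite pow_O, Rmult_1_r in B.
    apply B; try assumption; try lra; [|lia]. apply bd_pow; try assumption. apply Hb.
  - intros n. assert (B := bd_geom (tau U) (sigma U) n zeta (acut g) n 0).
    rewrite pow_O, Rmult_1_r in B. apply B; try assumption; [apply Hb|lia].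
Qed.

Definition prho (U : setup) (e : R) : R -> R -> R := fsum (arho U e).
Definition pmom (U : setup) (e : R) : R -> R -> R := fsum (am U e).
Definition pu (U : setup) (e t x : R) : R := velocity (prho U e t) (pmom U e t) x.

Lemma sol_gbd (U : setup) (e : R) :
  0 <= e < 1 ->
  gbd (TT U) (SS U) (bigM U) (arho U e) /\ gbd (TT U) (SS U) (bigM U) (am U e) /\
  gbd (TT U) (SS U) (bigM U) (fq (arho U e)) /\
  gbd (TT U) (SS U) (bigM U) (fu (arho U e) (am U e)) /\
  gbd (TT U) (SS U) (bigM U) (fv (pv U) (arho U e) (am U e)) /\
  gbd (TT U) (SS U) (bigM U) (fup (pv U) (arho U e) (am U e)) /\
  gbd (TT U) (SS U) (bigM U) (fum (pv U) (arho U e) (am U e)) /\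
  gbd (TT U) (SS U) (bigM U) (fL (pw e (pN U)) (arho U e)).
Proof.
  intros He. pose proof (bigM_ge U) as HM.
  assert (B := fun N x => ball_bounds U e N _ _ He (ball_sol U e N He) x).
  repeat split; apply bd_gbd; try lra; intros N x; apply (B N x).
Qed.

Lemma sol_reg (U : setup) (e : R) :
  0 <= e < 1 ->
  (forall N, reg N (arho U e)) /\ (forall N, reg N (am U e)) /\
  (forall N, reg N (fu (arho U e) (am U e))) /\
  (forall N, reg N (fup (pv U) (arho U e) (am U e))) /\
  (forall N, reg N (fum (pv U) (arho U e) (am U e))) /\
  (forall N, reg N (fL (pw e (pN U)) (arho U e))).
Proof.
  intros He.
  assert (R := fun N => reg_F U e N _ _ He (arho_00 U e) (proj1 (reg_sol U e N He)) (proj2 (reg_sol U e N He))).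
  split; [intros N; apply reg_sol, He|]. split; [intros N; apply reg_sol, He|].
  do 3 (split; [intros N; apply (R N)|]). intros N; apply (R N).
Qed.

(** Without its constant term the series has geometric bounds with prefactor [eta], and its sum
    costs a factor 2. This keeps the density where the families of [1 / y] and [ln] are controlled,
    and yields its positivity. *)
Lemma prho_near (U : setup) (e t x : R) :
  0 <= e < 1 -> Rabs t < tmax U -> Rabs (prho U e t x - pr U x) <= 2 * eta U.
Proof.
  intros He Ht. pose proof (TT_small U t Ht) as HTt. pose proof (Rabs_pos t).
  pose proof (tau_pos U); pose proof (sigma_pos U); pose proof (TT_pos U).
  destruct (eta_facts U) as (P1 & _).
  destruct (sol_gbd U e He) as (G & _).
  pose proof (fsum_pseries (TT U) (SS U) (bigM U) t x _ (TT_pos U) ltac:(lra) G) as HS.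
  fold (prho U e) in HS.
  pose proof (pseries_plus _ _ _ _ _ HS (pseries_scal (- pr U x) t 1 _ (pseries_aone t))) as H3.
  replace (prho U e t x - pr U x) with (prho U e t x + - pr U x * 1) by ring.
  apply pseries_series in H3. apply (is_series_bound _ _ (eta U) H3).
  intros n. apply (geom_term (eta U) (TT U) t (fun n => arho U e x n O + - pr U x * aone n O));
    [lra| |lra].
  intros k. assert (B := bd_geom (tau U) (sigma U) k (eta U) (acut (arho U e x)) k 0).
  rewrite pow_O, Rmult_1_r in B.
  replace (arho U e x k 0%nat + - pr U x * aone k 0%nat) with (acut (arho U e x) k O)
    by (rewrite (acut_split (arho U e x) k O), arho_00; ring).
  apply B; try assumption; try lra; [|lia]. apply (ball_sol U e k He).
Qed.

Lemma eta_pc (U : setup) : 4 * eta U <= / (2 * pc U) /\ eta U <= / 4000.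
Proof.
  destruct (eta_facts U) as (P1 & P2 & P3 & _). pose proof (h_c U). pose proof (h_cd U).
  split; [|exact P3]. apply Rmult_le_reg_r with (2 * pc U); [lra|].
  rewrite Rinv_l by lra.
  assert (eta U * (2 * pc U) <= eta U * pd U) by (apply Rmult_le_compat_l; lra). lra.
Qed.

Lemma near_pr_range (U : setup) (y x : R) :
  Rabs (y - pr U x) <= 2 * eta U -> / (2 * pc U) <= y <= pc U + 1 /\ 0 < y.
Proof.
  intros Hy. apply Rabs_le_between in Hy. destruct (eta_pc U) as [H1 H2].
  pose proof (h_rge U x). pose proof (h_rle U x). pose proof (pc_pos U). pose proof (h_c U).
  assert (E : / (2 * pc U) = / 2 * / pc U) by (apply Rinv_mult). lra.
Qed.

Lemma prho_pos (U : setup) (e t x : R) :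
  0 <= e < 1 -> Rabs t < tmax U -> 0 < prho U e t x.
Proof.
  intros He Ht. apply (near_pr_range U _ x). apply prho_near; assumption.
Qed.

Lemma sums_basic (U : setup) (e t : R) :
  0 <= e < 1 -> Rabs t < tmax U -> forall x,
  is_pseries (fun n => arho U e x n O) t (prho U e t x) /\
  is_pseries (fun n => am U e x n O) t (pmom U e t x) /\
  is_pseries (fun n => fu (arho U e) (am U e) x n O) t (pu U e t x) /\
  is_pseries (fun n => fup (pv U) (arho U e) (am U e) x n O) t (uplus (pv U) (pu U e t x)) /\
  is_pseries (fun n => fum (pv U) (arho U e) (am U e) x n O) t (uminus (pv U) (pu U e t x)) /\
  is_pseries (fun n => fL (pw e (pN U)) (arho U e) x n O) t (ln (prho U e t x + pw e (pN U))).
Proof.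
  intros He Ht x. pose proof (TT_small U t Ht) as HTt. pose proof (Rabs_pos t).
  pose proof (tau_pos U); pose proof (sigma_pos U); pose proof (TT_pos U) as HT.
  destruct (eta_facts U) as (P1 & P2 & P3 & P4 & P5 & P6 & _). pose proof (pd_ge U).
  destruct (sol_gbd U e He) as (Gr & Gm & Gq & Gu & _).
  assert (Sr := fsum_pseries (TT U) (SS U) (bigM U) t x _ HT ltac:(lra) Gr).
  assert (Sm := fsum_pseries (TT U) (SS U) (bigM U) t x _ HT ltac:(lra) Gm).
  fold (prho U e) in Sr. fold (pmom U e) in Sm.
  assert (HB := fun N => ball_sol U e N He).
  assert (HBB := fun N => ball_bounds U e N _ _ He (HB N) x).
  assert (Sq : is_pseries (fun n => fq (arho U e) x n O) t (/ prho U e t x)).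
  { rewrite <- invH_0. apply (comp_sum U invH (arho U e x) t (eta U) (pd U)); try assumption; try lra.
    - intros N. apply (HB N x).
    - intros j y Hy. rewrite arho_00 in Hy. apply near_pr_range in Hy.
      split; [apply invH_derive; lra|apply h_tinv; lra]. }
  assert (Su : is_pseries (fun n => fu (arho U e) (am U e) x n O) t (pu U e t x)).
  { apply (pseries_amul (TT U) (bigM U) (bigM U)); try assumption; try lra;
      apply gbd_geom with (SS U); assumption. }
  assert (Sv : is_pseries (fun n => fv (pv U) (arho U e) (am U e) x n O) t (pv U (pu U e t x))).
  { rewrite <- (tay_0 (pv U)), <- (is_pseries_unique _ _ _ Su).
    apply (comp_sum U (tay (pv U)) (fu (arho U e) (am U e) x) t (etau U) (pd U)); try assumption; try lra.
    - intros N. apply (HBB N).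
    - intros j y Hy. split; [apply tay_derive, h_v|]. apply h_tv.
      (* The initial velocity is at most [pc ^ 2] and [y] is within [2 * etau <= 1] of it: this is
         the unit margin built into [h_tv]. *)
      rewrite (proj2 (fq_00 U 0 _ _ x (HB O))) in Hy.
      pose proof (u00_bound U x). assert (2 * etau U <= 1) by nra.
      replace y with ((y - pm U x / pr U x) + pm U x / pr U x) by ring.
      eapply Rle_trans; [apply Rabs_triang|lra]. }
  assert (Sl : is_pseries (fun n => fL (pw e (pN U)) (arho U e) x n O) t (ln (prho U e t x + pw e (pN U)))).
  { pose proof (pw_bound e (pN U) He (h_N U)) as Hw.
    assert (E : PSeries (fun n => arho U e x n O + pw e (pN U) * aone n O) t = prho U e t x + pw e (pN U)).
    { apply is_pseries_unique.
      pose proof (pseries_plus _ _ _ _ _ Sr (pseries_scal (pw e (pN U)) t 1 _ (pseries_aone t))) as H3.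
      rewrite Rmult_1_r in H3. exact H3. }
    rewrite <- E.
    apply (comp_sum U lnH (fun n k => arho U e x n k + pw e (pN U) * aone n k) t (eta U) (pd U));
      try assumption; try lra.
    - intros N n k Hn. destruct (HB N x) as (_ & _ & B & _). specialize (B n k Hn).
      replace (acut (fun n k => arho U e x n k + pw e (pN U) * aone n k) n k)
        with (acut (arho U e x) n k); [exact B|].
      destruct n, k; simpl; ring.
    (* The upper end [pc + 2] in [h_tln] is accounted for here: [pc + 1] from [near_pr_range], and
       one more unit for [e^N]. *)
    - intros j y Hy. rewrite arho_00 in Hy. simpl in Hy. rewrite Rmult_1_r in Hy.
      replace (y - (pr U x + pw e (pN U))) with ((y - pw e (pN U)) - pr U x) in Hy by ring.
      apply near_pr_range in Hy. split; [apply lnH_derive; lra|apply h_tln; lra]. }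
  split; [exact Sr|]. split; [exact Sm|]. split; [exact Su|]. split; [|split; [|exact Sl]].
  - pose proof (pseries_scal (/ 2) _ _ _ (pseries_plus _ _ _ _ _ Sv Su)) as H3.
    replace (/ 2 * (pv U (pu U e t x) + pu U e t x)) with (uplus (pv U) (pu U e t x)) in H3
      by (unfold uplus; field). exact H3.
  - pose proof (pseries_scal (/ 2) _ _ _ (pseries_plus _ _ _ _ _ Sv (pseries_scal (-1) _ _ _ Su))) as H3.
    replace (/ 2 * (pv U (pu U e t x) + -1 * pu U e t x)) with (uminus (pv U) (pu U e t x)) in H3
      by (unfold uminus; field). exact H3.
Qed.

Lemma ftr_sum (U : setup) (e t x : R) (f : fld) (F : R -> R) :
  0 < e < 1 -> Rabs t < tmax U -> gbd (TT U) (SS U) (bigM U) f ->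
  (forall y, is_pseries (fun n => f y n O) t (F y)) ->
  is_pseries (fun n => ftr (pv U) e f (arho U e) (am U e) x n O) t
    (transport (pv U) e F (pu U e t) x).
Proof.
  intros He Ht Gf HF. assert (He' : 0 <= e < 1) by lra.
  pose proof (TT_small U t Ht) as HTt. pose proof (Rabs_pos t). pose proof (TT_pos U) as HT.
  destruct (sol_gbd U e He') as (_ & _ & _ & _ & _ & Gup & Gum & _).
  assert (B := sums_basic U e t He' Ht).
  assert (HTt2 : TT U * Rabs t <= / 2) by lra.
  assert (Hp : forall y, is_pseries (fun n => amul (f y) (fup (pv U) (arho U e) (am U e) y) n O) t
                 (F y * uplus (pv U) (pu U e t y))).
  { intros y. destruct (B y) as (_ & _ & _ & By & _ & _).
    exact (pseries_amul (TT U) (bigM U) (bigM U) t _ _ (f y) _ HT HTt2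
      (gbd_geom _ _ _ _ y Gf) (gbd_geom _ _ _ _ y Gup) (HF y) By). }
  assert (Hm : forall y, is_pseries (fun n => amul (f y) (fum (pv U) (arho U e) (am U e) y) n O) t
                 (F y * uminus (pv U) (pu U e t y))).
  { intros y. destruct (B y) as (_ & _ & _ & _ & By & _).
    exact (pseries_amul (TT U) (bigM U) (bigM U) t _ _ (f y) _ HT HTt2
      (gbd_geom _ _ _ _ y Gf) (gbd_geom _ _ _ _ y Gum) (HF y) By). }
  assert (E : transport (pv U) e F (pu U e t) x =
    (-1) * ((F (x + -1 * e) * uplus (pv U) (pu U e t (x + -1 * e)) - F x * uplus (pv U) (pu U e t x)) / (-1 * e))
    + (F (x + 1 * e) * uminus (pv U) (pu U e t (x + 1 * e)) - F x * uminus (pv U) (pu U e t x)) / (1 * e)).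
  { replace (x + -1 * e) with (x - e) by ring. replace (x + 1 * e) with (x + e) by ring.
    unfold transport, uplus, uminus. field. lra. }
  rewrite E.
  apply (pseries_plus t _ _ (fun n => (-1) * dquo (-1 * e)
     (fun y => amul (f y) (fup (pv U) (arho U e) (am U e) y)) x n O)).
  - apply (pseries_scal (-1) t _ (fun n => dquo (-1 * e)
     (fun y => amul (f y) (fup (pv U) (arho U e) (am U e) y)) x n O)).
    apply (pseries_dquo (-1 * e) t x _ _ (fun y => amul (f y) (fup (pv U) (arho U e) (am U e) y)));
      [lra|apply Hp|apply Hp].
  - apply (pseries_dquo (1 * e) t x _ _ (fun y => amul (f y) (fum (pv U) (arho U e) (am U e) y)));
      [lra|apply Hm|apply Hm].
Qed.

Lemma gbd_aconv (T s M A mu : R) (phi : R -> R) (f : fld) :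
  kernel phi A -> (forall N, reg N f) -> gbd T s M f -> gbd T s M (aconv phi A mu f).
Proof.
  intros Hk Hr Hf x n k. apply cnv_le; [exact Hk| |intros y; apply Hf].
  intros y. apply (reg_continuous n f); [apply Hr|lia].
Qed.

Definition smooth_log (U : setup) (e t : R) : R -> R :=
  cnv (pphi U) (pA U) (pw e (pal U)) (fun y => ln (prho U e t y + pw e (pN U))).

(** The case [e = 0] is included: there the width of the kernel and [pw e (pN U)] both vanish, and
    [smooth_log] is the logarithm of the density. The ODE and the gas equations therefore share this
    computation. *)
Lemma Fm_potential_sum (U : setup) (e t x : R) :
  0 <= e < 1 -> Rabs t < tmax U ->
  is_pseries (fun n => amul (arho U e x)
    (adz (aconv (pphi U) (pA U) (pw e (pal U)) (fL (pw e (pN U)) (arho U e)) x)) n O) t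
    (prho U e t x * Derive (smooth_log U e t) x) /\
  ex_derive (smooth_log U e t) x.
Proof.
  intros He Ht. pose proof (TT_small U t Ht) as HTt. pose proof (Rabs_pos t).
  pose proof (TT_pos U) as HT. pose proof (SS_pos U) as HS. pose proof (bigM_ge U) as HM.
  destruct (sol_gbd U e He) as (Gr & _ & _ & _ & _ & _ & _ & GL).
  destruct (sol_reg U e He) as (_ & _ & _ & _ & _ & RL).
  assert (B := sums_basic U e t He Ht).
  set (fc := aconv (pphi U) (pA U) (pw e (pal U)) (fL (pw e (pN U)) (arho U e))) in *.
  assert (Gc : gbd (TT U) (SS U) (bigM U) fc) by (apply gbd_aconv; [apply h_ker|exact RL|exact GL]).
  assert (Rc : forall N, reg N fc) by (intros N; apply reg_aconv; [apply h_ker|apply RL]).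
  assert (Ec : forall y, fsum fc t y = smooth_log U e t y).
  { intros y. apply is_pseries_unique. unfold smooth_log.
    rewrite (cnv_ext _ _ (fsum (fL (pw e (pN U)) (arho U e)) t)).
    - apply (pseries_aconv _ _ _ (TT U) (SS U) (bigM U)); try assumption; try lra; apply h_ker.
    - intros z. symmetry. apply is_pseries_unique.
      destruct (B z) as (_ & _ & _ & _ & _ & Bz). exact Bz. }
  assert (D : is_derive (smooth_log U e t) x (fsum (fun y => adz (fc y)) t x)).
  { apply is_derive_ext with (fsum fc t); [exact Ec|].
    apply fsum_derive with (TT U) (SS U) (bigM U); try assumption; lra. }
  split; [|eexists; exact D].
  rewrite (is_derive_unique _ _ _ D).
  pose proof (gbd_adz (TT U) (SS U) (bigM U) fc HT HS ltac:(lra) Gc) as Gd.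
  apply (pseries_amul (TT U) (bigM U) (bigM U * SS U)); try lra.
  - apply (gbd_geom (TT U) (SS U)), Gr.
  - apply (gbd_geom (TT U) (2 * SS U) (bigM U * SS U) (fun y => adz (fc y))), Gd.
  - apply (proj1 (B x)).
  - apply (fsum_pseries (TT U) (2 * SS U) (bigM U * SS U) t x (fun y => adz (fc y))); try assumption; lra.
Qed.

Lemma sol_derive_x (U : setup) (e t x : R) :
  0 <= e < 1 -> Rabs t < tmax U ->
  is_derive (prho U e t) x (fsum (fun y => adz (arho U e y)) t x) /\
  is_derive (pmom U e t) x (fsum (fun y => adz (am U e y)) t x).
Proof.
  intros He Ht. pose proof (TT_small U t Ht) as HTt. pose proof (Rabs_pos t).
  pose proof (TT_pos U). pose proof (SS_pos U). pose proof (bigM_ge U).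
  destruct (sol_gbd U e He) as (Gr & Gm & _).
  destruct (sol_reg U e He) as (Rr & Rm & _).
  split; apply fsum_derive with (TT U) (SS U) (bigM U); try assumption; lra.
Qed.

Lemma sol_periodic (U : setup) (e t : R) :
  0 <= e < 1 -> periodic (prho U e t) /\ periodic (pmom U e t).
Proof.
  intros He. destruct (sol_reg U e He) as (Rr & Rm & _).
  split; intros x; apply PSeries_ext; intros n.
  - apply (Rr n n O (le_n _)).
  - apply (Rm n n O (le_n _)).
Qed.

Lemma sol_init (U : setup) (e x : R) : prho U e 0 x = pr U x /\ pmom U e 0 x = pm U x.
Proof.
  unfold prho, pmom, fsum. rewrite !PSeries_0. split; [apply arho_00|apply am_00].
Qed.

(** The termwise derivative has coefficients [(n + 1) f_{n+1}], which the recursions [arho_succ] and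
    [am_succ] identify with those of the right-hand side. *)
Lemma sol_derive_t (U : setup) (e t : R) :
  0 <= e < 1 -> Rabs t < tmax U ->
  is_derive_unif (prho U e) t (fsum (Frho U e (arho U e) (am U e)) t) /\
  is_derive_unif (pmom U e) t (fsum (Fm U e (arho U e) (am U e)) t).
Proof.
  intros He Ht. pose proof (TT_pos U) as HT.
  assert (E : 64 * TT U * tmax U = 1) by (unfold tmax; field; lra).
  destruct (sol_gbd U e He) as (Gr & Gm & _).
  assert (G : forall f F, (forall x n, INR (S n) * f x (S n) O = F x n O) ->
     gbd (TT U) (SS U) (bigM U) f -> is_derive_unif (fsum f) t (fsum F t)).
  { intros f F EF Gf.
    assert (D := fsum_derive_unif (TT U) (SS U) (bigM U) (tmax U) t f HT ltac:(lra) Ht Gf).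
    replace (fsum F t) with (fun x => PSeries (PS_derive (fun n => f x n O)) t); [exact D|].
    apply FunctionalExtensionality.functional_extensionality. intros x.
    apply PSeries_ext. intros n. apply EF. }
  split; [apply (G (arho U e)); [intros; apply arho_succ|exact Gr]
         |apply (G (am U e)); [intros; apply am_succ|exact Gm]].
Qed.

Lemma ode_solution_exists (U : setup) (e : R) :
  0 < e < 1 ->
  ode_solution (pK U) (pal U) (pbe U) (pN U) (pv U) (pphi U) (pr U) (pm U) e (tmax U)
    (prho U e) (pmom U e).
Proof.
  intros He. assert (He' : 0 <= e < 1) by lra.
  destruct (sol_gbd U e He') as (Gr & Gm & _).
  split.
  - intros t Ht. split; [|apply (proj1 (sol_periodic U e t He'))].
    intros x. apply ex_derive_cont. eexists. apply (proj1 (sol_derive_x U e t x He' Ht)).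
  - intros t Ht. split; [|apply (proj2 (sol_periodic U e t He'))].
    intros x. apply ex_derive_cont. eexists. apply (proj2 (sol_derive_x U e t x He' Ht)).
  - intros t x Ht. apply prho_pos; assumption.
  - intros t Ht. destruct (sol_derive_t U e t He' Ht) as [D _].
    replace (rhs_rho (pbe U) (pv U) e (prho U e t) (pmom U e t))
      with (fsum (Frho U e (arho U e) (am U e)) t); [exact D|].
    apply FunctionalExtensionality.functional_extensionality. intros x.
    apply is_pseries_unique. unfold rhs_rho. rewrite <- pw_pos by lra.
    rewrite <- (Rmult_1_r (pw e (pbe U))).
    apply (pseries_plus t _ _ (fun n => ftr (pv U) e (arho U e) (arho U e) (am U e) x n O)).
    + apply ftr_sum; try assumption. intros y. apply (proj1 (sums_basic U e t He' Ht y)).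
    + apply pseries_scal, pseries_aone.
  - intros t Ht. destruct (sol_derive_t U e t He' Ht) as [_ D].
    replace (rhs_m (pK U) (pal U) (pN U) (pv U) (pphi U) e (prho U e t) (pmom U e t))
      with (fsum (Fm U e (arho U e) (am U e)) t); [exact D|].
    apply FunctionalExtensionality.functional_extensionality. intros x.
    apply is_pseries_unique. unfold rhs_m.
    destruct (Fm_potential_sum U e t x He' Ht) as [HP HD].
    assert (ED : Derive (potential (pK U) (pal U) (pN U) (pphi U) e (prho U e t)) x
                 = pK U * Derive (smooth_log U e t) x).
    { rewrite <- Derive_scal. apply Derive_ext. intros y. unfold potential, smooth_log. f_equal.
      rewrite (pw_pos e (pal U)), (pw_pos e (pN U)) by lra.
      apply convolution_cnv; [apply h_ker|apply exp_pos|].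
      intros z. apply (continuous_comp (fun z => prho U e t z + Rpower e (pN U)) ln).
      - apply (continuous_plus (prho U e t) (fun _ => Rpower e (pN U))); [|apply continuous_const].
        apply ex_derive_cont. eexists. apply (proj1 (sol_derive_x U e t z He' Ht)).
      - apply ex_derive_cont. eexists. apply is_derive_ln.
        pose proof (prho_pos U e t z He' Ht).
        assert (0 < Rpower e (pN U)) by apply exp_pos. lra. }
    rewrite ED.
    replace (transport (pv U) e (fun y => prho U e t y * velocity (prho U e t) (pmom U e t) y)
        (velocity (prho U e t) (pmom U e t)) x - prho U e t x * (pK U * Derive (smooth_log U e t) x))
      with (transport (pv U) e (pmom U e t) (pu U e t) x
        + (- pK U) * (prho U e t x * Derive (smooth_log U e t) x)).
    + apply (pseries_plus t _ _ (fun n => ftr (pv U) e (am U e) (arho U e) (am U e) x n O)).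
      * apply ftr_sum; try assumption. intros y. apply (proj1 (proj2 (sums_basic U e t He' Ht y))).
      * apply pseries_scal. exact HP.
    + assert (EV : forall y, prho U e t y * velocity (prho U e t) (pmom U e t) y = pmom U e t y).
      { intros y. unfold velocity. field. pose proof (prho_pos U e t y He' Ht). lra. }
      unfold transport. rewrite !EV. fold (pu U e t). unfold pu. ring.
  - intros x. apply (proj1 (sol_init U e x)).
  - intros x. apply (proj2 (sol_init U e x)).
Qed.

Lemma sol_cvg (U : setup) (t : R) :
  Rabs t < tmax U ->
  cvg_unif (fun e => prho U e t) (prho U 0 t) /\ cvg_unif (fun e => pmom U e t) (pmom U 0 t).
Proof.
  intros Ht. pose proof (TT_small U t Ht) as HTt. pose proof (Rabs_pos t).
  pose proof (TT_pos U) as HT. pose proof (bigM_ge U) as HM.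
  assert (G : forall f : R -> fld, (forall e, 0 <= e < 1 -> gbd (TT U) (SS U) (bigM U) (f e)) ->
     (forall N, cok N f) -> cvg_unif (fun e => fsum (f e) t) (fsum (f 0) t)).
  { intros f Gf Cf P [eps HP]. pose proof (cond_pos eps) as Heps.
    assert (HN : exists N, bigM U * (/ 2) ^ N < eps / 4).
    { assert (L : is_lim_seq (fun n => bigM U * (/ 2) ^ n) 0).
      { evar_last; [apply is_lim_seq_scal_l, is_lim_seq_geom; rewrite Rabs_pos_eq; lra|].
        simpl. f_equal; ring. }
      apply is_lim_seq_spec in L. destruct (L (mkposreal (eps / 4) ltac:(lra))) as [N HN].
      exists N. specialize (HN N (le_n _)). simpl in HN. rewrite Rminus_0_r in HN.
      eapply Rle_lt_trans; [apply Rle_abs|exact HN]. }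
    destruct HN as [N HN].
    assert (C : ucb (fun e x => sum_f_R0 (fun n => f e x n O * t ^ n) N)).
    { apply (ucb_sum (fun n e x => f e x n O * t ^ n)). intros i Hi.
      apply ucb_ext with (fun e x => t ^ i * f e x i O); [intros; ring|].
      apply ucb_scal, (Cf i i O (le_n _)). }
    destruct C as [_ C]. destruct (C (eps / 4)) as [e0 [He0 HC]]; [lra|].
    exists (mkposreal e0 (proj1 He0)). intros e Hb Hpos. apply HP. intros x.
    change (Rabs (e - 0) < e0) in Hb. rewrite Rminus_0_r, Rabs_pos_eq in Hb by lra.
    change (Rabs (fsum (f e) t x - fsum (f 0) t x) < eps).
    specialize (HC e ltac:(lra) x). simpl in HC.
    assert (T1 := geom_PSeries_tail (bigM U) (TT U) t _ N HT (gbd_geom _ _ _ _ x (Gf e ltac:(lra))) ltac:(lra)).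
    assert (T2 := geom_PSeries_tail (bigM U) (TT U) t _ N HT (gbd_geom _ _ _ _ x (Gf 0 ltac:(lra))) ltac:(lra)).
    fold (fsum (f e) t x) in T1. fold (fsum (f 0) t x) in T2.
    set (A := sum_f_R0 (fun n => f e x n O * t ^ n) N) in *.
    set (B := sum_f_R0 (fun n => f 0 x n O * t ^ n) N) in *.
    replace (fsum (f e) t x - fsum (f 0) t x) with
      ((fsum (f e) t x - A) + ((A - B) + - (fsum (f 0) t x - B))) by ring.
    eapply Rle_lt_trans; [apply Rabs_triang|].
    pose proof (Rabs_triang (A - B) (- (fsum (f 0) t x - B))) as H3.
    rewrite Rabs_Ropp in H3. lra. }
  split.
  - apply (G (arho U)); [intros e He; apply (proj1 (sol_gbd U e He))|intros N; apply (proj1 (cok_sol U N))].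
  - apply (G (am U)); [intros e He; apply (proj1 (proj2 (sol_gbd U e He)))|intros N; apply (proj2 (cok_sol U N))].
Qed.

(** * Double series *)

Lemma tri_sum (b : nat -> nat -> R) (N : nat) :
  sum_f_R0 (fun n => sum_f_R0 (fun i => b i (n - i)%nat) n) N =
  sum_f_R0 (fun i => sum_f_R0 (b i) (N - i)) N.
Proof.
  induction N as [|N IH]; [reflexivity|].
  rewrite tech5, IH, (tech5 _ N), (tech5 (fun i => sum_f_R0 (b i) (S N - i))).
  rewrite Nat.sub_diag. simpl (sum_f_R0 (b (S N)) 0).
  rewrite <- Rplus_assoc, <- plus_sum. f_equal. apply sum_ext; intros i Hi.
  replace (S N - i)%nat with (S (N - i)) by lia. reflexivity.
Qed.

Lemma diag_bound (b : nat -> nat -> R) (C : R) (n : nat) :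
  (forall i j, Rabs (b i j) <= C * (/ 4) ^ (i + j)) ->
  sum_f_R0 (fun i => Rabs (b i (n - i)%nat)) n <= C * (/ 2) ^ n.
Proof.
  intros Hb.
  assert (HC : 0 <= C).
  { specialize (Hb O O). simpl in Hb. pose proof (Rabs_pos (b O O)). lra. }
  apply Rle_trans with (sum_f_R0 (fun _ => C * (/ 4) ^ n) n).
  - apply sum_Rle; intros i Hi. specialize (Hb i (n - i)%nat).
    replace (i + (n - i))%nat with n in Hb by lia. exact Hb.
  - rewrite sum_cte. pose proof (INR_S_le_pow2 n).
    replace (/ 4) with (/ 2 * / 2) by field. rewrite Rpow_mult_distr.
    pose proof (pow_lt (/ 2) n ltac:(lra)) as Hp.
    assert (E : 2 ^ n * (/ 2) ^ n = 1) by (rewrite <- Rpow_mult_distr, Rinv_r, pow1; lra).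
    replace (C * ((/ 2) ^ n * (/ 2) ^ n) * INR (S n)) with (C * (/ 2) ^ n * ((/ 2) ^ n * INR (S n))) by ring.
    rewrite <- (Rmult_1_r (C * (/ 2) ^ n)) at 2. apply Rmult_le_compat_l.
    + apply Rmult_le_pos; lra.
    + rewrite <- E, (Rmult_comm ((/ 2) ^ n)). apply Rmult_le_compat_r; lra.
Qed.

(** The triangle cuts row [i] at [N - i], at a cost of [C * 4^-i * 2^-(N-i) = C * 2^-N * 2^-i].
    Assuming the rate [/ 4] and concluding with [/ 2] makes these row errors summable. *)
Lemma diag_error (b : nat -> nat -> R) (e : nat -> R) (C : R) (N : nat) :
  (forall i j, Rabs (b i j) <= C * (/ 4) ^ (i + j)) ->
  (forall i, is_series (b i) (e i)) ->
  Rabs (sum_f_R0 e N - sum_f_R0 (fun n => sum_f_R0 (fun i => b i (n - i)%nat) n) N)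
    <= 2 * C * (/ 2) ^ N.
Proof.
  intros Hb He.
  assert (HC : 0 <= C).
  { specialize (Hb O O). simpl in Hb. pose proof (Rabs_pos (b O O)). lra. }
  rewrite tri_sum, <- sum_minus_distr.
  apply Rle_trans with (sum_f_R0 (fun i => C * (/ 2) ^ N * (/ 2) ^ i) N).
  - apply sum_abs_le; intros i Hi.
    replace (C * (/ 2) ^ N * (/ 2) ^ i) with (C * (/ 4) ^ i * (/ 2) ^ (N - i)).
    + apply is_series_tail; [apply He|]. intros j.
      eapply Rle_trans; [apply Hb|]. rewrite pow_add, <- Rmult_assoc.
      apply Rmult_le_compat_l.
      * apply Rmult_le_pos; [exact HC|apply pow_le; lra].
      * apply pow_incr; lra.
    + replace ((/ 2) ^ N) with ((/ 2) ^ i * (/ 2) ^ (N - i))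
        by (rewrite <- pow_add; f_equal; lia).
      replace (/ 4) with (/ 2 * / 2) by field. rewrite Rpow_mult_distr. ring.
  - rewrite sum_scal_l. pose proof (sum_half_pow N).
    apply Rle_trans with (C * (/ 2) ^ N * 2); [|right; ring].
    apply Rmult_le_compat_l; [|assumption].
    apply Rmult_le_pos; [exact HC|apply pow_le; lra].
Qed.

Lemma row_bound (b : nat -> nat -> R) (e : nat -> R) (C : R) (i : nat) :
  (forall i j, Rabs (b i j) <= C * (/ 4) ^ (i + j)) ->
  (forall i, is_series (b i) (e i)) -> Rabs (e i) <= 2 * C * (/ 4) ^ i.
Proof.
  intros Hb He. rewrite Rmult_assoc. apply (is_series_bound _ _ _ (He i)). intros j.
  assert (HC : 0 <= C).
  { specialize (Hb O O). simpl in Hb. pose proof (Rabs_pos (b O O)). lra. }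
  eapply Rle_trans; [apply Hb|]. rewrite pow_add, <- Rmult_assoc. apply Rmult_le_compat_l.
  - apply Rmult_le_pos; [exact HC|apply pow_le; lra].
  - apply pow_incr; lra.
Qed.

(** The forward direction assembles a double series from iterated Taylor expansions; the backward
    one extracts the rows of a given double series. *)
Lemma series_iter_diag (b : nat -> nat -> R) (e : nat -> R) (C l : R) :
  (forall i j, Rabs (b i j) <= C * (/ 4) ^ (i + j)) ->
  (forall i, is_series (b i) (e i)) ->
  (is_series e l <-> is_series (fun n => sum_f_R0 (fun i => b i (n - i)%nat) n) l).
Proof.
  intros Hb He.
  assert (HC : 0 <= C).
  { specialize (Hb O O). simpl in Hb. pose proof (Rabs_pos (b O O)). lra. }
  split; intros Hl; apply is_series_err with (4 * C); intros N;
    pose proof (diag_error b e C N Hb He) as H1;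
    pose proof (pow_lt (/ 2) N ltac:(lra)) as Hp;
    set (A := sum_f_R0 e N) in *;
    set (B := sum_f_R0 (fun n => sum_f_R0 (fun i => b i (n - i)%nat) n) N) in *.
  - assert (H2 : Rabs (l - A) <= 2 * C * (/ 2) ^ N).
    { apply is_series_tail; [exact Hl|]. intros n.
      eapply Rle_trans; [apply (row_bound b e C n Hb He)|].
      apply Rmult_le_compat_l; [lra|apply pow_incr; lra]. }
    replace (B - l) with (- ((A - B) + (l - A))) by ring. rewrite Rabs_Ropp.
    eapply Rle_trans; [apply Rabs_triang|lra].
  - assert (H2 : Rabs (l - B) <= C * (/ 2) ^ N).
    { apply is_series_tail; [exact Hl|]. intros n.
      eapply Rle_trans; [apply Rsum_abs|]. apply diag_bound, Hb. }
    replace (A - l) with ((A - B) + - (l - B)) by ring.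
    eapply Rle_trans; [apply Rabs_triang|]. rewrite Rabs_Ropp.
    assert (0 <= C * (/ 2) ^ N) by nra. lra.
Qed.

(** [F i j] plays the part of the mixed derivative of order [(i, j)] divided by [i! j!]. A Taylor
    expansion in [x] for each [i], then one in [t] at fixed [x], gives the iterated sum, which
    [series_iter_diag] regroups by total degree. *)
Lemma analytic2_at_family (F : nat -> nat -> R -> R -> R) (f : R -> R -> R)
    (t0 x0 d C r : R) :
  0 < d -> 0 < r ->
  (forall t x, Rabs (t - t0) < d -> f t x = F O O t x) ->
  (forall i j t x, Rabs (t - t0) < d ->
     is_derive (fun s => F i j s x) t (INR (S i) * F (S i) j t x) /\
     is_derive (F i j t) x (INR (S j) * F i (S j) t x) /\
     Rabs (F i j t x) <= C * r ^ (i + j)) ->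
  analytic2_at f t0 x0.
Proof.
  intros Hd Hr Hf HF. exists (fun i j => F i j t0 x0), (Rmin d (/ (4 * r))).
  assert (H4 : 0 < / (4 * r)) by (apply Rinv_0_lt_compat; lra).
  split; [apply Rmin_glb_lt; assumption|].
  intros s x Hs Hx term.
  assert (Hs1 : Rabs (s - t0) < d) by (eapply Rlt_le_trans; [exact Hs|apply Rmin_l]).
  assert (Hsm : forall z, Rabs z < Rmin d (/ (4 * r)) -> r * Rabs z <= / 4).
  { intros z Hz. assert (Hz' : Rabs z < / (4 * r)) by (eapply Rlt_le_trans; [exact Hz|apply Rmin_r]).
    apply Rmult_lt_compat_l with (r := r) in Hz'; [|exact Hr].
    replace (r * / (4 * r)) with (/ 4) in Hz' by (field; lra). lra. }
  assert (H00 : Rabs (t0 - t0) < d) by (rewrite Rminus_diag_eq, Rabs_R0 by reflexivity; exact Hd).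
  assert (HC : 0 <= C).
  { destruct (HF O O t0 x0 H00) as (_ & _ & H). simpl in H. pose proof (Rabs_pos (F O O t0 x0)). lra. }
  assert (HC' : forall i, 0 <= C * r ^ i) by (intros i; apply Rmult_le_pos; [exact HC|apply pow_le; lra]).
  assert (Hb : forall i j, Rabs (term i j) <= C * (/ 4) ^ (i + j)).
  { intros i j. unfold term. rewrite !Rabs_mult, <- !RPow_abs.
    destruct (HF i j t0 x0 H00) as (_ & _ & H). rewrite pow_add in H.
    apply Rle_trans with (C * (r ^ i * r ^ j) * Rabs (s - t0) ^ i * Rabs (x - x0) ^ j).
    - apply Rmult_le_compat_r; [apply pow_le, Rabs_pos|].
      apply Rmult_le_compat_r; [apply pow_le, Rabs_pos|exact H].
    - replace (C * (r ^ i * r ^ j) * Rabs (s - t0) ^ i * Rabs (x - x0) ^ j)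
        with (C * ((r * Rabs (s - t0)) ^ i * (r * Rabs (x - x0)) ^ j))
        by (rewrite !Rpow_mult_distr; ring).
      rewrite pow_add. apply Rmult_le_compat_l; [exact HC|].
      apply Rmult_le_compat; try (apply pow_le, Rmult_le_pos; [lra|apply Rabs_pos]);
        apply pow_incr; (split; [apply Rmult_le_pos; [lra|apply Rabs_pos]|apply Hsm; assumption]). }
  split.
  - apply (ex_series_le (V := R_CompleteNormedModule) _ (fun n => C * (/ 2) ^ n)).
    + intros n. rewrite sum_n_Reals.
      change (Rabs (sum_f_R0 (fun i => Rabs (term i (n - i)%nat)) n) <= C * (/ 2) ^ n).
      rewrite Rabs_pos_eq by (apply cond_pos_sum; intros; apply Rabs_pos).
      apply diag_bound, Hb.
    + apply (ex_series_scal (V := R_NormedModule) C). apply ex_series_geom. rewrite Rabs_pos_eq; lra.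
  - apply is_series_ext with (fun n => sum_f_R0 (fun i => term i (n - i)%nat) n);
      [intros n; symmetry; apply sum_n_Reals|].
    apply (series_iter_diag term (fun i => F i O t0 x * (s - t0) ^ i) C); [exact Hb| |].
    + intros i.
      assert (HT : is_series (fun j => F i j t0 x0 * (x - x0) ^ j) (F i O t0 x)).
      { apply (taylor_series (fun j => F i j t0) (C * r ^ i) r); [lra|apply Hsm, Hx|].
        intros j y _. destruct (HF i j t0 y H00) as (_ & H2 & H3). split; [exact H2|].
        rewrite Rmult_assoc, <- pow_add. exact H3. }
      apply is_series_ext with (fun j => scal ((s - t0) ^ i) (F i j t0 x0 * (x - x0) ^ j)).
      { intros j. unfold term, scal; simpl; unfold mult; simpl. ring. }
      rewrite Rmult_comm. apply (is_series_scal ((s - t0) ^ i) _ _ HT).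
    + rewrite (Hf s x Hs1).
      apply (taylor_series (fun i t => F i O t x) C r); [lra|apply Hsm, Hs|].
      intros i y Hy.
      assert (Hyd : Rabs (y - t0) < d).
      { eapply Rle_lt_trans; [|exact Hs1]. unfold Rmin, Rmax in Hy.
        destruct (Rle_dec t0 s); unfold Rabs; repeat destruct Rcase_abs; lra. }
      destruct (HF i O y x Hyd) as (H1 & _ & H3). split; [exact H1|].
      rewrite Nat.add_0_r in H3. exact H3.
Qed.

(** * The classical solution *)

(** The mixed Taylor coefficients are the columns of the field re-expanded at time [t]. Re-expansion
    doubles the rate; the radius [/ (16 * T)] about a time with [8 * T * Rabs t0 <= / 2] keeps
    [4 * T * Rabs t <= / 2]. *)
Lemma fsum_analytic2 (T s M t0 x0 : R) (f : fld) :
  0 < T -> 0 < s -> 0 <= M -> 8 * T * Rabs t0 <= / 2 -> gbd T s M f -> (forall N, reg N f) ->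
  analytic2_at (fsum f) t0 x0.
Proof.
  intros HT Hs HM Ht0 Hf Hr.
  set (r := 2 * T + 2 * s).
  assert (Hd : 0 < / (16 * T)) by (apply Rinv_0_lt_compat; lra).
  apply (analytic2_at_family (fun i j t x => shf (fun n => f x n j) i t) _ t0 x0
    (/ (16 * T)) (2 * M) r); [exact Hd|unfold r; lra| |].
  - intros t x _. symmetry. apply shf_0.
  - intros i j t x Ht.
    assert (Ht' : 4 * T * Rabs t <= / 2).
    { replace t with ((t - t0) + t0) by ring.
      pose proof (Rabs_triang (t - t0) t0) as H1.
      assert (H2 : T * Rabs (t - t0 + t0) <= T * (/ (16 * T) + Rabs t0))
        by (apply Rmult_le_compat_l; lra).
      replace (T * (/ (16 * T) + Rabs t0)) with (/ 16 + T * Rabs t0) in H2 by (field; lra).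
      lra. }
    assert (G : forall j y, geom (M * s ^ j) T (fun n => f y n j)).
    { intros l y n. specialize (Hf y n l). lra. }
    assert (Hsj : forall l, 0 <= s ^ l) by (intros; apply pow_le; lra).
    split; [|split].
    + apply (shf_derive (M * s ^ j) T); [exact HT|apply G|lra].
    + set (B := fun l => M * s ^ l * (2 * T) ^ i).
      assert (GB : forall l y, geom (B l) (2 * T) (fun n => W n i * f y (n + i)%nat l))
        by (intros l y; exact (shf_geom (M * s ^ l) T (fun n => f y n l) i HT (G l y))).
      assert (HB : forall l, 0 <= B l) by (intros l; unfold B; repeat apply Rmult_le_pos; try apply pow_le; lra || apply Hsj).
      assert (GL : forall a b u, a <= b -> geom a (2 * T) u -> geom b (2 * T) u).
      { intros a b u Hab Hu n. eapply Rle_trans; [apply Hu|].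
        apply Rmult_le_compat_r; [apply pow_le; lra|exact Hab]. }
      assert (GS : forall c a u, 0 <= c -> geom a (2 * T) u -> geom (c * a) (2 * T) (fun n => c * u n)).
      { intros c a u Hc Hu n. rewrite Rabs_mult, (Rabs_pos_eq c), Rmult_assoc by exact Hc.
        apply Rmult_le_compat_l; [exact Hc|apply Hu]. }
      pose proof (pos_INR (S j)) as HSj. pose proof (pos_INR (S (S j))) as HSSj.
      unfold shf at 2. rewrite <- PSeries_scal.
      rewrite (PSeries_ext (PS_scal (INR (S j)) (fun n => W n i * f x (n + i)%nat (S j)))
        (fun n => INR (S j) * (W n i * f x (n + i)%nat (S j)))) by reflexivity.
      apply (pseries_derive_param (fun n y => W n i * f y (n + i)%nat j)
        (fun n y => INR (S j) * (W n i * f y (n + i)%nat (S j)))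
        (fun n y => INR (S j) * (INR (S (S j)) * (W n i * f y (n + i)%nat (S (S j)))))
        (B j + INR (S j) * B (S j)) (INR (S j) * (INR (S (S j)) * B (S (S j)))) (2 * T) t x 1);
        [lra|lra|lra| |].
      * intros n y _. split.
        -- evar_last; [apply (is_derive_scal (fun y => f y (n + i)%nat j)), (Hr (n + i)%nat _ j (le_n _))|].
           unfold adz. ring.
        -- apply (is_derive_scal (fun y => W n i * f y (n + i)%nat (S j))).
           evar_last; [apply (is_derive_scal (fun y => f y (n + i)%nat (S j))), (Hr (n + i)%nat _ (S j) (le_n _))|].
           unfold adz. ring.
      * intros y _.
        assert (0 <= INR (S j) * B (S j)) by (apply Rmult_le_pos; [apply pos_INR|apply HB]).
        split; [|split].
        -- apply GL with (B j); [lra|apply GB].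
        -- apply GL with (INR (S j) * B (S j)); [pose proof (HB j); lra|apply GS; [exact HSj|apply GB]].
        -- apply GS; [exact HSj|]. apply GS; [exact HSSj|apply GB].
    + eapply Rle_trans; [apply (shf_bound (M * s ^ j) T); [exact HT|apply G|lra]|].
      rewrite pow_add.
      replace (2 * (M * s ^ j) * (2 * T) ^ i) with (2 * M * ((2 * T) ^ i * s ^ j)) by ring.
      apply Rmult_le_compat_l; [lra|].
      apply Rmult_le_compat; try (apply pow_le; lra); apply pow_incr; unfold r; lra.
Qed.

Lemma is_derive_unif_pt (f : R -> R -> R) (t x : R) (l : R -> R) :
  is_derive_unif f t l -> is_derive (fun s => f s x) t (l x).
Proof.
  intros H. apply is_derive_Reals. intros eps Heps.
  destruct (H (fun g => Rabs (g x - l x) < eps)) as [d Hd].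
  - exists (mkposreal eps Heps). intros g Hg. apply (Hg x).
  - exists d. intros h Hh Hhd. apply (Hd h); [|exact Hh].
    change (Rabs (h - 0) < d). rewrite Rminus_0_r. exact Hhd.
Qed.

(** At [e = 0] both quotients are derivatives, and [uplus - uminus = u] recombines them into that of
    the flux. *)
Lemma ftr0_sum (U : setup) (t x : R) (f : fld) (F : R -> R) :
  Rabs t < tmax U -> (forall N y, bd (tau U) (sigma U) N (bigM U) (f y)) -> (forall N, reg N f) ->
  (forall y, is_pseries (fun n => f y n O) t (F y)) ->
  is_pseries (fun n => ftr (pv U) 0 f (arho U 0) (am U 0) x n O) t
    (- Derive (fun y => F y * pu U 0 t y) x).
Proof.
  intros Ht Bf Rf HF. assert (He : 0 <= 0 < 1) by lra.
  pose proof (TT_small U t Ht) as HTt. pose proof (Rabs_pos t).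
  pose proof (TT_pos U) as HT. pose proof (SS_pos U) as HS. pose proof (bigM_ge U) as HM.
  assert (HTt2 : TT U * Rabs t <= / 2) by lra.
  assert (HMM : 0 <= bigM U * bigM U) by (apply Rmult_le_pos; lra).
  destruct (sol_gbd U 0 He) as (_ & _ & _ & _ & _ & Gup & Gum & _).
  destruct (sol_reg U 0 He) as (_ & _ & _ & Rup & Rum & _).
  assert (B := sums_basic U 0 t He Ht).
  assert (BB := fun N y => ball_bounds U 0 N _ _ He (ball_sol U 0 N He) y).
  assert (Gf : gbd (TT U) (SS U) (bigM U) f) by (apply bd_gbd; [lra|exact Bf]).
  set (gp := fun y => amul (f y) (fup (pv U) (arho U 0) (am U 0) y)).
  set (gm := fun y => amul (f y) (fum (pv U) (arho U 0) (am U 0) y)).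
  assert (Ggp : gbd (TT U) (SS U) (bigM U * bigM U) gp).
  { apply bd_gbd; [exact HMM|]. intros N y.
    apply bd_mul; [apply tau_pos|apply sigma_pos|lra|lra|apply Bf|apply (BB N y)]. }
  assert (Ggm : gbd (TT U) (SS U) (bigM U * bigM U) gm).
  { apply bd_gbd; [exact HMM|]. intros N y.
    apply bd_mul; [apply tau_pos|apply sigma_pos|lra|lra|apply Bf|apply (BB N y)]. }
  assert (Rgp : forall N, reg N gp) by (intros N; apply reg_mul; [apply Rf|apply Rup]).
  assert (Rgm : forall N, reg N gm) by (intros N; apply reg_mul; [apply Rf|apply Rum]).
  assert (Ep : forall y, fsum gp t y = F y * uplus (pv U) (pu U 0 t y)).
  { intros y. destruct (B y) as (_ & _ & _ & By & _ & _). apply is_pseries_unique.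
    exact (pseries_amul (TT U) (bigM U) (bigM U) t _ _ (f y) _ HT HTt2
      (gbd_geom _ _ _ _ y Gf) (gbd_geom _ _ _ _ y Gup) (HF y) By). }
  assert (Em : forall y, fsum gm t y = F y * uminus (pv U) (pu U 0 t y)).
  { intros y. destruct (B y) as (_ & _ & _ & _ & By & _). apply is_pseries_unique.
    exact (pseries_amul (TT U) (bigM U) (bigM U) t _ _ (f y) _ HT HTt2
      (gbd_geom _ _ _ _ y Gf) (gbd_geom _ _ _ _ y Gum) (HF y) By). }
  pose proof (fsum_derive _ _ _ t x gp HT HS HMM HTt2 Ggp Rgp) as Dp.
  pose proof (fsum_derive _ _ _ t x gm HT HS HMM HTt2 Ggm Rgm) as Dm.
  assert (D : is_derive (fun y => F y * pu U 0 t y) x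
     (fsum (fun y => adz (gp y)) t x - fsum (fun y => adz (gm y)) t x)).
  { apply is_derive_ext with (fun y => fsum gp t y - fsum gm t y).
    - intros y. rewrite Ep, Em. unfold uplus, uminus. simpl. field.
    - apply (is_derive_minus (fsum gp t) (fsum gm t)); assumption. }
  assert (ED : Derive (fun y => F y * pu U 0 t y) x =
    fsum (fun y => adz (gp y)) t x - fsum (fun y => adz (gm y)) t x)
    by (apply is_derive_unique, D).
  rewrite ED.
  assert (Sp : is_pseries (fun n => adz (gp x) n O) t (fsum (fun y => adz (gp y)) t x)).
  { apply (fsum_pseries (TT U) (2 * SS U) (bigM U * bigM U * SS U) t x (fun y => adz (gp y)));
      [exact HT|exact HTt2|]. apply gbd_adz; assumption. }
  assert (Sm : is_pseries (fun n => adz (gm x) n O) t (fsum (fun y => adz (gm y)) t x)).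
  { apply (fsum_pseries (TT U) (2 * SS U) (bigM U * bigM U * SS U) t x (fun y => adz (gm y)));
      [exact HT|exact HTt2|]. apply gbd_adz; assumption. }
  pose proof (pseries_plus _ _ _ _ _ (pseries_scal (-1) _ _ _ Sp) Sm) as H3.
  replace (- (fsum (fun y => adz (gp y)) t x - fsum (fun y => adz (gm y)) t x))
    with (-1 * fsum (fun y => adz (gp y)) t x + fsum (fun y => adz (gm y)) t x) by ring.
  apply is_pseries_ext with (2 := H3). intros n. unfold ftr, dquo.
  destruct (Req_EM_T (-1 * 0) 0) as [_|E]; [|exfalso; apply E; ring].
  destruct (Req_EM_T (1 * 0) 0) as [_|E]; [|exfalso; apply E; ring].
  reflexivity.
Qed.

Lemma classical_solution_exists (U : setup) :
  classical_solution (pK U) (pr U) (pm U) (tmax U) (prho U 0) (pmom U 0).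
Proof.
  assert (He : 0 <= 0 < 1) by lra.
  destruct (sol_gbd U 0 He) as (Gr & Gm & _).
  destruct (sol_reg U 0 He) as (Rr & Rm & _).
  pose proof (TT_pos U) as HT. pose proof (SS_pos U) as HS. pose proof (bigM_ge U) as HM.
  assert (BB := fun N y => ball_bounds U 0 N _ _ He (ball_sol U 0 N He) y).
  assert (An : forall t x f, Rabs t < tmax U -> gbd (TT U) (SS U) (bigM U) f ->
            (forall N, reg N f) -> analytic2_at (fsum f) t x).
  { intros t x f Ht Gf Rf. pose proof (TT_small U t Ht).
    apply fsum_analytic2 with (TT U) (SS U) (bigM U); try assumption; lra. }
  assert (Ev : forall t x, Rabs t < tmax U -> prho U 0 t x * pu U 0 t x = pmom U 0 t x).
  { intros t x Ht. unfold pu, velocity. field. pose proof (prho_pos U 0 t x He Ht). lra. }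
  split.
  - intros t x Ht. apply An; assumption.
  - intros t x Ht. apply An; assumption.
  - intros t _. apply (proj1 (sol_periodic U 0 t He)).
  - intros t _. apply (proj2 (sol_periodic U 0 t He)).
  - intros t x Ht. apply prho_pos; assumption.
  - intros t x Ht. destruct (sol_derive_t U 0 t He Ht) as [D _].
    assert (ED : Derive (fun s => prho U 0 s x) t = fsum (Frho U 0 (arho U 0) (am U 0)) t x)
      by (apply is_derive_unique, (is_derive_unif_pt _ t x _ D)).
    assert (E : fsum (Frho U 0 (arho U 0) (am U 0)) t x = - Derive (fun y => prho U 0 t y * pu U 0 t y) x).
    { apply is_pseries_unique.
      apply is_pseries_ext with (fun n => ftr (pv U) 0 (arho U 0) (arho U 0) (am U 0) x n O).
      { intros n. unfold Frho. rewrite pw_0. simpl. rewrite Rmult_0_l, Rplus_0_r. reflexivity. }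
      apply ftr0_sum; [exact Ht|intros N y; apply (BB N y)|exact Rr|].
      intros y. apply (proj1 (sums_basic U 0 t He Ht y)). }
    rewrite ED, E, (Derive_ext _ (pmom U 0 t)) by (intros y; apply Ev, Ht). ring.
  - intros t x Ht. destruct (sol_derive_t U 0 t He Ht) as [_ D].
    assert (ED : Derive (fun s => pmom U 0 s x) t = fsum (Fm U 0 (arho U 0) (am U 0)) t x)
      by (apply is_derive_unique, (is_derive_unif_pt _ t x _ D)).
    destruct (Fm_potential_sum U 0 t x He Ht) as [HP _].
    assert (E : fsum (Fm U 0 (arho U 0) (am U 0)) t x =
      - Derive (fun y => pmom U 0 t y * pu U 0 t y) x
      + (- pK U) * (prho U 0 t x * Derive (smooth_log U 0 t) x)).
    { apply is_pseries_unique.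
      apply (pseries_plus t _ _ (fun n => ftr (pv U) 0 (am U 0) (arho U 0) (am U 0) x n O)).
      - apply ftr0_sum; [exact Ht|intros N y; apply (BB N y)|exact Rm|].
        intros y. apply (proj1 (proj2 (sums_basic U 0 t He Ht y))).
      - apply pseries_scal. exact HP. }
    rewrite ED, E, Derive_scal.
    rewrite (Derive_ext (smooth_log U 0 t) (fun y => ln (prho U 0 t y))).
    2:{ intros y. unfold smooth_log. rewrite !pw_0, cnv_0 by apply h_ker. f_equal. ring. }
    rewrite (Derive_ext (fun y => prho U 0 t y * velocity (prho U 0 t) (pmom U 0 t) y ^ 2)
      (fun y => pmom U 0 t y * pu U 0 t y)).
    2:{ intros y. rewrite <- (Ev t y Ht). unfold pu. ring. }
    ring.
  - intros x. apply (proj1 (sol_init U 0 x)).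
  - intros x. apply (proj2 (sol_init U 0 x)).
Qed.

(** * Uniqueness for the regularized system *)

(** Connectedness of the segment from 0 to [t]: the supremum of the [l] for which [P] holds on
    [[0, l t]] is attained by closedness and cannot be below 1 by openness. Parametrising by [k * t]
    treats both signs of [t] at once. *)
Lemma interval_induction (T : R) (P : R -> Prop) :
  P 0 ->
  (forall t, Rabs t < T -> P t ->
     exists h, 0 < h /\ forall s, Rabs (s - t) < h -> Rabs s < T -> P s) ->
  (forall t, Rabs t < T ->
     (forall h, 0 < h -> exists s, Rabs (s - t) < h /\ Rabs s < T /\ P s) -> P t) ->
  forall t, Rabs t < T -> P t.
Proof.
  intros H0 Hopen Hclosed t Ht. pose proof (Rabs_pos t) as Ht0.
  set (E := fun l => 0 <= l <= 1 /\ forall k, 0 <= k <= l -> P (k * t)).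
  assert (E0 : E 0).
  { split; [lra|]. intros k Hk. replace (k * t) with 0 by (replace k with 0 by lra; ring). exact H0. }
  destruct (completeness E) as [l [Hub Hlub]].
  { exists 1. intros k [Hk _]. lra. }
  { exists 0. exact E0. }
  assert (Hl : 0 <= l <= 1).
  { split; [apply Hub, E0|]. apply Hlub. intros k [Hk _]. lra. }
  assert (Hin : forall k, 0 <= k <= 1 -> Rabs (k * t) < T).
  { intros k Hk. rewrite Rabs_mult, (Rabs_pos_eq k) by lra. nra. }
  assert (Hex : forall d, 0 < d -> exists k, E k /\ l - d < k).
  { intros d Hd. apply NNPP. intros Hn.
    assert (l <= l - d); [|lra]. apply Hlub. intros k Hk.
    destruct (Rle_dec k (l - d)) as [Hle|Hgt]; [exact Hle|].
    exfalso. apply Hn. exists k. split; [exact Hk|lra]. }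
  assert (Hlt : forall k, 0 <= k < l -> P (k * t)).
  { intros k Hk. destruct (Hex (l - k)) as [k' [[_ Hk'] Hkk]]; [lra|]. apply Hk'. lra. }
  assert (HPl : P (l * t)).
  { apply Hclosed; [apply Hin, Hl|]. intros h Hh.
    destruct (Hex (h / (Rabs t + 1))) as [k [[Hk HE] Hkl]]; [apply Rdiv_lt_0_compat; lra|].
    exists (k * t). split; [|split; [apply Hin, Hk|apply HE; lra]].
    replace (k * t - l * t) with (- ((l - k) * t)) by ring.
    assert (Hle : k <= l) by (apply Hub; split; assumption).
    rewrite Rabs_Ropp, Rabs_mult, (Rabs_pos_eq (l - k)) by lra.
    apply Rle_lt_trans with ((h / (Rabs t + 1)) * Rabs t); [nra|].
    assert (EQ : h / (Rabs t + 1) * (Rabs t + 1) = h) by (field; lra).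
    assert (0 < h / (Rabs t + 1)) by (apply Rdiv_lt_0_compat; lra). nra. }
  destruct (Req_dec l 1) as [->|Hne]; [rewrite Rmult_1_l in HPl; exact HPl|exfalso].
  destruct (Hopen (l * t) (Hin l Hl) HPl) as [h [Hh Hs]].
  set (d := Rmin (1 - l) (h / (2 * (Rabs t + 1)))).
  assert (Hd : 0 < d) by (apply Rmin_glb_lt; [lra|apply Rdiv_lt_0_compat; lra]).
  assert (Hd1 : d <= 1 - l) by apply Rmin_l.
  assert (Hd2 : d <= h / (2 * (Rabs t + 1))) by apply Rmin_r.
  assert (E (l + d)); [|specialize (Hub (l + d) H); lra].
  split; [lra|]. intros k Hk. destruct (Rlt_dec k l) as [Hkl|Hkl]; [apply Hlt; lra|].
  apply Hs; [|apply Hin; lra].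
  replace (k * t - l * t) with ((k - l) * t) by ring.
  rewrite Rabs_mult, (Rabs_pos_eq (k - l)) by lra.
  assert (EQ : h / (2 * (Rabs t + 1)) * (2 * (Rabs t + 1)) = h) by (field; lra). nra.
Qed.

(** * Lipschitz estimates on boxes where the density is bounded below *)

Definition lip (a b : R) (g : R -> R -> R) : Prop :=
  exists M L, 0 <= M /\ 0 <= L /\ forall r q r' q' D,
    a <= r <= b -> a <= r' <= b -> Rabs q <= b -> Rabs q' <= b ->
    Rabs (r - r') <= D -> Rabs (q - q') <= D ->
    Rabs (g r q) <= M /\ Rabs (g r q - g r' q') <= L * D.

Lemma lip_plus (a b : R) (g g' : R -> R -> R) :
  lip a b g -> lip a b g' -> lip a b (fun r q => g r q + g' r q).
Proof.
  intros (M & L & HM & HL & H) (M' & L' & HM' & HL' & H').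
  exists (M + M'), (L + L'). split; [lra|]. split; [lra|].
  intros r q r' q' D H1 H2 H3 H4 H5 H6.
  destruct (H r q r' q' D) as [A B]; try assumption.
  destruct (H' r q r' q' D) as [A' B']; try assumption. split.
  - eapply Rle_trans; [apply Rabs_triang|lra].
  - replace (g r q + g' r q - (g r' q' + g' r' q')) with ((g r q - g r' q') + (g' r q - g' r' q')) by ring.
    eapply Rle_trans; [apply Rabs_triang|lra].
Qed.

(** The bound that [lip] carries besides the Lipschitz constant is what makes products stay in the
    class. A single [D] for both increments suits the sup norm on pairs. *)
Lemma lip_mult (a b : R) (g g' : R -> R -> R) :
  lip a b g -> lip a b g' -> lip a b (fun r q => g r q * g' r q).
Proof.
  intros (M & L & HM & HL & H) (M' & L' & HM' & HL' & H').
  exists (M * M'), (M' * L + M * L'). split; [nra|]. split; [nra|].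
  intros r q r' q' D H1 H2 H3 H4 H5 H6.
  destruct (H r q r' q' D) as [A B]; try assumption.
  destruct (H' r q r' q' D) as [A' B']; try assumption.
  destruct (H r' q' r' q' 0) as [A2 _]; try assumption;
    try (rewrite Rminus_diag_eq, Rabs_R0 by reflexivity; lra).
  split.
  - rewrite Rabs_mult. apply Rmult_le_compat; try apply Rabs_pos; assumption.
  - replace (g r q * g' r q - g r' q' * g' r' q') with
      ((g r q - g r' q') * g' r q + g r' q' * (g' r q - g' r' q')) by ring.
    eapply Rle_trans; [apply Rabs_triang|]. rewrite !Rabs_mult.
    pose proof (Rabs_pos (g r q - g r' q')). pose proof (Rabs_pos (g' r q - g' r' q')).
    pose proof (Rabs_pos (g' r q)). pose proof (Rabs_pos (g r' q')).
    assert (0 <= L * D) by lra. assert (0 <= L' * D) by lra.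
    apply Rle_trans with (L * D * M' + M * (L' * D)); [|right; ring].
    apply Rplus_le_compat; apply Rmult_le_compat; assumption.
Qed.

Lemma lip_const (a b c : R) : lip a b (fun _ _ => c).
Proof.
  exists (Rabs c), 0. split; [apply Rabs_pos|]. split; [lra|].
  intros. rewrite Rminus_diag_eq, Rabs_R0 by reflexivity. split; lra.
Qed.

Lemma lip_fst (a b : R) : 0 < a <= b -> lip a b (fun r _ => r).
Proof.
  intros Hab. exists b, 1. split; [lra|]. split; [lra|]. intros.
  split; [rewrite Rabs_pos_eq; lra|lra].
Qed.

Lemma lip_snd (a b : R) : 0 < a <= b -> lip a b (fun _ q => q).
Proof.
  intros Hab. exists b, 1. split; [lra|]. split; [lra|]. intros. split; lra.
Qed.

Lemma lip_comp (a b lo hi C C' : R) (h h' : R -> R) (g : R -> R -> R) :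
  0 <= C -> 0 <= C' ->
  (forall y, lo <= y <= hi -> is_derive h y (h' y) /\ Rabs (h y) <= C /\ Rabs (h' y) <= C') ->
  (forall r q, a <= r <= b -> Rabs q <= b -> lo <= g r q <= hi) ->
  lip a b g -> lip a b (fun r q => h (g r q)).
Proof.
  intros HC HC' Hh Hg (M & L & HM & HL & H).
  exists C, (C' * L). split; [exact HC|]. split; [nra|].
  intros r q r' q' D H1 H2 H3 H4 H5 H6.
  pose proof (Hg r q H1 H3) as G1. pose proof (Hg r' q' H2 H4) as G2.
  destruct (H r q r' q' D) as [_ B]; try assumption.
  split; [apply Hh, G1|].
  apply Rle_trans with (C' * Rabs (g r q - g r' q')).
  - apply (mvt_lipschitz h h'). intros y Hy. split; apply Hh;
      unfold Rmin, Rmax in Hy; destruct (Rle_dec (g r' q') (g r q)); lra.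
  - rewrite Rmult_assoc. apply Rmult_le_compat_l; assumption.
Qed.

Lemma lip_inv (a b : R) : 0 < a <= b -> lip a b (fun r _ => / r).
Proof.
  intros Hab.
  assert (Hia : 0 < / a) by (apply Rinv_0_lt_compat; lra).
  apply (lip_comp a b a b (/ a) (/ a * / a) Rinv (fun y => - (/ y * / y)) (fun r _ => r)); try nra.
  - intros y Hy.
    assert (Hy1 : 0 < / y <= / a)
      by (split; [apply Rinv_0_lt_compat; lra|apply Rinv_le_contravar; lra]).
    split; [|split].
    + evar_last; [apply (is_derive_inv (fun y => y) y 1); [apply (is_derive_id (K := R_AbsRing) y)|lra]|].
      field. lra.
    + rewrite Rabs_pos_eq; lra.
    + rewrite Rabs_Ropp, Rabs_mult, Rabs_pos_eq by lra. apply Rmult_le_compat; lra.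
  - intros; lra.
  - apply lip_fst, Hab.
Qed.

Lemma lip_vel (a b : R) : 0 < a <= b -> lip a b (fun r q => q / r).
Proof.
  intros Hab. apply (lip_mult a b (fun _ q => q) (fun r _ => / r)); [apply lip_snd|apply lip_inv]; exact Hab.
Qed.

(** On the box the quotient [q / r] stays in a compact interval, where [tay_compact] bounds [v] and
    its first derivative. *)
Lemma lip_v (a b : R) (v : R -> R) : 0 < a <= b -> analytic v -> lip a b (fun r q => v (q / r)).
Proof.
  intros Hab Hv.
  destruct (lip_vel a b Hab) as (M & L & HM & HL & H).
  destruct (tay_compact v (- M) M Hv) as [C [HC HT]].
  apply (lip_comp a b (- M) M (C ^ 1) (C ^ 2) v (Derive v) (fun r q => q / r)).
  - apply pow_le; lra.
  - apply pow_le; lra.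
  - intros y Hy. split; [|split].
    + apply Derive_correct. apply (analytic_ex_derive_n v 1 y Hv).
    + rewrite <- (tay_0 v). apply (HT y Hy 0%nat).
    + specialize (HT y Hy 1%nat). unfold tay in HT. simpl in HT. rewrite Rdiv_1_r in HT. exact HT.
  - intros r q Hr Hq. destruct (H r q r q 0) as [B _]; try assumption;
      try (rewrite Rminus_diag_eq, Rabs_R0 by reflexivity; lra).
    apply Rabs_le_between, B.
  - apply lip_vel, Hab.
Qed.

Lemma lip_up (a b : R) (v : R -> R) :
  0 < a <= b -> analytic v ->
  lip a b (fun r q => uplus v (q / r)) /\ lip a b (fun r q => uminus v (q / r)).
Proof.
  intros Hab Hv. unfold uplus, uminus, Rdiv at 1 3. split.
  - apply (lip_mult a b (fun r q => v (q / r) + q / r) (fun _ _ => / 2)); [|apply lip_const].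
    apply (lip_plus a b (fun r q => v (q / r))); [apply lip_v|apply lip_vel]; assumption.
  - apply (lip_mult a b (fun r q => v (q / r) + - (q / r)) (fun _ _ => / 2)); [|apply lip_const].
    apply (lip_plus a b (fun r q => v (q / r)) (fun r q => - (q / r))); [apply lip_v; assumption|].
    destruct (lip_mult a b (fun _ _ => -1) (fun r q => q / r)) as (M & L & HM & HL & H);
      [apply lip_const|apply lip_vel, Hab|].
    exists M, L. split; [exact HM|]. split; [exact HL|].
    intros r q r' q' D H1 H2 H3 H4 H5 H6.
    replace (- (q / r)) with (-1 * (q / r)) by ring.
    replace (- (q' / r')) with (-1 * (q' / r')) by ring. apply H; assumption.
Qed.

Definition inbox (a b : R) (rho m : R -> R) : Prop :=
  forall x, a <= rho x <= b /\ Rabs (m x) <= b.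

(** The values at [x - e], [x] and [x + e] are each controlled by the sup norm of the differences.
    The constant contains [1 / e], which is harmless since uniqueness concerns one fixed [e]. *)
Lemma transport_lip (a b e : R) (v : R -> R) (g : R -> R -> R) :
  0 < a <= b -> analytic v -> lip a b g ->
  exists L, 0 <= L /\ forall rho m rho' m' D,
    inbox a b rho m -> inbox a b rho' m' ->
    (forall x, Rabs (rho x - rho' x) <= D) -> (forall x, Rabs (m x - m' x) <= D) ->
    forall x,
    Rabs (transport v e (fun y => g (rho y) (m y)) (velocity rho m) x) <= L /\
    Rabs (transport v e (fun y => g (rho y) (m y)) (velocity rho m) x
          - transport v e (fun y => g (rho' y) (m' y)) (velocity rho' m') x) <= L * D.
Proof.
  intros Hab Hv Hg. destruct (lip_up a b v Hab Hv) as [Lp Lm].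
  destruct (lip_mult a b g _ Hg Lp) as (M1 & L1 & HM1 & HL1 & H1).
  destruct (lip_mult a b g _ Hg (lip_v a b v Hab Hv)) as (M2 & L2 & HM2 & HL2 & H2).
  destruct (lip_mult a b g _ Hg Lm) as (M3 & L3 & HM3 & HL3 & H3).
  exists (Rabs (/ e) * (M1 + M2 + M3) + Rabs (/ e) * (L1 + L2 + L3)).
  pose proof (Rabs_pos (/ e)) as He.
  assert (P1 : 0 <= Rabs (/ e) * (M1 + M2 + M3)) by (apply Rmult_le_pos; lra).
  assert (P2 : 0 <= Rabs (/ e) * (L1 + L2 + L3)) by (apply Rmult_le_pos; lra).
  split; [lra|].
  intros rho m rho' m' D B B' Dr Dm x.
  assert (HD : 0 <= D) by (eapply Rle_trans; [apply Rabs_pos|apply (Dr 0)]).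
  assert (Q1 := fun y => H1 (rho y) (m y) (rho' y) (m' y) D (proj1 (B y)) (proj1 (B' y))
                 (proj2 (B y)) (proj2 (B' y)) (Dr y) (Dm y)).
  assert (Q2 := fun y => H2 (rho y) (m y) (rho' y) (m' y) D (proj1 (B y)) (proj1 (B' y))
                 (proj2 (B y)) (proj2 (B' y)) (Dr y) (Dm y)).
  assert (Q3 := fun y => H3 (rho y) (m y) (rho' y) (m' y) D (proj1 (B y)) (proj1 (B' y))
                 (proj2 (B y)) (proj2 (B' y)) (Dr y) (Dm y)).
  clear H1 H2 H3.
  destruct (Q1 (x - e)) as [A1 C1]. destruct (Q2 x) as [A2 C2]. destruct (Q3 (x + e)) as [A3 C3].
  unfold transport, velocity.
  set (p1 := g (rho (x - e)) (m (x - e)) * uplus v (m (x - e) / rho (x - e))) in *.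
  set (p2 := g (rho x) (m x) * v (m x / rho x)) in *.
  set (p3 := g (rho (x + e)) (m (x + e)) * uminus v (m (x + e) / rho (x + e))) in *.
  set (q1 := g (rho' (x - e)) (m' (x - e)) * uplus v (m' (x - e) / rho' (x - e))) in *.
  set (q2 := g (rho' x) (m' x) * v (m' x / rho' x)) in *.
  set (q3 := g (rho' (x + e)) (m' (x + e)) * uminus v (m' (x + e) / rho' (x + e))) in *.
  assert (T3 : forall u v w a1 a2 a3, Rabs u <= a1 -> Rabs v <= a2 -> Rabs w <= a3 ->
            Rabs (u - v + w) <= a1 + a2 + a3).
  { intros u w z a1 a2 a3 Hu Hw Hz. apply Rabs_le_between in Hu, Hw, Hz. apply Rabs_le. lra. }
  split.
  - rewrite Rabs_mult. apply Rle_trans with (Rabs (/ e) * (M1 + M2 + M3)); [|lra].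
    apply Rmult_le_compat_l; [exact He|]. apply T3; assumption.
  - replace (/ e * (p1 - p2 + p3) - / e * (q1 - q2 + q3))
      with (/ e * ((p1 - q1) - (p2 - q2) + (p3 - q3))) by ring.
    rewrite Rabs_mult. apply Rle_trans with (Rabs (/ e) * (L1 * D + L2 * D + L3 * D)).
    + apply Rmult_le_compat_l; [exact He|]. apply T3; assumption.
    + nra.
Qed.

(** With the derivative falling on the kernel, [f] need only be continuous. *)
Lemma cnv_derive_kernel (phi f : R -> R) (A mu x : R) :
  kernel phi A -> 0 < mu -> (forall y, continuous f y) ->
  is_derive (cnv phi A mu f) x
    (RInt (fun y => f y * (/ mu * (/ mu * Derive phi ((x - y) / mu))))
      (x - (mu * A + 1)) (x + (mu * A + 1))).
Proof.
  intros Hk Hmu Hf. pose proof (kernel_A _ _ Hk) as HA. assert (HmA : 0 < mu * A) by nra.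
  (* The unit margin keeps the support of the kernel around [x'] inside a fixed interval as long as
     [x'] is within 1 of [x], so that the limits of integration do not move with [x']. *)
  set (B := mu * A + 1).
  assert (Hphi : forall y, continuous phi y)
    by (intros; apply ex_derive_cont, (kernel_derive _ _ Hk)).
  assert (Hcx : forall x' y, continuous (fun y => f y * (/ mu * phi ((x' - y) / mu))) y).
  { intros x' y. apply (continuous_mult f (fun y => / mu * phi ((x' - y) / mu))); [apply Hf|].
    apply (continuous_mult (fun _ => / mu) (fun y => phi ((x' - y) / mu))); [apply continuous_const|].
    apply (continuous_comp (fun y => (x' - y) / mu) phi); [|apply Hphi].
    apply ex_derive_cont. auto_derive. exact I. }
  apply is_derive_ext_loc with
    (fun x' => RInt (fun y => f y * (/ mu * phi ((x' - y) / mu))) (x - B) (x + B)).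
  { exists (mkposreal 1 Rlt_0_1). intros x' Hx'. change (Rabs (x' - x) < 1) in Hx'.
    apply Rabs_lt_between in Hx'.
    assert (Z : forall c d, (forall y, Rmin c d < y < Rmax c d -> mu * A <= Rabs (x' - y)) ->
       is_RInt (fun y => f y * (/ mu * phi ((x' - y) / mu))) c d 0).
    { intros c d Hcd. apply is_RInt_ext with (fun _ => 0).
      - intros y Hy. rewrite (kernel_support _ _ Hk); [simpl; ring|].
        unfold Rdiv. rewrite Rabs_mult, Rabs_inv, (Rabs_pos_eq mu) by lra.
        apply Rmult_le_reg_r with mu; [exact Hmu|].
        rewrite Rmult_assoc, Rinv_l, Rmult_1_r, Rmult_comm by lra. apply Hcd, Hy.
      - evar_last; [apply (is_RInt_const c d 0)|]. unfold scal; simpl; unfold mult; simpl; ring. }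
    apply is_RInt_unique.
    assert (Mid : is_RInt (fun y => f y * (/ mu * phi ((x' - y) / mu)))
       (x' - mu * A) (x' + mu * A) (cnv phi A mu f x')).
    { evar_last.
      - apply is_RInt_ext with (fun y => scal (- / mu)
           (- (phi (- / mu * y + x' / mu) * f (x' - mu * (- / mu * y + x' / mu))))).
        + intros y _. unfold scal; simpl; unfold mult; simpl.
          replace (x' - mu * (- / mu * y + x' / mu)) with y by (field; lra).
          replace (- / mu * y + x' / mu) with ((x' - y) / mu) by (field; lra). ring.
        + apply (is_RInt_comp_lin (fun z => - (phi z * f (x' - mu * z))) (- / mu) (x' / mu)).
          replace (- / mu * (x' - mu * A) + x' / mu) with A by (field; lra).
          replace (- / mu * (x' + mu * A) + x' / mu) with (- A) by (field; lra).
          apply (is_RInt_opp (fun z => phi z * f (x' - mu * z))).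
          apply (is_RInt_swap (V := R_NormedModule) (fun z => phi z * f (x' - mu * z))).
          apply (RInt_correct (fun z => phi z * f (x' - mu * z))).
          apply ex_RInt_kernel_prod; assumption.
      - unfold cnv, opp; simpl. ring. }
    evar_last.
    { apply (is_RInt_Chasles (V := R_NormedModule) _ (x - B) (x' + mu * A) (x + B)
        (plus 0 (cnv phi A mu f x')) 0);
        [apply (is_RInt_Chasles (V := R_NormedModule) _ (x - B) (x' - mu * A) (x' + mu * A) 0);
           [|exact Mid]|].
      - apply Z. intros y Hy. unfold B in Hy. rewrite Rmin_left, Rmax_right in Hy by lra.
        rewrite Rabs_pos_eq; lra.
      - apply Z. intros y Hy. unfold B in Hy. rewrite Rmin_left, Rmax_right in Hy by lra.
        rewrite Rabs_left; lra. }
    unfold plus; simpl; ring. }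
  assert (D : forall y u, is_derive (fun x' => f y * (/ mu * phi ((x' - y) / mu))) u
            (f y * (/ mu * (/ mu * Derive phi ((u - y) / mu))))).
  { intros y u. apply (is_derive_scal (fun x' => / mu * phi ((x' - y) / mu))).
    apply (is_derive_scal (fun x' => phi ((x' - y) / mu))).
    apply (is_derive_comp phi (fun x' => (x' - y) / mu)).
    - apply Derive_correct, (kernel_derive _ _ Hk).
    - auto_derive; [exact I|]. field. lra. }
  evar_last.
  - apply (is_derive_RInt_param (fun x' y => f y * (/ mu * phi ((x' - y) / mu))) (x - B) (x + B) x).
    + apply filter_forall. intros u y _. eexists; apply D.
    + intros y _. apply continuity_2d_pt_ext with
        (fun u w => f w * (/ mu * (/ mu * Derive phi ((u - w) * / mu)))).
      { intros u w; symmetry; apply is_derive_unique, D. }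
      apply continuity_2d_pt_mult;
        [|apply continuity_2d_pt_mult; [apply continuity_2d_pt_const|
           apply continuity_2d_pt_mult; [apply continuity_2d_pt_const|]]].
      * apply (continuity_1d_2d_pt_comp f (fun u w => w)); [|apply continuity_2d_pt_id2].
        apply continuity_pt_filterlim, Hf.
      * apply (continuity_1d_2d_pt_comp (Derive phi) (fun u w => (u - w) * / mu)).
        -- apply continuity_pt_filterlim, ex_derive_cont, (kernel_derive2 _ _ Hk).
        -- apply continuity_2d_pt_mult; [|apply continuity_2d_pt_const].
           apply continuity_2d_pt_minus; [apply continuity_2d_pt_id1|apply continuity_2d_pt_id2].
    + apply filter_forall. intros u.
      apply (ex_RInt_continuous (fun y => f y * (/ mu * phi ((u - y) / mu)))). intros; apply Hcx.
  - apply RInt_ext. intros y _. apply is_derive_unique, D.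
Qed.

(** A competing solution of the ODE is only known to be continuous in [x], so the derivative in the
    force term must be borne by the kernel. The constant depends on [mu], hence on [e]. *)
Lemma cnv_Derive_lip (phi : R -> R) (A mu : R) :
  kernel phi A -> 0 < mu ->
  exists C, 0 <= C /\ forall f g D, (forall y, continuous f y) -> (forall y, continuous g y) ->
    (forall y, Rabs (f y - g y) <= D) -> forall x,
    Rabs (Derive (cnv phi A mu f) x - Derive (cnv phi A mu g) x) <= C * D.
Proof.
  intros Hk Hmu. pose proof (kernel_A _ _ Hk) as HA. assert (HmA : 0 < mu * A) by nra.
  set (B := mu * A + 1).
  assert (Hd : forall y, continuous (Derive phi) y)
    by (intros; apply ex_derive_cont, (kernel_derive2 _ _ Hk)).
  destruct (continuous_compact_bound (Derive phi) (- (B / mu)) (B / mu)) as [M [HM H]];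
    [intros; apply Hd|].
  assert (Him : 0 < / mu) by (apply Rinv_0_lt_compat, Hmu).
  assert (HB : 0 < B) by (unfold B; lra).
  exists (2 * B * (/ mu * (/ mu * M))). split.
  { apply Rmult_le_pos; [lra|]. repeat apply Rmult_le_pos; lra. }
  intros f g D Hf Hg HD x.
  rewrite (is_derive_unique _ _ _ (cnv_derive_kernel phi f A mu x Hk Hmu Hf)).
  rewrite (is_derive_unique _ _ _ (cnv_derive_kernel phi g A mu x Hk Hmu Hg)).
  fold B.
  assert (Hc : forall h, (forall y, continuous h y) -> forall y,
    continuous (fun y => h y * (/ mu * (/ mu * Derive phi ((x - y) / mu)))) y).
  { intros h Hh y. apply (continuous_mult h); [apply Hh|].
    apply (continuous_mult (fun _ => / mu)); [apply continuous_const|].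
    apply (continuous_mult (fun _ => / mu)); [apply continuous_const|].
    apply (continuous_comp (fun y => (x - y) / mu) (Derive phi)); [|apply Hd].
    apply ex_derive_cont. auto_derive. exact I. }
  rewrite <- (RInt_minus (V := R_CompleteNormedModule))
    by (apply (ex_RInt_continuous (V := R_CompleteNormedModule)); intros; apply Hc; assumption).
  replace (2 * B * (/ mu * (/ mu * M)) * D)
    with ((x + B - (x - B)) * (D * (/ mu * (/ mu * M)))) by ring.
  apply abs_RInt_le_const; [lra| |].
  - apply (ex_RInt_minus (V := R_NormedModule));
      apply (ex_RInt_continuous (V := R_CompleteNormedModule)); intros; apply Hc; assumption.
  - intros y Hy.
    unfold minus, plus, opp; simpl.
    replace (f y * (/ mu * (/ mu * Derive phi ((x - y) / mu))) +
      - (g y * (/ mu * (/ mu * Derive phi ((x - y) / mu)))))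
      with ((f y - g y) * (/ mu * (/ mu * Derive phi ((x - y) / mu)))) by ring.
    rewrite !Rabs_mult, (Rabs_pos_eq (/ mu)) by lra.
    assert (Hr : Rabs (Derive phi ((x - y) / mu)) <= M).
    { apply H. assert (E : B / mu = B * / mu) by reflexivity.
      unfold Rdiv. split.
      - replace (- (B * / mu)) with (- B * / mu) by ring. apply Rmult_le_compat_r; lra.
      - apply Rmult_le_compat_r; lra. }
    apply Rmult_le_compat; try apply Rabs_pos.
    + repeat apply Rmult_le_pos; try lra. apply Rabs_pos.
    + apply HD.
    + apply Rmult_le_compat_l; [lra|]. apply Rmult_le_compat_l; [lra|exact Hr].
Qed.

Lemma lip_ln (a b c : R) : 0 < a <= b -> 0 < c -> lip a b (fun r _ => ln (r + c)).
Proof.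
  intros Hab Hc.
  assert (D : forall y, a <= y <= b -> is_derive (fun y => ln (y + c)) y (/ (y + c))).
  { intros y Hy. apply (is_derive_shift ln c). apply is_derive_ln. lra. }
  destruct (continuous_compact_bound (fun y => ln (y + c)) a b) as [C [HC HB]].
  { intros y Hy. apply ex_derive_cont. eexists; apply D, Hy. }
  assert (Hia : 0 < / a) by (apply Rinv_0_lt_compat; lra).
  apply (lip_comp a b a b C (/ a) (fun y => ln (y + c)) (fun y => / (y + c)) (fun r _ => r)); try lra.
  - intros y Hy. split; [apply D, Hy|split; [apply HB, Hy|]].
    rewrite Rabs_pos_eq by (left; apply Rinv_0_lt_compat; lra).
    apply Rinv_le_contravar; lra.
  - intros; lra.
  - apply lip_fst, Hab.
Qed.

Lemma ln_shift_continuous (rho : R -> R) (c : R) :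
  0 < c -> in_CT rho -> (forall x, 0 < rho x) -> forall x, continuous (fun y => ln (rho y + c)) x.
Proof.
  intros Hc [Hr _] Hp x. apply (continuous_comp (fun z => rho z + c) ln).
  - apply (continuous_plus rho (fun _ => c)); [apply Hr|apply continuous_const].
  - apply ex_derive_cont. eexists. apply is_derive_ln. specialize (Hp x). lra.
Qed.

Lemma Derive_potential (K alpha N e A : R) (phi rho : R -> R) (x : R) :
  kernel phi A -> in_CT rho -> (forall x, 0 < rho x) ->
  Derive (potential K alpha N phi e rho) x =
  K * Derive (cnv phi A (Rpower e alpha) (fun y => ln (rho y + Rpower e N))) x.
Proof.
  intros Hk Hr Hp. rewrite <- Derive_scal. apply Derive_ext. intros y. unfold potential. f_equal.
  apply convolution_cnv; [exact Hk|apply exp_pos|].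
  apply ln_shift_continuous; [apply exp_pos|assumption..].
Qed.

Lemma rhs_lip (K alpha beta N e A a b : R) (v phi : R -> R) :
  0 < a <= b -> analytic v -> kernel phi A ->
  exists L, 0 <= L /\ forall rho m rho' m' D,
    in_CT rho -> in_CT rho' -> inbox a b rho m -> inbox a b rho' m' ->
    (forall x, Rabs (rho x - rho' x) <= D) -> (forall x, Rabs (m x - m' x) <= D) ->
    forall x,
    Rabs (rhs_rho beta v e rho m x) <= L /\
    Rabs (rhs_m K alpha N v phi e rho m x) <= L /\
    Rabs (rhs_rho beta v e rho m x - rhs_rho beta v e rho' m' x) <= L * D /\
    Rabs (rhs_m K alpha N v phi e rho m x - rhs_m K alpha N v phi e rho' m' x) <= L * D.
Proof.
  intros Hab Hv Hk.
  destruct (transport_lip a b e v (fun r _ => r) Hab Hv (lip_fst a b Hab)) as [L1 [HL1 T1]].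
  destruct (transport_lip a b e v (fun r q => r * (q / r)) Hab Hv) as [L2 [HL2 T2]].
  { apply (lip_mult a b (fun r _ => r) (fun r q => q / r)); [apply lip_fst|apply lip_vel]; exact Hab. }
  set (c := Rpower e N). assert (Hc : 0 < c) by apply exp_pos.
  destruct (lip_ln a b c Hab Hc) as (M3 & L3 & HM3 & HL3 & T3).
  destruct (cnv_Derive_lip phi A (Rpower e alpha) Hk (exp_pos _)) as [C [HC T4]].
  set (g := fun rho : R -> R => cnv phi A (Rpower e alpha) (fun y => ln (rho y + c))).
  pose proof (Rabs_pos K) as HK. pose proof (Rabs_pos (Rpower e beta)) as Hbe.
  set (L := (L1 + Rabs (Rpower e beta)) + (L2 + b * (Rabs K * (C * M3)))
            + (1 * (Rabs K * (C * M3)) + b * (Rabs K * (C * L3)))).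
  assert (Q0 : 0 <= Rabs K * (C * M3)) by (repeat apply Rmult_le_pos; assumption).
  assert (Q1 : 0 <= Rabs K * (C * L3)) by (repeat apply Rmult_le_pos; assumption).
  assert (Q2 : 0 <= b * (Rabs K * (C * M3))) by (apply Rmult_le_pos; lra).
  assert (Q3 : 0 <= b * (Rabs K * (C * L3))) by (apply Rmult_le_pos; lra).
  exists L. split; [unfold L; lra|].
  intros rho m rho' m' D Cr Cr' B B' Dr Dm x.
  assert (HD : 0 <= D) by (eapply Rle_trans; [apply Rabs_pos|apply (Dr 0)]).
  assert (Pr : forall x, 0 < rho x) by (intros y; destruct (B y); lra).
  assert (Pr' : forall x, 0 < rho' x) by (intros y; destruct (B' y); lra).
  destruct (T1 rho m rho' m' D B B' Dr Dm x) as [A1 A2].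
  destruct (T2 rho m rho' m' D B B' Dr Dm x) as [A3 A4].
  change (fun y => (fun r _ : R => r) (rho y) (m y)) with (fun y => rho y) in *.
  unfold rhs_rho, rhs_m.
  rewrite !(Derive_potential K alpha N e A) by assumption. fold c. fold (g rho). fold (g rho').
  assert (G : Rabs (Derive (g rho) x - Derive (g rho') x) <= C * (L3 * D)).
  { apply T4; [apply ln_shift_continuous; assumption|apply ln_shift_continuous; assumption|].
    intros y. apply (T3 (rho y) (m y) (rho' y) (m' y) D); try apply B; try apply B'; auto. }
  (* The bound is the Lipschitz estimate taken against the zero function, whose smoothing is
     zero. *)
  assert (G0 : Rabs (Derive (g rho) x) <= C * M3).
  { replace (Derive (g rho) x) with (Derive (g rho) x - Derive (cnv phi A (Rpower e alpha) (fun _ => 0)) x).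
    - apply T4; [apply ln_shift_continuous; assumption|intros; apply continuous_const|].
      intros y. rewrite Rminus_0_r.
      apply (T3 (rho y) (m y) (rho' y) (m' y) D); try apply B; try apply B'; auto.
    - rewrite (Derive_ext (cnv phi A (Rpower e alpha) (fun _ => 0)) (fun _ => 0))
        by (intros; apply cnv_const, Hk).
      rewrite Derive_const. ring. }
  set (p := Derive (g rho) x) in *. set (p' := Derive (g rho') x) in *.
  assert (Hr : Rabs (rho x) <= b) by (destruct (B x); rewrite Rabs_pos_eq; lra).
  assert (Hr' : Rabs (rho' x) <= b) by (destruct (B' x); rewrite Rabs_pos_eq; lra).
  assert (KP : Rabs (K * p) <= Rabs K * (C * M3))
    by (rewrite Rabs_mult; apply Rmult_le_compat_l; assumption).
  assert (LD : 0 <= L1 * D /\ 0 <= L2 * D) by (split; apply Rmult_le_pos; assumption).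
  assert (ED : L * D = L1 * D + L2 * D + Rabs (Rpower e beta) * D + b * (Rabs K * (C * M3)) * D
      + (Rabs K * (C * M3)) * D + b * (Rabs K * (C * L3)) * D) by (unfold L; ring).
  assert (QD : 0 <= Rabs (Rpower e beta) * D /\ 0 <= b * (Rabs K * (C * M3)) * D
      /\ 0 <= (Rabs K * (C * M3)) * D /\ 0 <= b * (Rabs K * (C * L3)) * D)
    by (repeat split; apply Rmult_le_pos; assumption).
  split; [|split; [|split]].
  - eapply Rle_trans; [apply Rabs_triang|].
    apply Rle_trans with (L1 + Rabs (Rpower e beta)); [|unfold L; lra].
    apply Rplus_le_compat_r. exact A1.
  - unfold Rminus. eapply Rle_trans; [apply Rabs_triang|]. rewrite Rabs_Ropp, (Rabs_mult (rho x)).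
    apply Rle_trans with (L2 + b * (Rabs K * (C * M3))); [|unfold L; lra].
    apply Rplus_le_compat; [exact A3|].
    apply Rmult_le_compat; try apply Rabs_pos; assumption.
  - match goal with |- Rabs (?u + ?w - (?u' + ?w)) <= _ =>
      replace (u + w - (u' + w)) with (u - u') by ring end.
    eapply Rle_trans; [exact A2|]. lra.
  - match goal with |- Rabs (?u - ?s - (?u' - ?s')) <= _ =>
      replace (u - s - (u' - s')) with ((u - u') + - (s - s')) by ring;
      set (w := u - u') in * end.
    replace (rho x * (K * p) - rho' x * (K * p')) with
      ((rho x - rho' x) * (K * p) + rho' x * (K * (p - p'))) by ring.
    eapply Rle_trans; [apply Rabs_triang|]. rewrite Rabs_Ropp.
    assert (E1 : Rabs ((rho x - rho' x) * (K * p)) <= D * (Rabs K * (C * M3))).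
    { rewrite Rabs_mult. apply Rmult_le_compat; try apply Rabs_pos; [apply Dr|exact KP]. }
    assert (E2 : Rabs (rho' x * (K * (p - p'))) <= b * (Rabs K * (C * (L3 * D)))).
    { rewrite !Rabs_mult. apply Rmult_le_compat; try apply Rabs_pos; [|exact Hr'|].
      - apply Rmult_le_pos; apply Rabs_pos.
      - apply Rmult_le_compat_l; assumption. }
    pose proof (Rabs_triang ((rho x - rho' x) * (K * p)) (rho' x * (K * (p - p')))) as E3.
    assert (E4 : Rabs w <= L2 * D) by exact A4.
    assert (E5 : D * (Rabs K * (C * M3)) = Rabs K * (C * M3) * D) by ring.
    assert (E6 : b * (Rabs K * (C * (L3 * D))) = b * (Rabs K * (C * L3)) * D) by ring.
    lra.
Qed.

(** Differentiability in the sup norm gives one time step valid for all [x], which is what keeps a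
    solution in a common box for a short time. *)
Lemma derive_unif_near (f : R -> R -> R) (t L : R) (l : R -> R) :
  is_derive_unif f t l -> (forall x, Rabs (l x) <= L) ->
  exists d, 0 < d /\ forall s, Rabs (s - t) < d -> forall x,
    Rabs (f s x - f t x) <= (L + 1) * Rabs (s - t).
Proof.
  intros H HL.
  destruct (H (fun g => forall x, Rabs (g x - l x) < 1)) as [d Hd].
  { exists (mkposreal 1 Rlt_0_1). intros g Hg x. apply (Hg x). }
  exists d. split; [apply cond_pos|]. intros s Hs x.
  destruct (Req_dec s t) as [->|Hne].
  - rewrite !Rminus_diag_eq, Rabs_R0 by reflexivity. lra.
  - assert (Hst : s - t <> 0) by lra.
    assert (Hq := Hd (s - t)). specialize (HL x).
    assert (Hq1 : Rabs ((f (t + (s - t)) x - f t x) / (s - t) - l x) < 1).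
    { apply Hq; [|exact Hst]. change (Rabs (s - t - 0) < d). rewrite Rminus_0_r. exact Hs. }
    replace (t + (s - t)) with s in Hq1 by ring.
    replace (f s x - f t x) with ((((f s x - f t x) / (s - t) - l x) + l x) * (s - t))
      by (field; exact Hst).
    rewrite Rabs_mult. apply Rmult_le_compat_r; [apply Rabs_pos|].
    eapply Rle_trans; [apply Rabs_triang|lra].
Qed.

Lemma eq_closure (f g : R -> R) (t : R) :
  continuous f t -> continuous g t ->
  (forall h, 0 < h -> exists s, Rabs (s - t) < h /\ g s = f s) -> g t = f t.
Proof.
  intros Cf Cg Hs. apply Rminus_diag_uniq. apply NNPP. intros Hne.
  assert (Hc : continuous (fun s => g s - f s) t) by (apply (continuous_minus g f); assumption).
  assert (Hpos : 0 < Rabs (g t - f t)) by (apply Rabs_pos_lt, Hne).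
  destruct (Hc (fun y => Rabs (y - (g t - f t)) < Rabs (g t - f t))) as [d Hd].
  { exists (mkposreal _ Hpos). intros y Hy. exact Hy. }
  destruct (Hs d (cond_pos d)) as [s [Hst E]]. specialize (Hd s Hst). simpl in Hd.
  rewrite E in Hd. replace (f s - f s - (g t - f t)) with (- (g t - f t)) in Hd by ring.
  rewrite Rabs_Ropp in Hd. lra.
Qed.

(** Near a time [t1] of coincidence both solutions stay in a box where the right-hand side is
    [L]-Lipschitz. The mean value theorem in time then improves any uniform bound on their
    difference by the factor [L * Rabs (s - t1)], at most one half, and iteration gives zero.
    Coincidence passes to limits of times by continuity. *)
Lemma ode_solution_unique (K alpha beta N e A T : R) (v phi rho0 m0 : R -> R)
    (rho m rho' m' : R -> R -> R) :
  0 < e -> analytic v -> kernel phi A ->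
  ode_solution K alpha beta N v phi rho0 m0 e T rho m ->
  ode_solution K alpha beta N v phi rho0 m0 e T rho' m' ->
  forall t, Rabs t < T -> forall x, rho' t x = rho t x /\ m' t x = m t x.
Proof.
  intros He Hv Hk S1 S2.
  assert (Dc : forall f l t x, is_derive_unif f t l -> is_derive (fun s => f s x) t (l x))
    by (intros; apply is_derive_unif_pt; assumption).
  apply (interval_induction T (fun t => forall x, rho' t x = rho t x /\ m' t x = m t x)).
  - intros x. rewrite (ode_rho_init _ _ _ _ _ _ _ _ _ _ _ _ S1), (ode_rho_init _ _ _ _ _ _ _ _ _ _ _ _ S2),
      (ode_m_init _ _ _ _ _ _ _ _ _ _ _ _ S1), (ode_m_init _ _ _ _ _ _ _ _ _ _ _ _ S2).
    split; reflexivity.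
  - intros t1 Ht1 HP.
    assert (E1 : rho' t1 = rho t1)
      by (apply FunctionalExtensionality.functional_extensionality; intros x; apply HP).
    assert (E2 : m' t1 = m t1)
      by (apply FunctionalExtensionality.functional_extensionality; intros x; apply HP).
    pose proof (ode_rho_CT _ _ _ _ _ _ _ _ _ _ _ _ S1 t1 Ht1) as Cr.
    pose proof (ode_m_CT _ _ _ _ _ _ _ _ _ _ _ _ S1 t1 Ht1) as Cm.
    destruct (in_CT_pos_lower _ Cr (fun x => ode_rho_gt0 _ _ _ _ _ _ _ _ _ _ _ _ S1 t1 x Ht1)) as [a [Ha Hal]].
    destruct (in_CT_bound _ Cr) as [b1 [Hb1 HB1]]. destruct (in_CT_bound _ Cm) as [b2 [Hb2 HB2]].
    set (b := b1 + b2 + a + 1).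
    assert (Hab : 0 < a / 2 <= b) by (unfold b; lra).
    destruct (rhs_lip K alpha beta N e A (a / 2) b v phi Hab Hv Hk) as [L [HL HR]].
    assert (B1 : inbox (a / 2) b (rho t1) (m t1)).
    { intros x. specialize (Hal x). specialize (HB1 x). specialize (HB2 x).
      rewrite Rabs_pos_eq in HB1 by lra. unfold b. split; lra. }
    assert (Bd : forall x, Rabs (rhs_rho beta v e (rho t1) (m t1) x) <= L /\
                           Rabs (rhs_m K alpha N v phi e (rho t1) (m t1) x) <= L).
    { intros x. destruct (HR (rho t1) (m t1) (rho t1) (m t1) 0 Cr Cr B1 B1) with (x := x) as (R1 & R2 & _);
        try (intros; rewrite Rminus_diag_eq, Rabs_R0 by reflexivity; lra). split; assumption. }
    destruct (derive_unif_near _ _ L _ (ode_rho_eq _ _ _ _ _ _ _ _ _ _ _ _ S1 t1 Ht1)) as [d1 [Hd1 N1]];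
      [intros; apply Bd|].
    destruct (derive_unif_near _ _ L _ (ode_m_eq _ _ _ _ _ _ _ _ _ _ _ _ S1 t1 Ht1)) as [d2 [Hd2 N2]];
      [intros; apply Bd|].
    destruct (derive_unif_near _ _ L _ (ode_rho_eq _ _ _ _ _ _ _ _ _ _ _ _ S2 t1 Ht1)) as [d3 [Hd3 N3]];
      [intros; rewrite E1, E2; apply Bd|].
    destruct (derive_unif_near _ _ L _ (ode_m_eq _ _ _ _ _ _ _ _ _ _ _ _ S2 t1 Ht1)) as [d4 [Hd4 N4]];
      [intros; rewrite E1, E2; apply Bd|].
    rewrite E1 in N3. rewrite E2 in N4.
    (* The first entry keeps both solutions within [Rmin 1 (a / 2)] of their common value, hence in
       the box; the second gives [L * h0 <= / 2]. *)
    set (h0 := Rmin (Rmin 1 (a / 2) / (L + 1)) (/ (2 * (L + 1)))).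
    assert (Hmin : 0 < Rmin 1 (a / 2)) by (apply Rmin_glb_lt; lra).
    assert (Hh0 : 0 < h0).
    { apply Rmin_glb_lt; [apply Rdiv_lt_0_compat; lra|apply Rinv_0_lt_compat; lra]. }
    assert (Hh1 : (L + 1) * h0 <= Rmin 1 (a / 2)).
    { apply Rle_trans with ((L + 1) * (Rmin 1 (a / 2) / (L + 1))).
      - apply Rmult_le_compat_l; [lra|apply Rmin_l].
      - right; field; lra. }
    assert (Hh2 : L * h0 <= / 2).
    { apply Rle_trans with ((L + 1) * h0); [apply Rmult_le_compat_r; lra|].
      apply Rle_trans with ((L + 1) * / (2 * (L + 1))).
      - apply Rmult_le_compat_l; [lra|apply Rmin_r].
      - right; field; lra. }
    pose proof (Rmin_l 1 (a / 2)) as Hm1. pose proof (Rmin_r 1 (a / 2)) as Hm2.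
    exists (Rmin h0 (Rmin (Rmin d1 d2) (Rmin d3 d4))).
    split; [apply Rmin_glb_lt; [exact Hh0|repeat apply Rmin_glb_lt; assumption]|].
    set (h := Rmin h0 (Rmin (Rmin d1 d2) (Rmin d3 d4))).
    assert (Hh : h <= h0 /\ h <= d1 /\ h <= d2 /\ h <= d3 /\ h <= d4).
    { unfold h. pose proof (Rmin_l h0 (Rmin (Rmin d1 d2) (Rmin d3 d4))).
      pose proof (Rmin_r h0 (Rmin (Rmin d1 d2) (Rmin d3 d4))).
      pose proof (Rmin_l (Rmin d1 d2) (Rmin d3 d4)). pose proof (Rmin_r (Rmin d1 d2) (Rmin d3 d4)).
      pose proof (Rmin_l d1 d2). pose proof (Rmin_r d1 d2).
      pose proof (Rmin_l d3 d4). pose proof (Rmin_r d3 d4). repeat split; lra. }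
    assert (Box : forall r q s, Rabs (s - t1) < h ->
      (forall x, Rabs (r x - rho t1 x) <= (L + 1) * Rabs (s - t1)) ->
      (forall x, Rabs (q x - m t1 x) <= (L + 1) * Rabs (s - t1)) -> inbox (a / 2) b r q).
    { intros r q s Hs Hr Hq x. specialize (Hr x). specialize (Hq x).
      assert (HS : (L + 1) * Rabs (s - t1) <= Rmin 1 (a / 2)).
      { apply Rle_trans with ((L + 1) * h0); [|exact Hh1]. apply Rmult_le_compat_l; lra. }
      specialize (Hal x). specialize (HB1 x). specialize (HB2 x).
      rewrite Rabs_pos_eq in HB1 by lra.
      assert (Hr' : Rabs (r x - rho t1 x) <= Rmin 1 (a / 2)) by lra.
      apply Rabs_le_between in Hr'.
      split; [unfold b; lra|].
      replace (q x) with ((q x - m t1 x) + m t1 x) by ring.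
      eapply Rle_trans; [apply Rabs_triang|]. unfold b. lra. }
    (* The induction starts from [2 * b], which bounds the differences inside the box, and each step
       halves the bound on the whole time interval. *)
    assert (Key : forall n s, Rabs (s - t1) < h -> Rabs s < T -> forall x,
      Rabs (rho s x - rho' s x) <= 2 * b * (/ 2) ^ n /\ Rabs (m s x - m' s x) <= 2 * b * (/ 2) ^ n).
    { assert (BX : forall s, Rabs (s - t1) < h -> inbox (a / 2) b (rho s) (m s) /\ inbox (a / 2) b (rho' s) (m' s)).
      { intros s Hs. split; (apply Box with s; [exact Hs| |]); intros x;
          [apply N1|apply N2|apply N3|apply N4]; lra. }
      induction n as [|n IH]; intros s Hs HsT x.
      - destruct (BX s Hs) as [X1 X2]. destruct (X1 x) as [Y1 Y2]. destruct (X2 x) as [Y3 Y4].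
        simpl. rewrite Rmult_1_r. apply Rabs_le_between in Y2, Y4.
        split; apply Rabs_le; lra.
      - set (D := 2 * b * (/ 2) ^ n) in *.
        assert (HD : 0 <= D) by (unfold D; apply Rmult_le_pos; [lra|apply pow_le; lra]).
        assert (Hseg : forall y, Rmin t1 s <= y <= Rmax t1 s -> Rabs (y - t1) < h /\ Rabs y < T).
        { intros y Hy. unfold Rmin, Rmax in Hy. destruct (Rle_dec t1 s);
            unfold Rabs in *; repeat destruct Rcase_abs; lra. }
        assert (HLD : forall y, Rmin t1 s <= y <= Rmax t1 s -> forall x,
          Rabs (rhs_rho beta v e (rho y) (m y) x - rhs_rho beta v e (rho' y) (m' y) x) <= L * D /\
          Rabs (rhs_m K alpha N v phi e (rho y) (m y) x - rhs_m K alpha N v phi e (rho' y) (m' y) x) <= L * D).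
        { intros y Hy z. destruct (Hseg y Hy) as [Hy1 Hy2]. destruct (BX y Hy1) as [X1 X2].
          destruct (HR (rho y) (m y) (rho' y) (m' y) D) with (x := z) as (_ & _ & R3 & R4);
            try assumption; try (intros; apply IH; assumption).
          - apply (ode_rho_CT _ _ _ _ _ _ _ _ _ _ _ _ S1 y Hy2).
          - apply (ode_rho_CT _ _ _ _ _ _ _ _ _ _ _ _ S2 y Hy2).
          - split; assumption. }
        assert (HF : L * D * Rabs (s - t1) <= 2 * b * (/ 2) ^ S n).
        { replace (2 * b * (/ 2) ^ S n) with (D * / 2) by (unfold D; simpl; ring).
          replace (L * D * Rabs (s - t1)) with (D * (L * Rabs (s - t1))) by ring.
          apply Rmult_le_compat_l; [exact HD|].
          apply Rle_trans with (L * h0); [|exact Hh2]. apply Rmult_le_compat_l; lra. }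
        destruct (HP x) as [P1 P2].
        split.
        + eapply Rle_trans; [|exact HF].
          replace (rho s x - rho' s x) with ((rho s x - rho' s x) - (rho t1 x - rho' t1 x)) by (rewrite P1; ring).
          apply (mvt_lipschitz (fun y => rho y x - rho' y x)
            (fun y => rhs_rho beta v e (rho y) (m y) x - rhs_rho beta v e (rho' y) (m' y) x)).
          intros y Hy. split; [|apply (HLD y Hy x)]. destruct (Hseg y Hy) as [_ Hy2].
          apply (is_derive_minus (fun y => rho y x) (fun y => rho' y x)).
          * apply (Dc _ _ y x (ode_rho_eq _ _ _ _ _ _ _ _ _ _ _ _ S1 y Hy2)).
          * apply (Dc _ _ y x (ode_rho_eq _ _ _ _ _ _ _ _ _ _ _ _ S2 y Hy2)).
        + eapply Rle_trans; [|exact HF].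
          replace (m s x - m' s x) with ((m s x - m' s x) - (m t1 x - m' t1 x)) by (rewrite P2; ring).
          apply (mvt_lipschitz (fun y => m y x - m' y x)
            (fun y => rhs_m K alpha N v phi e (rho y) (m y) x - rhs_m K alpha N v phi e (rho' y) (m' y) x)).
          intros y Hy. split; [|apply (HLD y Hy x)]. destruct (Hseg y Hy) as [_ Hy2].
          apply (is_derive_minus (fun y => m y x) (fun y => m' y x)).
          * apply (Dc _ _ y x (ode_m_eq _ _ _ _ _ _ _ _ _ _ _ _ S1 y Hy2)).
          * apply (Dc _ _ y x (ode_m_eq _ _ _ _ _ _ _ _ _ _ _ _ S2 y Hy2)). }
    assert (Z : forall z, (forall n, Rabs z <= 2 * b * (/ 2) ^ n) -> z = 0).
    { intros z Hz. apply Rabs_eq_0. apply Rle_antisym; [|apply Rabs_pos].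
      assert (Lm : is_lim_seq (fun n => 2 * b * (/ 2) ^ n) 0).
      { evar_last; [apply is_lim_seq_scal_l, is_lim_seq_geom; rewrite Rabs_pos_eq; lra|].
        simpl. f_equal; ring. }
      apply (is_lim_seq_le (fun _ => Rabs z) (fun n => 2 * b * (/ 2) ^ n) (Rabs z) 0 Hz);
        [apply is_lim_seq_const|exact Lm]. }
    intros s Hs HsT x. split.
    + assert (rho s x - rho' s x = 0) by (apply Z; intros n; apply Key; assumption). lra.
    + assert (m s x - m' s x = 0) by (apply Z; intros n; apply Key; assumption). lra.
  - intros t Ht Hcl x.
    split.
    + apply (eq_closure (fun s => rho s x) (fun s => rho' s x)).
      * apply ex_derive_cont. eexists. apply (Dc _ _ t x (ode_rho_eq _ _ _ _ _ _ _ _ _ _ _ _ S1 t Ht)).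
      * apply ex_derive_cont. eexists. apply (Dc _ _ t x (ode_rho_eq _ _ _ _ _ _ _ _ _ _ _ _ S2 t Ht)).
      * intros h Hh. destruct (Hcl h Hh) as [s [Hs [_ E]]]. exists s. split; [exact Hs|apply E].
    + apply (eq_closure (fun s => m s x) (fun s => m' s x)).
      * apply ex_derive_cont. eexists. apply (Dc _ _ t x (ode_m_eq _ _ _ _ _ _ _ _ _ _ _ _ S1 t Ht)).
      * apply ex_derive_cont. eexists. apply (Dc _ _ t x (ode_m_eq _ _ _ _ _ _ _ _ _ _ _ _ S2 t Ht)).
      * intros h Hh. destruct (Hcl h Hh) as [s [Hs [_ E]]]. exists s. split; [exact Hs|apply E].
Qed.

Lemma ode_solution_restrict (K alpha beta N e T T' : R) (v phi rho0 m0 : R -> R)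
    (rho m : R -> R -> R) :
  T' <= T -> ode_solution K alpha beta N v phi rho0 m0 e T rho m ->
  ode_solution K alpha beta N v phi rho0 m0 e T' rho m.
Proof.
  intros HT [H1 H2 H3 H4 H5 H6 H7].
  split; try assumption; intros t; intros;
    [apply H1|apply H2|apply H3|apply H4|apply H5]; lra.
Qed.

(** * Uniqueness of the classical solution *)

Lemma geom_PSeries_order (M T t : R) (a : nat -> R) (n : nat) :
  0 < T -> geom M T a -> T * Rabs t <= / 2 ->
  Rabs (PSeries a t - sum_f_R0 (fun k => a k * t ^ k) n) <= 2 * (M * T ^ S n) * Rabs t ^ S n.
Proof.
  intros HT Ha Ht. rewrite (PSeries_decr_n a n t).
  2:{ eexists. apply geom_pseries with M T; eassumption. }
  replace (sum_f_R0 (fun k => a k * t ^ k) n + t ^ S n * PSeries (PS_decr_n a (S n)) t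
    - sum_f_R0 (fun k => a k * t ^ k) n) with (PSeries (PS_decr_n a (S n)) t * t ^ S n) by ring.
  rewrite Rabs_mult, <- RPow_abs. apply Rmult_le_compat_r; [apply pow_le, Rabs_pos|].
  apply geom_PSeries_bound with T; try assumption.
  intros k. unfold PS_decr_n. rewrite Rmult_assoc, <- pow_add. apply Ha.
Qed.

Lemma analytic2_time (f : R -> R -> R) (t0 x : R) :
  analytic2_at f t0 x ->
  exists a r, 0 < r /\ forall t, Rabs (t - t0) < r -> is_pseries a (t - t0) (f t x).
Proof.
  intros (a & r & Hr & H). exists (fun i => a i O), r. split; [exact Hr|].
  intros t Ht. destruct (H t x Ht) as [_ HS]; [rewrite Rminus_diag_eq, Rabs_R0 by reflexivity; exact Hr|].
  apply series_pseries. eapply is_series_ext; [|exact HS].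
  intros n. cbv beta. rewrite sum_n_Reals, <- sum_rev, (sum_extend _ 0 n).
  - simpl sum_f_R0. rewrite Nat.sub_0_r, Nat.sub_diag. simpl. ring.
  - lia.
  - intros i Hi. replace (n - (n - i))%nat with i by lia.
    rewrite (Rminus_diag_eq x x) by reflexivity. rewrite pow_i by lia. ring.
Qed.

Lemma sum_ge_term (b : nat -> R) (n k : nat) :
  (forall l, 0 <= b l) -> (k <= n)%nat -> b k <= sum_f_R0 b n.
Proof.
  intros Hb Hk. induction n as [|n IH].
  - replace k with O by lia. simpl. lra.
  - simpl. destruct (Nat.eq_dec k (S n)) as [->|Hne].
    + pose proof (cond_pos_sum b n Hb). lra.
    + specialize (IH ltac:(lia)). specialize (Hb (S n)). lra.
Qed.

(** [e i k y] is the [k]-th Taylor coefficient at [y] of the [i]-th time coefficient of [f],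
    obtained by re-expanding row [i] of the double series. The bounds hold on a neighbourhood of
    [x1], as differentiation in [x] under the series demands. *)
Lemma analytic2_rows (f : R -> R -> R) (x1 : R) :
  analytic2_at f 0 x1 ->
  exists d r M (e : nat -> nat -> R -> R), 0 < d /\ 0 < r /\ 4 * r * d <= 1 /\
    (forall y, Rabs (y - x1) < d ->
      (forall i k, is_derive (e i k) y (INR (S k) * e i (S k) y)) /\
      (forall k, geom (M k) r (fun i => e i k y)) /\
      forall t, Rabs t < d -> f t y = PSeries (fun i => e i O y) t).
Proof.
  intros (a & r0 & Hr0 & H).
  assert (Hh : 0 < r0 / 2) by lra.
  assert (Hh' : Rabs (r0 / 2) < r0) by (rewrite Rabs_pos_eq; lra).
  (* One corner [(r0 / 2, x1 + r0 / 2)] suffices: the diagonal sums of absolute values tend to zero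
     there, hence are bounded, and each dominates all of its terms. *)
  assert (HM : exists M, 0 <= M /\ forall i j, Rabs (a i j) <= M * (/ (r0 / 2)) ^ (i + j)).
  { destruct (H (r0 / 2) (x1 + r0 / 2)) as [Hex _];
      [rewrite Rminus_0_r; exact Hh'|replace (x1 + r0 / 2 - x1) with (r0 / 2) by ring; exact Hh'|].
    apply ex_series_lim_0 in Hex.
    destruct (filterlim_bounded (K := R_AbsRing) (V := R_NormedModule) _ (ex_intro _ 0 Hex)) as [M HM].
    exists (Rabs M). split; [apply Rabs_pos|]. intros i j.
    specialize (HM (i + j)%nat). rewrite sum_n_Reals in HM.
    change (Rabs (sum_f_R0 (fun i0 => Rabs (a i0 (i + j - i0)%nat * (r0 / 2 - 0) ^ i0 *
      (x1 + r0 / 2 - x1) ^ (i + j - i0))) (i + j)) <= M) in HM.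
    assert (Hterm : Rabs (a i j) * (r0 / 2) ^ (i + j) <= M).
    { eapply Rle_trans; [|exact HM]. eapply Rle_trans; [|apply Rle_abs].
      replace (Rabs (a i j) * (r0 / 2) ^ (i + j)) with
        ((fun i0 => Rabs (a i0 (i + j - i0)%nat * (r0 / 2 - 0) ^ i0 * (x1 + r0 / 2 - x1) ^ (i + j - i0))) i).
      - apply (sum_ge_term (fun i0 => Rabs (a i0 (i + j - i0)%nat * (r0 / 2 - 0) ^ i0 *
          (x1 + r0 / 2 - x1) ^ (i + j - i0)))); [intros; apply Rabs_pos|lia].
      - cbv beta. replace (i + j - i)%nat with j by lia.
        replace (r0 / 2 - 0) with (r0 / 2) by ring. replace (x1 + r0 / 2 - x1) with (r0 / 2) by ring.
        rewrite !Rabs_mult, !(Rabs_pos_eq ((r0 / 2) ^ _)) by (apply pow_le; lra).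
        rewrite pow_add. ring. }
    pose proof (pow_lt (r0 / 2) (i + j) Hh) as Hp.
    rewrite pow_inv. apply Rmult_le_reg_r with ((r0 / 2) ^ (i + j)); [exact Hp|].
    rewrite Rmult_assoc, Rinv_l, Rmult_1_r by lra. pose proof (Rle_abs M). lra. }
  destruct HM as [M [HM0 HM]]. set (r := / (r0 / 2)) in *.
  assert (Hr : 0 < r) by (apply Rinv_0_lt_compat; lra).
  assert (Ed : r * r0 = 2) by (unfold r; field; lra).
  assert (HG : forall i, geom (M * r ^ i) r (a i)).
  { intros i j. rewrite Rmult_assoc, <- pow_add. apply HM. }
  exists (r0 / 8), r, (fun k => 2 * M * (2 * r) ^ k), (fun i k y => shf (a i) k (y - x1)).
  split; [lra|]. split; [exact Hr|]. split; [lra|].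
  intros y Hy. assert (Hs : 4 * r * Rabs (y - x1) <= 1).
  { assert (r * Rabs (y - x1) <= r * (r0 / 8)) by (apply Rmult_le_compat_l; lra). lra. }
  split; [|split].
  - intros i k. apply (is_derive_shift (shf (a i) k) (- x1)).
    apply shf_derive with (M * r ^ i) r; try assumption. apply HG.
  - intros k i.
    eapply Rle_trans; [apply (shf_bound (M * r ^ i) r); [exact Hr|apply HG|exact Hs]|].
    right; ring.
  - intros t Ht. assert (Hst : r * Rabs t <= / 4).
    { assert (r * Rabs t <= r * (r0 / 8)) by (apply Rmult_le_compat_l; lra). lra. }
    symmetry. apply is_pseries_unique. apply series_pseries.
    apply (series_iter_diag (fun i j => a i j * t ^ i * (y - x1) ^ j) _ M).
    + intros i j. rewrite !Rabs_mult, <- !RPow_abs.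
      apply Rle_trans with (M * r ^ (i + j) * Rabs t ^ i * Rabs (y - x1) ^ j).
      * apply Rmult_le_compat_r; [apply pow_le, Rabs_pos|].
        apply Rmult_le_compat_r; [apply pow_le, Rabs_pos|apply HM].
      * replace (M * r ^ (i + j) * Rabs t ^ i * Rabs (y - x1) ^ j)
          with (M * ((r * Rabs t) ^ i * (r * Rabs (y - x1)) ^ j))
          by (rewrite !Rpow_mult_distr, pow_add; ring).
        rewrite pow_add. apply Rmult_le_compat_l; [exact HM0|].
        apply Rmult_le_compat; try (apply pow_le, Rmult_le_pos; [lra|apply Rabs_pos]);
          apply pow_incr; (split; [apply Rmult_le_pos; [lra|apply Rabs_pos]|lra]).
    + intros i. cbv beta.
      pose proof (geom_pseries (M * r ^ i) r (y - x1) (a i) Hr (HG i) ltac:(lra)) as HP.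
      apply pseries_series in HP. rewrite shf_0, Rmult_comm.
      apply is_series_ext with (fun j => scal (t ^ i) (a i j * (y - x1) ^ j)).
      { intros j. unfold scal; simpl; unfold mult; simpl. ring. }
      apply (is_series_scal (t ^ i) _ _ HP).
    + destruct (H t y) as [_ HS]; [rewrite Rminus_0_r; lra|lra|].
      eapply is_series_ext; [|exact HS]. intros n. cbv beta. rewrite sum_n_Reals, Rminus_0_r. reflexivity.
Qed.

(** Defined by [t]-derivatives at 0 rather than from the local double series, whose coefficients
    depend on the base point: this is one function of [x], which can itself be differentiated. *)
Definition tcoef (f : R -> R -> R) (i : nat) (x : R) : R := tay (fun t => f t x) i 0.

Lemma tcoef_0 (f : R -> R -> R) (x : R) : tcoef f 0 x = f 0 x.
Proof. apply (tay_0 (fun t => f t x)). Qed.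

(** The quantities that the equations involve, all expanded in [t] at fixed [x]. The coefficients
    for the [x]-derivative are the derivatives of [tcoef], those for the [t]-derivative the shifted
    ones. *)
Lemma analytic2_expand (f : R -> R -> R) (x : R) (n : nat) :
  analytic2_at f 0 x ->
  exists C d, 0 <= C /\ 0 < d /\ forall t, Rabs t < d ->
    (Rabs (f t x) <= C /\
     Rabs (f t x - sum_f_R0 (fun i => tcoef f i x * t ^ i) n) <= C * Rabs t ^ S n) /\
    (ex_derive (f t) x /\ Rabs (Derive (f t) x) <= C /\
     Rabs (Derive (f t) x - sum_f_R0 (fun i => Derive (tcoef f i) x * t ^ i) n) <= C * Rabs t ^ S n) /\
    Rabs (Derive (fun s => f s x) t
       - sum_f_R0 (fun i => INR (S i) * tcoef f (S i) x * t ^ i) n) <= C * Rabs t ^ S n.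
Proof.
  intros Hf. destruct (analytic2_rows f x Hf) as (d & r & M & e & Hd & Hr & Hrd & H).
  assert (Hx : Rabs (x - x) < d) by (rewrite Rminus_diag_eq, Rabs_R0 by reflexivity; exact Hd).
  assert (Hsm : forall t, Rabs t < d -> 4 * r * Rabs t <= 1).
  { intros t Ht. assert (r * Rabs t <= r * d) by (apply Rmult_le_compat_l; lra). lra. }
  assert (Hfam : forall y, Rabs (y - x) < d -> forall j t, Rabs t < d ->
     Derive_n (fun s => f s y) j t = INR (fact j) * shf (fun i => e i O y) j t).
  { intros y Hy j t Ht. destruct (H y Hy) as (_ & G & E).
    destruct (fam_Derive_n (shf (fun i => e i O y)) (fun s => f s y) 0 d) with (j := j) (x := t)
      as [_ E2]; [| |rewrite Rminus_0_r; exact Ht|exact E2].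
    - intros i s Hs. rewrite Rminus_0_r in Hs. apply shf_derive with (M O) r; [exact Hr|apply G|apply Hsm, Hs].
    - intros s Hs. rewrite Rminus_0_r in Hs. rewrite shf_0. apply E, Hs. }
  assert (Hc : forall y, Rabs (y - x) < d -> forall i, tcoef f i y = e i O y).
  { intros y Hy i. unfold tcoef, tay. rewrite (Hfam y Hy i 0) by (rewrite Rabs_R0; exact Hd).
    rewrite shf_at_0. field. apply INR_fact_neq_0. }
  assert (Hloc : locally x (fun y => Rabs (y - x) < d))
    by (exists (mkposreal d Hd); intros y Hy; exact Hy).
  assert (Hc1 : forall i, Derive (tcoef f i) x = e i 1%nat x).
  { intros i. rewrite (Derive_ext_loc _ (e i O)).
    - destruct (H x Hx) as (D & _ & _). specialize (D i O).
      rewrite (is_derive_unique _ _ _ D). simpl. ring.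
    - eapply filter_imp; [|exact Hloc]. intros y Hy. apply Hc, Hy. }
  destruct (H x Hx) as (Dx & Gx & Ex).
  set (C0 := 2 * (M O * r ^ S n)). set (C1 := 2 * (M 1%nat * r ^ S n)).
  set (C2 := 2 * (M O * r * (2 * r) ^ S n)).
  assert (HM : forall k, 0 <= M k).
  { intros k. specialize (Gx k O). simpl in Gx. pose proof (Rabs_pos (e O k x)). lra. }
  assert (P : forall m s, 0 <= m -> 0 < s -> 0 <= 2 * (m * s ^ S n)).
  { intros m s Hm Hs. pose proof (pow_lt s (S n) Hs). assert (0 <= m * s ^ S n) by nra. lra. }
  assert (P0 : 0 <= C0) by (apply P; auto). assert (P1 : 0 <= C1) by (apply P; auto).
  assert (P2 : 0 <= C2) by (apply P; [|lra]; apply Rmult_le_pos; [apply HM|lra]).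
  pose proof (HM O) as HM0. pose proof (HM 1%nat) as HM1.
  exists (C0 + C1 + C2 + 2 * M O + 2 * M 1%nat), d. split; [lra|]. split; [exact Hd|].
  intros t Ht. specialize (Hsm t Ht). pose proof (Rabs_pos t) as Ht0.
  assert (Hrt : r * Rabs t <= / 2) by lra.
  assert (Htn : 0 <= Rabs t ^ S n) by (apply pow_le, Ht0).
  assert (Hle : forall c z, 0 <= c -> c <= C0 + C1 + C2 + 2 * M O + 2 * M 1%nat ->
     Rabs z <= c * Rabs t ^ S n -> Rabs z <= (C0 + C1 + C2 + 2 * M O + 2 * M 1%nat) * Rabs t ^ S n).
  { intros c z _ Hcc Hz. eapply Rle_trans; [exact Hz|]. apply Rmult_le_compat_r; assumption. }
  split; [|split].
  - rewrite (Ex t Ht). split.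
    + eapply Rle_trans; [apply (geom_PSeries_bound (M O) r); try assumption; apply Gx|]. lra.
    + apply Hle with C0; [assumption|lra|].
      rewrite (sum_ext _ (fun i => e i O x * t ^ i)) by (intros; rewrite Hc by exact Hx; reflexivity).
      apply geom_PSeries_order; try assumption. apply Gx.
  - assert (D : is_derive (f t) x (PSeries (fun i => e i 1%nat x) t)).
    { apply is_derive_ext_loc with (fun y => PSeries (fun i => e i O y) t).
      { eapply filter_imp; [|exact Hloc]. intros y Hy. symmetry. apply (H y Hy), Ht. }
      apply (pseries_derive_param (fun i => e i O) (fun i => e i 1%nat)
        (fun i y => INR 2 * e i 2%nat y) (M O + M 1%nat) (INR 2 * M 2%nat) r t x d); try assumption.
      - intros i y Hy. destruct (H y Hy) as (D & _ & _). split; [|apply (D i 1%nat)].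
        evar_last; [apply (D i O)|]. simpl. ring.
      - intros y Hy. destruct (H y Hy) as (_ & G & _).
        assert (GL : forall a b u, a <= b -> geom a r u -> geom b r u).
        { intros a b u Hab Hu i. eapply Rle_trans; [apply Hu|].
          apply Rmult_le_compat_r; [apply pow_le; lra|exact Hab]. }
        split; [|split].
        + apply GL with (M O); [lra|apply G].
        + apply GL with (M 1%nat); [lra|apply G].
        + intros i. rewrite Rabs_mult, (Rabs_pos_eq (INR 2)), Rmult_assoc by apply pos_INR.
          apply Rmult_le_compat_l; [apply pos_INR|apply G]. }
    split; [eexists; exact D|]. rewrite (is_derive_unique _ _ _ D). split.
    + eapply Rle_trans; [apply (geom_PSeries_bound (M 1%nat) r); try assumption; apply Gx|]. lra.
    + apply Hle with C1; [assumption|lra|].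
      rewrite (sum_ext _ (fun i => e i 1%nat x * t ^ i)) by (intros; rewrite Hc1; reflexivity).
      apply geom_PSeries_order; try assumption. apply Gx.
  - assert (D : Derive (fun s => f s x) t = PSeries (PS_derive (fun i => e i O x)) t).
    { change (Derive_n (fun s => f s x) 1 t = PSeries (PS_derive (fun i => e i O x)) t).
      rewrite (Hfam x Hx 1%nat t Ht). simpl INR. rewrite Rmult_1_l.
      apply PSeries_ext. intros i. unfold PS_derive.
      pose proof (W_succ_r i 0) as HW. rewrite W_0r, Nat.add_0_r, Rmult_1_r in HW.
      change (INR 1) with 1 in HW. rewrite Rmult_1_l in HW. rewrite HW, Nat.add_1_r. reflexivity. }
    rewrite D. apply Hle with C2; [assumption|lra|].
    rewrite (sum_ext _ (fun i => PS_derive (fun i => e i O x) i * t ^ i)).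
    + apply geom_PSeries_order; [lra|apply geom_PS_derive; [lra|apply Gx]|lra].
    + intros i _. unfold PS_derive. rewrite Hc by exact Hx. reflexivity.
Qed.

(** * Agreement to a given order in time *)

Definition sim (n : nat) (f g : R -> R) : Prop :=
  exists C d, 0 <= C /\ 0 < d /\ forall t, Rabs t < d ->
    Rabs (f t) <= C /\ Rabs (g t) <= C /\ Rabs (f t - g t) <= C * Rabs t ^ n.

Lemma sim_ext (n : nat) (f g f' g' : R -> R) (d : R) :
  0 < d -> (forall t, Rabs t < d -> f' t = f t /\ g' t = g t) -> sim n f g -> sim n f' g'.
Proof.
  intros Hd E (C & d' & HC & Hd' & H). exists C, (Rmin d d').
  split; [exact HC|]. split; [apply Rmin_glb_lt; assumption|].
  intros t Ht. destruct (E t) as [E1 E2]; [eapply Rlt_le_trans; [exact Ht|apply Rmin_l]|].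
  rewrite E1, E2. apply H. eapply Rlt_le_trans; [exact Ht|apply Rmin_r].
Qed.

Lemma sim_plus (n : nat) (f g f' g' : R -> R) :
  sim n f g -> sim n f' g' -> sim n (fun t => f t + f' t) (fun t => g t + g' t).
Proof.
  intros (C & d & HC & Hd & H) (C' & d' & HC' & Hd' & H').
  exists (C + C'), (Rmin d d'). split; [lra|]. split; [apply Rmin_glb_lt; assumption|].
  intros t Ht.
  destruct (H t) as (A1 & A2 & A3); [eapply Rlt_le_trans; [exact Ht|apply Rmin_l]|].
  destruct (H' t) as (B1 & B2 & B3); [eapply Rlt_le_trans; [exact Ht|apply Rmin_r]|].
  split; [|split].
  - eapply Rle_trans; [apply Rabs_triang|lra].
  - eapply Rle_trans; [apply Rabs_triang|lra].
  - replace (f t + f' t - (g t + g' t)) with ((f t - g t) + (f' t - g' t)) by ring.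
    eapply Rle_trans; [apply Rabs_triang|lra].
Qed.

(** The bounds included in [sim] serve here: [f f' - g g'] is split so that each difference is
    multiplied by a bounded factor. *)
Lemma sim_mult (n : nat) (f g f' g' : R -> R) :
  sim n f g -> sim n f' g' -> sim n (fun t => f t * f' t) (fun t => g t * g' t).
Proof.
  intros (C & d & HC & Hd & H) (C' & d' & HC' & Hd' & H').
  exists (2 * (C * C')), (Rmin d d').
  assert (HCC : 0 <= C * C') by (apply Rmult_le_pos; assumption).
  split; [lra|]. split; [apply Rmin_glb_lt; assumption|].
  intros t Ht.
  destruct (H t) as (A1 & A2 & A3); [eapply Rlt_le_trans; [exact Ht|apply Rmin_l]|].
  destruct (H' t) as (B1 & B2 & B3); [eapply Rlt_le_trans; [exact Ht|apply Rmin_r]|].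
  split; [|split].
  - rewrite Rabs_mult. apply Rle_trans with (C * C'); [|lra].
    apply Rmult_le_compat; try apply Rabs_pos; assumption.
  - rewrite Rabs_mult. apply Rle_trans with (C * C'); [|lra].
    apply Rmult_le_compat; try apply Rabs_pos; assumption.
  - replace (f t * f' t - g t * g' t) with ((f t - g t) * f' t + g t * (f' t - g' t)) by ring.
    eapply Rle_trans; [apply Rabs_triang|]. rewrite !Rabs_mult.
    apply Rle_trans with (C * Rabs t ^ n * C' + C * (C' * Rabs t ^ n)); [|right; ring].
    apply Rplus_le_compat; apply Rmult_le_compat; try apply Rabs_pos; assumption.
Qed.

Lemma sim_const (n : nat) (c : R) : sim n (fun _ => c) (fun _ => c).
Proof.
  exists (Rabs c), 1. split; [apply Rabs_pos|]. split; [lra|]. intros t _.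
  rewrite Rminus_diag_eq, Rabs_R0 by reflexivity. split; [lra|]. split; [lra|].
  apply Rmult_le_pos; [apply Rabs_pos|apply pow_le, Rabs_pos].
Qed.

Lemma sim_inv (n : nat) (f g : R -> R) (a d : R) :
  0 < a -> 0 < d -> (forall t, Rabs t < d -> a <= f t /\ a <= g t) ->
  sim n f g -> sim n (fun t => / f t) (fun t => / g t).
Proof.
  intros Ha Hd Hl (C & d' & HC & Hd' & H).
  assert (Hia : 0 < / a) by (apply Rinv_0_lt_compat, Ha).
  exists (/ a + / a * / a * C), (Rmin d d').
  assert (H0 : 0 <= / a * / a * C) by (repeat apply Rmult_le_pos; lra).
  split; [lra|]. split; [apply Rmin_glb_lt; assumption|].
  intros t Ht.
  destruct (Hl t) as [L1 L2]; [eapply Rlt_le_trans; [exact Ht|apply Rmin_l]|].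
  destruct (H t) as (_ & _ & A3); [eapply Rlt_le_trans; [exact Ht|apply Rmin_r]|].
  assert (B : forall z, a <= z -> 0 < / z <= / a)
    by (intros z Hz; split; [apply Rinv_0_lt_compat; lra|apply Rinv_le_contravar; lra]).
  pose proof (B _ L1) as B1. pose proof (B _ L2) as B2.
  split; [rewrite Rabs_pos_eq; lra|]. split; [rewrite Rabs_pos_eq; lra|].
  replace (/ f t - / g t) with (- (/ f t * / g t * (f t - g t))) by (field; lra).
  rewrite Rabs_Ropp, !Rabs_mult, (Rabs_pos_eq (/ f t)), (Rabs_pos_eq (/ g t)) by lra.
  apply Rle_trans with (/ a * / a * (C * Rabs t ^ n)).
  - apply Rmult_le_compat; [|apply Rabs_pos| |exact A3].
    + apply Rmult_le_pos; lra.
    + apply Rmult_le_compat; lra.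
  - rewrite <- Rmult_assoc. apply Rmult_le_compat_r; [apply pow_le, Rabs_pos|lra].
Qed.

(** The coefficients are compared at all [y] and not only at [x]; this lets the agreement pass to
    the [x]-derivatives. *)
Lemma sim_expand (f g : R -> R -> R) (x : R) (n : nat) :
  analytic2_at f 0 x -> analytic2_at g 0 x ->
  (forall i y, (i <= n)%nat -> tcoef f i y = tcoef g i y) ->
  sim (S n) (fun t => f t x) (fun t => g t x) /\
  sim (S n) (fun t => Derive (f t) x) (fun t => Derive (g t) x).
Proof.
  intros Hf Hg E.
  destruct (analytic2_expand f x n Hf) as (C & d & HC & Hd & H).
  destruct (analytic2_expand g x n Hg) as (C' & d' & HC' & Hd' & H').
  split; exists (C + C'), (Rmin d d'); (split; [lra|]); (split; [apply Rmin_glb_lt; assumption|]);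
    intros t Ht;
    (destruct (H t) as ((A1 & A2) & (_ & A3 & A4) & _); [eapply Rlt_le_trans; [exact Ht|apply Rmin_l]|]);
    (destruct (H' t) as ((B1 & B2) & (_ & B3 & B4) & _); [eapply Rlt_le_trans; [exact Ht|apply Rmin_r]|]).
  - rewrite (sum_ext _ (fun i => tcoef g i x * t ^ i)) in A2 by (intros; rewrite E by lia; reflexivity).
    set (s := sum_f_R0 (fun i => tcoef g i x * t ^ i) n) in *.
    split; [lra|]. split; [lra|].
    replace (f t x - g t x) with ((f t x - s) + - (g t x - s)) by ring.
    eapply Rle_trans; [apply Rabs_triang|]. rewrite Rabs_Ropp. lra.
  - rewrite (sum_ext _ (fun i => Derive (tcoef g i) x * t ^ i)) in A4
      by (intros i Hi; rewrite (Derive_ext (tcoef f i) (tcoef g i)) by (intros; apply E; lia); reflexivity).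
    set (s := sum_f_R0 (fun i => Derive (tcoef g i) x * t ^ i) n) in *.
    split; [lra|]. split; [lra|].
    replace (Derive (f t) x - Derive (g t) x) with ((Derive (f t) x - s) + - (Derive (g t) x - s)) by ring.
    eapply Rle_trans; [apply Rabs_triang|]. rewrite Rabs_Ropp. lra.
Qed.

(** The coefficient of index [S n] is, up to the factor [INR (S n)], the one of index [n] of the
    time derivative. A discrepancy [z] there contributes [z * t ^ n], too large for an error of
    order [t ^ S n] once [t] is small. *)
Lemma sim_tcoef (f g : R -> R -> R) (x : R) (n : nat) :
  analytic2_at f 0 x -> analytic2_at g 0 x ->
  (forall i, (i <= n)%nat -> tcoef f i x = tcoef g i x) ->
  sim (S n) (fun t => Derive (fun s => f s x) t) (fun t => Derive (fun s => g s x) t) ->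
  tcoef f (S n) x = tcoef g (S n) x.
Proof.
  intros Hf Hg E (C0 & d0 & HC0 & Hd0 & H0).
  destruct (analytic2_expand f x n Hf) as (C & d & HC & Hd & H).
  destruct (analytic2_expand g x n Hg) as (C' & d' & HC' & Hd' & H').
  apply Rminus_diag_uniq. apply NNPP. intros Hne.
  set (z := INR (S n) * (tcoef f (S n) x - tcoef g (S n) x)).
  assert (Hz : 0 < Rabs z).
  { apply Rabs_pos_lt. unfold z. apply Rmult_integral_contrapositive.
    split; [apply not_0_INR; lia|exact Hne]. }
  set (t := Rmin (Rabs z / (2 * (C0 + C + C' + 1))) (Rmin d0 (Rmin d d') / 2)).
  assert (Hmm : 0 < Rmin d0 (Rmin d d')) by (repeat apply Rmin_glb_lt; assumption).
  assert (Ht : 0 < t) by (apply Rmin_glb_lt; [apply Rdiv_lt_0_compat; lra|lra]).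
  assert (Ht1 : t <= Rabs z / (2 * (C0 + C + C' + 1))) by apply Rmin_l.
  assert (Ht2 : t <= Rmin d0 (Rmin d d') / 2) by apply Rmin_r.
  pose proof (Rmin_l d0 (Rmin d d')). pose proof (Rmin_r d0 (Rmin d d')).
  pose proof (Rmin_l d d'). pose proof (Rmin_r d d').
  assert (At : Rabs t = t) by (apply Rabs_pos_eq; lra).
  destruct (H0 t) as (_ & _ & A); [lra|].
  destruct (H t) as (_ & _ & A1); [lra|]. destruct (H' t) as (_ & _ & A2); [lra|].
  rewrite At in *.
  set (p := Derive (fun s => f s x) t) in *. set (q := Derive (fun s => g s x) t) in *.
  set (sf := sum_f_R0 (fun i => INR (S i) * tcoef f (S i) x * t ^ i) n) in *.
  set (sg := sum_f_R0 (fun i => INR (S i) * tcoef g (S i) x * t ^ i) n) in *.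
  assert (Es : sf - sg = z * t ^ n).
  { unfold sf, sg, z. rewrite <- sum_minus_distr. destruct n as [|n].
    - simpl. ring.
    - rewrite tech5, sum_zero; [ring|]. intros i Hi. rewrite E by lia. ring. }
  assert (B : Rabs (z * t ^ n) <= (C0 + C + C') * t ^ S n).
  { rewrite <- Es. replace (sf - sg) with ((p - q) + (- (p - sf) + (q - sg))) by ring.
    eapply Rle_trans; [apply Rabs_triang|].
    pose proof (Rabs_triang (- (p - sf)) (q - sg)) as H5. rewrite Rabs_Ropp in H5. lra. }
  pose proof (pow_lt t n Ht) as Hp.
  rewrite Rabs_mult, (Rabs_pos_eq (t ^ n)) in B by lra.
  replace ((C0 + C + C') * t ^ S n) with ((C0 + C + C') * t * t ^ n) in B by (simpl; ring).
  apply Rmult_le_reg_r in B; [|exact Hp].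
  apply Rmult_le_compat_l with (r := C0 + C + C' + 1) in Ht1; [|lra].
  replace ((C0 + C + C' + 1) * (Rabs z / (2 * (C0 + C + C' + 1)))) with (Rabs z / 2) in Ht1
    by (field; lra).
  lra.
Qed.

(** After the product and chain rules, with [rho] times the derivative of [K ln rho] equal to [K]
    times that of [rho], the time derivatives are polynomials in [m], [1 / rho] and the
    [x]-derivatives, all of them operations that preserve [sim]. *)
Lemma classical_equations (K T t x : R) (rho0 m0 : R -> R) (rho m : R -> R -> R) :
  classical_solution K rho0 m0 T rho m -> Rabs t < T ->
  ex_derive (rho t) x -> ex_derive (m t) x ->
  Derive (fun s => rho s x) t = -1 * Derive (m t) x /\
  Derive (fun s => m s x) t =
    -2 * (m t x * / rho t x) * Derive (m t) x
    + ((m t x * / rho t x) * (m t x * / rho t x) + - K) * Derive (rho t) x.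
Proof.
  intros U Ht Dr Dm.
  pose proof (cl_rho_gt0 _ _ _ _ _ _ U t x Ht) as Hp.
  pose proof (cl_mass _ _ _ _ _ _ U t x Ht) as E1.
  pose proof (cl_momentum _ _ _ _ _ _ U t x Ht) as E2.
  split; [lra|].
  assert (D1 : is_derive (fun y => rho t y * velocity (rho t) (m t) y ^ 2) x
    (2 * (m t x * / rho t x) * Derive (m t) x
     - (m t x * / rho t x) * (m t x * / rho t x) * Derive (rho t) x)).
  { unfold velocity. auto_derive; [repeat split; try assumption; lra|].
    change (fun y => rho t y) with (rho t). change (fun y => m t y) with (m t). field. lra. }
  assert (D2 : is_derive (fun y => K * ln (rho t y)) x (K * (Derive (rho t) x * / rho t x))).
  { auto_derive; [repeat split; assumption|]. change (fun y => rho t y) with (rho t). field. lra. }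
  assert (F1 : Derive (fun y => rho t y * velocity (rho t) (m t) y ^ 2) x =
    2 * (m t x * / rho t x) * Derive (m t) x
     - (m t x * / rho t x) * (m t x * / rho t x) * Derive (rho t) x) by (apply is_derive_unique, D1).
  assert (F2 : Derive (fun y => K * ln (rho t y)) x = K * (Derive (rho t) x * / rho t x))
    by (apply is_derive_unique, D2).
  rewrite F1, F2 in E2.
  replace (rho t x * (K * (Derive (rho t) x * / rho t x))) with (K * Derive (rho t) x) in E2 by (field; lra).
  lra.
Qed.

Lemma classical_tcoef (K T : R) (rho0 m0 : R -> R) (rho m rho' m' : R -> R -> R) :
  0 < T ->
  classical_solution K rho0 m0 T rho m -> classical_solution K rho0 m0 T rho' m' ->
  forall n x, tcoef rho n x = tcoef rho' n x /\ tcoef m n x = tcoef m' n x.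
Proof.
  intros HT U U'.
  assert (H0 : Rabs 0 < T) by (rewrite Rabs_R0; exact HT).
  assert (Ar := fun x => cl_rho_analytic _ _ _ _ _ _ U 0 x H0).
  assert (Am := fun x => cl_m_analytic _ _ _ _ _ _ U 0 x H0).
  assert (Ar' := fun x => cl_rho_analytic _ _ _ _ _ _ U' 0 x H0).
  assert (Am' := fun x => cl_m_analytic _ _ _ _ _ _ U' 0 x H0).
  assert (All : forall n i x, (i <= n)%nat -> tcoef rho i x = tcoef rho' i x /\ tcoef m i x = tcoef m' i x).
  2:{ intros n x. apply (All n n x (le_n _)). }
  induction n as [|n IH]; intros i x Hi.
  - replace i with O by lia. rewrite !tcoef_0.
    rewrite (cl_rho_init _ _ _ _ _ _ U), (cl_rho_init _ _ _ _ _ _ U'),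
      (cl_m_init _ _ _ _ _ _ U), (cl_m_init _ _ _ _ _ _ U'). split; reflexivity.
  - destruct (Nat.eq_dec i (S n)) as [->|Hne]; [|apply IH; lia].
    destruct (sim_expand rho rho' x n (Ar x) (Ar' x)) as [Sr Srx]; [intros; apply IH; assumption|].
    destruct (sim_expand m m' x n (Am x) (Am' x)) as [Sm Smx]; [intros; apply IH; assumption|].
    destruct (analytic2_expand rho x 0 (Ar x)) as (C1 & d1 & HC1 & Hd1 & X1).
    destruct (analytic2_expand rho' x 0 (Ar' x)) as (C2 & d2 & HC2 & Hd2 & X2).
    destruct (analytic2_expand m x 0 (Am x)) as (C3 & d3 & HC3 & Hd3 & X3).
    destruct (analytic2_expand m' x 0 (Am' x)) as (C4 & d4 & HC4 & Hd4 & X4).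
    set (a := rho0 x / 2).
    assert (Ha : 0 < rho0 x).
    { rewrite <- (cl_rho_init _ _ _ _ _ _ U x). apply (cl_rho_gt0 _ _ _ _ _ _ U 0 x H0). }
    (* Besides [T] and the radii of the four expansions, the entry [a / (C1 + C2 + 1)] makes the
       order-zero expansions keep both densities above [a], half the initial value, as [sim_inv]
       requires. *)
    set (d := Rmin (Rmin T (a / (C1 + C2 + 1))) (Rmin (Rmin d1 d2) (Rmin d3 d4))).
    assert (Hd : 0 < d).
    { repeat apply Rmin_glb_lt; try assumption. apply Rdiv_lt_0_compat; unfold a; lra. }
    assert (Hds : forall t, Rabs t < d -> Rabs t < T /\ Rabs t < a / (C1 + C2 + 1) /\
       Rabs t < d1 /\ Rabs t < d2 /\ Rabs t < d3 /\ Rabs t < d4).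
    { intros t Ht. unfold d in Ht.
      apply Rmin_Rgt in Ht. destruct Ht as [T1 T2]. apply Rmin_Rgt in T1, T2.
      destruct T1 as [T3 T4]. destruct T2 as [T5 T6]. apply Rmin_Rgt in T5, T6. tauto. }
    assert (Hlow : forall t, Rabs t < d -> a <= rho t x /\ a <= rho' t x).
    { intros t Ht. destruct (Hds t Ht) as (T1 & T2 & T3 & T4 & _ & _).
      destruct (X1 t T3) as ((_ & Y1) & _). destruct (X2 t T4) as ((_ & Y2) & _).
      simpl in Y1, Y2. rewrite !Rmult_1_r, tcoef_0 in Y1, Y2.
      rewrite (cl_rho_init _ _ _ _ _ _ U) in Y1. rewrite (cl_rho_init _ _ _ _ _ _ U') in Y2.
      assert (T2' : (C1 + C2 + 1) * Rabs t <= a).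
      { apply Rlt_le in T2. apply Rmult_le_compat_l with (r := C1 + C2 + 1) in T2; [|lra].
        replace ((C1 + C2 + 1) * (a / (C1 + C2 + 1))) with a in T2 by (field; lra). exact T2. }
      pose proof (Rabs_pos t).
      assert (0 <= C1 * Rabs t /\ 0 <= C2 * Rabs t) by (split; apply Rmult_le_pos; assumption).
      apply Rabs_le_between in Y1, Y2. unfold a in *. lra. }
    assert (Eq : forall t, Rabs t < d ->
      Derive (fun s => rho s x) t = -1 * Derive (m t) x /\
      Derive (fun s => m s x) t =
        -2 * (m t x * / rho t x) * Derive (m t) x
        + ((m t x * / rho t x) * (m t x * / rho t x) + - K) * Derive (rho t) x).
    { intros t Ht. destruct (Hds t Ht) as (T1 & T2 & T3 & T4 & T5 & T6).
      destruct (X1 t T3) as (_ & (Z1 & _) & _). destruct (X3 t T5) as (_ & (Z2 & _) & _).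
      apply (classical_equations K T t x rho0 m0); assumption. }
    assert (Eq' : forall t, Rabs t < d ->
      Derive (fun s => rho' s x) t = -1 * Derive (m' t) x /\
      Derive (fun s => m' s x) t =
        -2 * (m' t x * / rho' t x) * Derive (m' t) x
        + ((m' t x * / rho' t x) * (m' t x * / rho' t x) + - K) * Derive (rho' t) x).
    { intros t Ht. destruct (Hds t Ht) as (T1 & T2 & T3 & T4 & T5 & T6).
      destruct (X2 t T4) as (_ & (Z1 & _) & _). destruct (X4 t T6) as (_ & (Z2 & _) & _).
      apply (classical_equations K T t x rho0 m0); assumption. }
    assert (Si := sim_inv _ _ _ a d ltac:(unfold a; lra) Hd Hlow Sr).
    assert (Su := sim_mult _ _ _ _ _ Sm Si).
    split.
    + apply sim_tcoef; [apply Ar|apply Ar'|intros; apply IH; assumption|].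
      eapply sim_ext; [exact Hd| |exact (sim_mult _ _ _ _ _ (sim_const _ (-1)) Smx)].
      intros t Ht. split; [apply (Eq t Ht)|apply (Eq' t Ht)].
    + apply sim_tcoef; [apply Am|apply Am'|intros; apply IH; assumption|].
      eapply sim_ext; [exact Hd| |exact (sim_plus _ _ _ _ _
        (sim_mult _ _ _ _ _ (sim_mult _ _ _ _ _ (sim_const _ (-2)) Su) Smx)
        (sim_mult _ _ _ _ _ (sim_plus _ _ _ _ _ (sim_mult _ _ _ _ _ Su Su) (sim_const _ (- K))) Srx))].
      intros t Ht. split; [apply (Eq t Ht)|apply (Eq' t Ht)].
Qed.

(** What is propagated is equality of all Taylor coefficients, since equality of values at one time
    is not an open condition. It is open because the local series then coincide, and closed because
    derivatives of every order are continuous. *)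
Lemma pseries_identity (T : R) (f g : R -> R) :
  (forall t, Rabs t < T -> exists a r, 0 < r /\ forall s, Rabs (s - t) < r -> is_pseries a (s - t) (f s)) ->
  (forall t, Rabs t < T -> exists a r, 0 < r /\ forall s, Rabs (s - t) < r -> is_pseries a (s - t) (g s)) ->
  (forall j, tay g j 0 = tay f j 0) ->
  forall t, Rabs t < T -> g t = f t.
Proof.
  intros Hf Hg H0 t Ht. rewrite <- (tay_0 f), <- (tay_0 g). revert t Ht.
  enough (A : forall t, Rabs t < T -> forall j, tay g j t = tay f j t) by (intros; apply A; assumption).
  apply (interval_induction T (fun t => forall j, tay g j t = tay f j t)); [exact H0| |].
  - intros t Ht HP.
    destruct (Hf t Ht) as (a & r & Hr & Ha). destruct (Hg t Ht) as (b & r' & Hr' & Hb).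
    destruct (pseries_local f a t r Hr Ha) as (_ & _ & _ & _ & Ea).
    destruct (pseries_local g b t r' Hr' Hb) as (_ & _ & _ & _ & Eb).
    exists (Rmin r r'). split; [apply Rmin_glb_lt; assumption|].
    assert (E : forall s, Rabs (s - t) < Rmin r r' -> g s = f s).
    { intros s Hs.
      assert (S1 := Ha s ltac:(eapply Rlt_le_trans; [exact Hs|apply Rmin_l])).
      assert (S2 := Hb s ltac:(eapply Rlt_le_trans; [exact Hs|apply Rmin_r])).
      rewrite <- (is_pseries_unique _ _ _ S1), <- (is_pseries_unique _ _ _ S2).
      apply PSeries_ext. intros j. rewrite <- Ea, <- Eb. apply HP. }
    intros s Hs _ j. unfold tay. f_equal. apply Derive_n_ext_loc.
    exists (mkposreal (Rmin r r' - Rabs (s - t)) ltac:(lra)). intros y Hy. apply E.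
    change (Rabs (y - s) < Rmin r r' - Rabs (s - t)) in Hy.
    replace (y - t) with ((y - s) + (s - t)) by ring.
    eapply Rle_lt_trans; [apply Rabs_triang|lra].
  - intros t Ht Hcl j.
    assert (C : forall h : R -> R, (exists a r, 0 < r /\ forall s, Rabs (s - t) < r -> is_pseries a (s - t) (h s)) ->
              continuous (tay h j) t).
    { intros h (a & r & Hr & Ha). destruct (pseries_local h a t r Hr Ha) as (d & M & Hd & Hx & _).
      apply (continuous_mult (Derive_n h j) (fun _ => / INR (fact j))); [|apply continuous_const].
      apply ex_derive_cont. apply (Hx t) with (j := S j).
      rewrite Rminus_diag_eq, Rabs_R0 by reflexivity. exact Hd. }
    apply (eq_closure (tay f j) (tay g j) t (C f (Hf t Ht)) (C g (Hg t Ht))).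
    intros h Hh. destruct (Hcl h Hh) as [s [Hs [_ E]]]. exists s. split; [exact Hs|apply E].
Qed.

Lemma classical_solution_unique (K T : R) (rho0 m0 : R -> R) (rho m rho' m' : R -> R -> R) :
  classical_solution K rho0 m0 T rho m -> classical_solution K rho0 m0 T rho' m' ->
  forall t x, Rabs t < T -> rho' t x = rho t x /\ m' t x = m t x.
Proof.
  intros U U' t x Ht. assert (HT : 0 < T) by (pose proof (Rabs_pos t); lra).
  assert (E := classical_tcoef K T rho0 m0 rho m rho' m' HT U U').
  split.
  - apply (pseries_identity T (fun s => rho s x) (fun s => rho' s x)); [| | |exact Ht].
    + intros s Hs. apply analytic2_time, (cl_rho_analytic _ _ _ _ _ _ U s x Hs).
    + intros s Hs. apply analytic2_time, (cl_rho_analytic _ _ _ _ _ _ U' s x Hs).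
    + intros j. symmetry. apply (E j x).
  - apply (pseries_identity T (fun s => m s x) (fun s => m' s x)); [| | |exact Ht].
    + intros s Hs. apply analytic2_time, (cl_m_analytic _ _ _ _ _ _ U s x Hs).
    + intros s Hs. apply analytic2_time, (cl_m_analytic _ _ _ _ _ _ U' s x Hs).
    + intros j. symmetry. apply (E j x).
Qed.

Lemma classical_solution_restrict (K T T' : R) (rho0 m0 : R -> R) (rho m : R -> R -> R) :
  T' <= T -> classical_solution K rho0 m0 T rho m -> classical_solution K rho0 m0 T' rho m.
Proof.
  intros HT [H1 H2 H3 H4 H5 H6 H7 H8 H9].
  split; try assumption; intros t; intros;
    [apply H1|apply H2|apply H3|apply H4|apply H5|apply H6|apply H7]; lra.
Qed.

(** The constants [c] and [d] only have to be large, so sums of the bounds found on the data are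
    taken in place of maxima. *)
Lemma setup_exists (K alpha beta N : R) (v phi rho0 m0 : R -> R) :
  0 <= K -> 0 < alpha -> 0 < beta -> 0 < N ->
  analytic v -> mollifier phi ->
  analytic rho0 -> periodic rho0 -> analytic m0 -> periodic m0 -> (forall x, 0 < rho0 x) ->
  exists U : setup, pK U = K /\ pal U = alpha /\ pbe U = beta /\ pN U = N /\
    pv U = v /\ pphi U = phi /\ pr U = rho0 /\ pm U = m0.
Proof.
  intros hK ha hb hN hv hphi hr hrp hm hmp hpos.
  destruct (mollifier_kernel phi hphi) as [A hA].
  destruct (in_CT_pos_lower rho0 (analytic_in_CT _ hr hrp) hpos) as [a [Ha Hal]].
  destruct (in_CT_bound rho0 (analytic_in_CT _ hr hrp)) as [b1 [Hb1 HB1]].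
  destruct (in_CT_bound m0 (analytic_in_CT _ hm hmp)) as [b2 [Hb2 HB2]].
  assert (Hia : 0 < / a) by (apply Rinv_0_lt_compat, Ha).
  set (c := 1 + b1 + b2 + / a).
  assert (Hc : 1 <= c) by (unfold c; lra).
  destruct (tay_periodic_bound rho0 hr hrp) as [d1 [Hd1 HD1]].
  destruct (tay_periodic_bound m0 hm hmp) as [d2 [Hd2 HD2]].
  destruct (tay_compact v (- (c ^ 2 + 1)) (c ^ 2 + 1) hv) as [d3 [Hd3 HD3]].
  pose proof (pow2_ge_0 c) as Hc2.
  (* [c ^ 2] answers to [h_cd2], and [d1], [d2], [d3] to the Taylor coefficients of the data and of
     [v]. The last group is the constant of [lnH_bound] on [[/ (2 * c), c + 2]]; it also dominates
     the [2 * c] of [h_cd] and of [invH_bound]. *)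
  set (d := c ^ 2 + d1 + d2 + d3 + (2 * c + (c + 2))).
  assert (Hd : forall b j, 0 <= b <= d -> b ^ S j <= d ^ S j)
    by (intros; apply pow_incr; assumption).
  unshelve eexists (Build_setup K alpha beta N v phi rho0 m0 A c d
    hK ha hb hN hv hA hr hrp hm hmp Hc _ _ _ _ _ _ _ _ _ _); [..|repeat split].
  - unfold d; lra.
  - unfold d; lra.
  - intros x. apply Rle_trans with a; [|apply Hal].
    rewrite <- (Rinv_inv a). apply Rinv_le_contravar; unfold c; lra.
  - intros x. specialize (HB1 x). apply Rabs_le_between in HB1. unfold c; lra.
  - intros x. specialize (HB2 x). unfold c; lra.
  - intros x k. eapply Rle_trans; [apply HD1|]. apply Hd. unfold d; lra.
  - intros x k. eapply Rle_trans; [apply HD2|]. apply Hd. unfold d; lra.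
  - intros y j Hy. eapply Rle_trans; [apply HD3, Rabs_le_between, Hy|]. apply Hd. unfold d; lra.
  - intros y j Hy. eapply Rle_trans; [apply (invH_bound (2 * c)); [lra|exact Hy]|].
    apply (Hd (2 * c)). unfold d; lra.
  - intros y j Hy. eapply Rle_trans; [apply (lnH_bound (2 * c) (c + 2)); lra|].
    apply (Hd (2 * c + (c + 2))). unfold d; lra.
Qed.

Theorem proposition2 (K alpha beta N delta : R) (v phi rho0 m0 : R -> R)
    (hK : 0 <= K) (halpha : 0 < alpha < 1) (hbeta : 0 < beta)
    (hN : 0 < N) (hdelta : 0 < delta)
    (hv : analytic v)
    (hv_bounds : forall u, Rabs u < v u <= Rabs u + delta)
    (hphi : mollifier phi)
    (hrho0 : analytic rho0) (hrho0_per : periodic rho0)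
    (hm0 : analytic m0) (hm0_per : periodic m0)
    (hrho0_pos : forall x, 0 < rho0 x) :
  exists t0 eps0 : R, 0 < t0 /\ 0 < eps0 /\
  exists rho m : R -> R -> R,
    is_the_solution (classical_solution K rho0 m0) t0 rho m /\
  exists rho_ m_ : R -> R -> R -> R,
    (forall eps, 0 < eps < eps0 ->
       is_the_solution (ode_solution K alpha beta N v phi rho0 m0 eps) t0
         (rho_ eps) (m_ eps)) /\
    (forall t, Rabs t < t0 ->
       cvg_unif (fun eps => rho_ eps t) (rho t) /\
       cvg_unif (fun eps => m_ eps t) (m t)).
Proof.
  destruct (setup_exists K alpha beta N v phi rho0 m0) as (U & E1 & E2 & E3 & E4 & E5 & E6 & E7 & E8);
    try assumption; [lra|].
  (* All estimates hold for [0 <= e < 1] with the same constants, so one time serves every [e] and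
     the limit, and [eps0] may be 1. *)
  exists (tmax U), 1. split; [apply tmax_pos|]. split; [lra|].
  exists (prho U 0), (pmom U 0). split.
  - pose proof (classical_solution_exists U) as H. rewrite E1, E7, E8 in H.
    split; [exact H|]. intros T' rho' m' H' t x Ht Ht'.
    (* The competitor lives on its own interval, shorter or longer; the comparison takes place on
       the smaller of the two. *)
    apply (classical_solution_unique K (Rmin (tmax U) T') rho0 m0).
    + apply classical_solution_restrict with (tmax U); [apply Rmin_l|exact H].
    + apply classical_solution_restrict with T'; [apply Rmin_r|exact H'].
    + apply Rmin_glb_lt; assumption.
  - exists (prho U), (pmom U). split; [|intros t Ht; apply sol_cvg, Ht].
    intros e He. pose proof (ode_solution_exists U e He) as H.
    rewrite E1, E2, E3, E4, E5, E6, E7, E8 in H.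
    split; [exact H|]. intros T' rho' m' H' t x Ht Ht'.
    destruct (mollifier_kernel phi hphi) as [A hA].
    apply (ode_solution_unique K alpha beta N e A (Rmin (tmax U) T') v phi rho0 m0);
      [lra|exact hv|exact hA| | |apply Rmin_glb_lt; assumption].
    + apply ode_solution_restrict with (tmax U); [apply Rmin_l|exact H].
    + apply ode_solution_restrict with T'; [apply Rmin_r|exact H'].
Qed.
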